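(* In the setting described in the context (a fixed mesh), let $v=U_1+U_2+U_3$. As $t\downarrow0$, $$\|q_h^Q(tv)\|_{\mathsf V^{-1}}=\Theta(t^3),\qquad \operatorname{dist}_{H^1}(tv,\mathcal F_h^Q)=\Theta(t),\qquad q_h^I(tv)=0.$$ Consequently no local residual--distance upper bound with exponent greater than $1/3$ holds at zero: there are no constants $C>0$, $\theta>1/3$ and neighborhood of $0$ in $\mathcal U_h$ on which $\operatorname{dist}_{H^1}(u,\mathcal F_h^Q)\le C\|q_h^Q(u)\|_{\mathsf V^{-1}}^{\theta}$. When all cells satisfy the cellwise admission hypotheses stated in the context, so that $\operatorname{dist}_{H^1}(u,\mathcal F_h^Q)\le C\|q_h^Q(u)\|_{\mathsf V^{-1}}^{1/3}$ with $C=\sqrt{1+C_P^2}\,L_2\gamma_0^{-1/3}|\Omega|^{1/3}$ for all $u\in\mathcal U_h$, the exponent $1/3$ in this upper bound is therefore optimal.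
   Context: $\Omega\subset\mathbb R^3$ is a bounded Lipschitz domain with a conforming, face-connected mesh (cell adjacency graph through shared interior faces is connected) of $m$ affine hexahedra $K_e=X_e([-1,1]^3)$, $X_e(\xi)=b_e+A_e\xi$, $\det A_e>0$, $V_e=|K_e|=8\det A_e$. $\mathbb Q_p$ denotes polynomials of degree at most $p$ in each coordinate, $p\ge3$. $\mathcal U_h$ is the full space of continuous fields $u:\Omega\to\mathbb R^3$ with $u\circ X_e\in\mathbb Q_p^3$ on every cell and zero trace on $\partial\Omega$. Face parameterizations are compatible, so that for every interior face shared by two cells and every constant vector $c$, the field equal on each of the two cells to $c$ times the product of the two tangential factors $1-\xi_j^2$ and a linear factor equal to one on the shared face and vanishing on the opposite face (zero on other cells) belongs to $\mathcal U_h$. On cell $e$, $\mathcal G_{n_e}$ is the tensor Gauss--Legendre rule on $[-1,1]^3$ with $n_e\ge p+1$ points per coordinate ($\mathcal G_{n_e}[1]=8$). With $y_e=X_e+u\circ X_e$, $$q_{h,e}^Q(u)=\mathcal G_{n_e}[\det D_\xi y_e-\det A_e],\qquad q_{h,e}^I(u)=\int_{[-1,1]^3}(\det D_\xi y_e-\det A_e)\,d\xi,$$ and $q_h^r=(q_{h,1}^r,\dots,q_{h,m}^r)^T$, $r\in\{Q,I\}$. $\mathcal F_h^Q=\{u\in\mathcal U_h:q_h^Q(u)=0\}$. At least one cell $e_*$ has $2n_{e_*}<3p$. Put $n=n_{e_*}$, $A(t)=1-t^2$, $B(t)=t(1-t^2)$, $d=2n-2p+1$, $f(x)=x^{d-2}(1-x^2)$,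 $g(x)=x^{p-2}(1-x^2)$ and, for $\xi=(x,y,z)$, $$W_1=(f(x)A(y)A(z),0,0),\quad W_2=(0,g(x)B(y)A(z),0),\quad W_3=(0,0,g(x)A(y)B(z)).$$ $U_i\in\mathcal U_h$ is given by $U_i(X_{e_*}(\xi))=A_{e_*}W_i(\xi)$ on $K_{e_*}$, zero elsewhere. Norms: $\|q\|_{\mathsf V^{-1}}=(\sum_eq_e^2/V_e)^{1/2}$; $\|u\|_{H^1}^2=\int_\Omega(|u|^2+\|\nabla_Xu\|_F^2)$; $\operatorname{dist}_{H^1}(u,\mathcal F)=\inf_{w\in\mathcal F}\|u-w\|_{H^1}$; $C_P$ is a Poincaré constant, $\|u\|_{L^2}\le C_P\|\nabla_X u\|_{L^2}$ on $H^1_0(\Omega;\mathbb R^3)$. Cellwise admission hypotheses: every cell $K_e$ has three directions $U_{e,i}\in\mathcal U_h$, $i=1,2,3$, supported in $\overline{K_e}$ and zero on $\partial K_e$, such that for every $u\in\mathcal U_h$ the map $a\mapsto q_{h,e}^Q(u+\sum_ia_iU_{e,i})$ is affine in each of $a_1,a_2,a_3$ separately with coefficient $\gamma_e$ of $a_1a_2a_3$ independent of $u$, these changes leave all other components of $q_h^Q$ unchanged, and for common positive constants $\gamma_0,L_2,L_\infty$ and all $e,a$: $|\gamma_e|\ge\gamma_0V_e$, $(\int_{K_e}\|\nabla_X\sum_ia_iU_{e,i}\|_F^2)^{1/2}\le L_2\sqrt{V_e}\max_i|a_i|$, and $\|\nabla_X\sum_ia_iU_{e,i}\|_{L^\infty(K_e)}\le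 L_\infty\max_i|a_i|$. *)

(* Defs.v *)
(* Points of R^3 are column vectors ['cV[R]_3], over any [R : realType]. *)
From HB Require Import structures.
From mathcomp Require Import all_boot all_order all_algebra.
From mathcomp Require Import all_classical all_reals all_analysis.
From mathcomp Require polyrcf.

Set Implicit Arguments.
Unset Strict Implicit.
Unset Printing Implicit Defensive.

Import Order.TTheory GRing.Theory Num.Theory.
Import numFieldTopology.Exports numFieldNormedType.Exports.

Local Open Scope classical_set_scope.
Local Open Scope ring_scope.

Section Calculus.
Context {R : realType}.

Definition vec3 (x y z : R) : 'cV[R]_3 := \col_(i < 3) [:: x; y; z]`_i.

Definition pt3 (x : R * R * R) : 'cV[R]_3 := vec3 x.1.1 x.1.2 x.2.

(* The library has Lebesgue measure on R only, and no measurable structure on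
   matrices: Lebesgue measure on R^3 is the threefold product measure, and
   subsets of ['cV[R]_3] are pulled back along the bijection [pt3]. *)
Definition leb3 :
    {measure set (measurableTypeR R * measurableTypeR R * measurableTypeR R)
       -> \bar R} :=
  ((@lebesgue_measure R \x @lebesgue_measure R) \x @lebesgue_measure R)%E.

Definition vol (D : set 'cV[R]_3) : R := fine (leb3 (pt3 @^-1` D)).

Definition int3 (D : set 'cV[R]_3) (f : 'cV[R]_3 -> R) : R :=
  \int[leb3]_(x in pt3 @^-1` D) f (pt3 x).

Definition frob2 m n (M : 'M[R]_(m, n)) : R := \sum_i \sum_j M i j ^+ 2.

(* Jacobian matrix (also the gradient of a vector field), row = component,
   column = direction.  For a piecewise smooth field it is the almost
   everywhere defined gradient; its values on the null set where the field is
   not differentiable are irrelevant under the integrals below. *)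
Definition Dmx (F : 'cV[R]_3 -> 'cV[R]_3) (x : 'cV[R]_3) : 'M[R]_3 :=
  \matrix_(i, j) 'D_(delta_mx j 0) (fun y => F y i 0) x.

Definition H1norm (Om : set 'cV[R]_3) (u : 'cV[R]_3 -> 'cV[R]_3) : R :=
  Num.sqrt (int3 Om (fun x => frob2 (u x) + frob2 (Dmx u x))).

Definition distH1 (Om : set 'cV[R]_3) (u : 'cV[R]_3 -> 'cV[R]_3)
    (F : set ('cV[R]_3 -> 'cV[R]_3)) : R :=
  inf [set H1norm Om (fun x => u x - w x) | w in F].

Definition C1c (Om : set 'cV[R]_3) (phi : 'cV[R]_3 -> 'cV[R]_3) : Prop :=
  [/\ forall x, differentiable phi x,
      continuous (Dmx phi),
      compact (closure [set x | phi x != 0]) &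
      closure [set x | phi x != 0] `<=` Om].

(* [u] belongs to H^1_0(Om; R^3), the closure of C^1_c(Om; R^3) in H^1, and
   [G] is its weak gradient. *)
Definition H10 (Om : set 'cV[R]_3) (u : 'cV[R]_3 -> 'cV[R]_3)
    (G : 'cV[R]_3 -> 'M[R]_3) : Prop :=
  [/\ forall i, measurable_fun (pt3 @^-1` Om)
        ((fun x => u (pt3 x) i 0) :
           measurableTypeR R * measurableTypeR R * measurableTypeR R -> R),
      forall i j, measurable_fun (pt3 @^-1` Om)
        ((fun x => G (pt3 x) i j) :
           measurableTypeR R * measurableTypeR R * measurableTypeR R -> R) &
      exists2 phi : nat -> 'cV[R]_3 -> 'cV[R]_3, forall k, C1c Om (phi k) &
        (fun k => \int[leb3]_(x in pt3 @^-1` Om)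
           (frob2 (phi k (pt3 x) - u (pt3 x)) +
            frob2 (Dmx (phi k) (pt3 x) - G (pt3 x)))%:E)%E @ \oo --> 0%E].

Definition poincare_constant (Om : set 'cV[R]_3) (CP : R) : Prop :=
  forall u G, H10 Om u G ->
    Num.sqrt (int3 Om (fun x => frob2 (u x)))
      <= CP * Num.sqrt (int3 Om (fun x => frob2 (G x))).

(* Near each boundary point, Om is the strict epigraph of a Lipschitz function
   in some orthonormal system of coordinates [Q *m y]. *)
Definition lipschitz_boundary (Om : set 'cV[R]_3) : Prop :=
  forall x, (closure Om `\` Om°) x ->
    exists (Q : 'M[R]_3) (h : R * R -> R),
      [/\ Q *m Q^T = 1%:M,
          lipschitz h &
          \forall y \near x,
            Om y <-> h ((Q *m y) 0 0, (Q *m y) 1 0) < (Q *m y) 2%:R 0].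

Definition bounded_lipschitz_domain (Om : set 'cV[R]_3) : Prop :=
  [/\ Om !=set0, open Om, connected Om, bounded_set Om &
      lipschitz_boundary Om].

End Calculus.

Section Mesh.
Context {R : realType} {m : nat}.

Record hexes := Hexes {
  hexA : 'I_m -> 'M[R]_3;
  hexb : 'I_m -> 'cV[R]_3;
  hexA_det : forall e, 0 < \det (hexA e) }.

Variables (Om : set 'cV[R]_3) (T : hexes).

Definition cube : set 'cV[R]_3 := [set xi | forall i, -1 <= xi i 0 <= 1].

(* A face of the reference cube, of any dimension: coordinate [j] is free when
   [s j = None], and fixed to [(-1) ^+ b] when [s j = Some b]. *)
Definition ref_face (s : 'I_3 -> option bool) : set 'cV[R]_3 :=
  [set xi | cube xi /\ forall j b, s j = Some b -> xi j 0 = (-1) ^+ b].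

Definition ref_facet (j : 'I_3) (b : bool) : set 'cV[R]_3 :=
  ref_face (fun i => if i == j then Some b else None).

Definition cellX (e : 'I_m) (xi : 'cV[R]_3) : 'cV[R]_3 :=
  hexb T e + hexA T e *m xi.

Definition cellXinv (e : 'I_m) (x : 'cV[R]_3) : 'cV[R]_3 :=
  invmx (hexA T e) *m (x - hexb T e).

Definition cell (e : 'I_m) : set 'cV[R]_3 := cellX e @` cube.

(* Equal to [8 * \det (hexA T e)]. *)
Definition cellV (e : 'I_m) : R := vol (cell e).

Definition conforming_mesh : Prop :=
  [/\ closure Om = \bigcup_e cell e,
      forall e f, e != f -> (cell e)° `&` (cell f)° = set0 &
      forall e f, e != f -> cell e `&` cell f = set0 \/
        exists s t, cell e `&` cell f = cellX e @` ref_face s /\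
                    cell e `&` cell f = cellX f @` ref_face t].

Definition shared_facet (e f : 'I_m) (j : 'I_3) (b : bool) (k : 'I_3) (c : bool)
    : Prop :=
  [/\ e != f, cell e `&` cell f = cellX e @` ref_facet j b &
      cell e `&` cell f = cellX f @` ref_facet k c].

Definition cell_adjacent : rel 'I_m :=
  fun e f => `[< exists j b k c, shared_facet e f j b k c >].

Definition face_connected : Prop := forall e f, connect cell_adjacent e f.

Variable p : nat.

Definition Qp (F : 'cV[R]_3 -> R) : Prop :=
  exists c : 'I_p.+1 -> 'I_p.+1 -> 'I_p.+1 -> R,
    forall xi, cube xi ->
      F xi = \sum_i \sum_j \sum_k
               c i j k * xi 0 0 ^+ i * xi 1 0 ^+ j * xi 2%:R 0 ^+ k.

(* Fields with zero trace are identified with their extensions by zero to R^3,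
   so that an element of the space is determined by its values in Om. *)
Definition Uh : set ('cV[R]_3 -> 'cV[R]_3) :=
  [set u : 'cV[R]_3 -> 'cV[R]_3 |
           [/\ continuous u,
               forall x, ~ Om x -> u x = 0 &
               forall e i, Qp (fun xi => u (cellX e xi) i 0)]].

(* Product of the two tangential factors [1 - xi_i ^ 2] and of the linear
   factor equal to 1 on the facet [xi_j = (-1) ^+ b] and to 0 on the opposite
   one. *)
Definition facet_bubble (j : 'I_3) (b : bool) (xi : 'cV[R]_3) : R :=
  (\prod_(i < 3 | i != j) (1 - xi i 0 ^+ 2)) *
  ((1 + (-1) ^+ b * xi j 0) / 2).

Definition facet_field (e f : 'I_m) (j : 'I_3) (b : bool) (k : 'I_3) (c : bool)
    (a : 'cV[R]_3) (x : 'cV[R]_3) : 'cV[R]_3 :=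
  if x \in cell e then facet_bubble j b (cellXinv e x) *: a
  else if x \in cell f then facet_bubble k c (cellXinv f x) *: a
  else 0.

Definition facets_compatible : Prop :=
  forall e f j b k c, shared_facet e f j b k c ->
    forall a, Uh (facet_field e f j b k c a).

End Mesh.

Arguments hexes R m : clear implicits.

Section Quadrature.
Context {R : realType}.

Definition legendre (n : nat) : {poly R} :=
  (2 ^+ n * n`!%:R)^-1 *: (('X^2 - 1) ^+ n)^`(n).

Definition gl_nodes (n : nat) : seq R := polyrcf.roots (legendre n) (-1) 1.

(* Integral of the Lagrange basis polynomial of the node [x]. *)
Definition gl_weight (n : nat) (x : R) : R :=
  \int[@lebesgue_measure R]_(t in `[-1, 1])
    \prod_(y <- gl_nodes n | y != x) ((t - y) / (x - y)).

Definition gauss3 (n : nat) (F : 'cV[R]_3 -> R) : R :=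
  \sum_(x <- gl_nodes n) \sum_(y <- gl_nodes n) \sum_(z <- gl_nodes n)
    gl_weight n x * gl_weight n y * gl_weight n z * F (vec3 x y z).

End Quadrature.

Section Residual.
Context {R : realType} {m : nat}.
Variables (Om : set 'cV[R]_3) (T : hexes R m) (p : nat) (ne : 'I_m -> nat).

Definition vol_defect (e : 'I_m) (u : 'cV[R]_3 -> 'cV[R]_3) (xi : 'cV[R]_3)
    : R :=
  \det (Dmx (fun eta => cellX T e eta + u (cellX T e eta)) xi)
    - \det (hexA T e).

Definition qQ (u : 'cV[R]_3 -> 'cV[R]_3) (e : 'I_m) : R :=
  gauss3 (ne e) (vol_defect e u).

Definition qI (u : 'cV[R]_3 -> 'cV[R]_3) (e : 'I_m) : R :=
  int3 cube (vol_defect e u).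

Definition qnorm (q : 'I_m -> R) : R :=
  Num.sqrt (\sum_e q e ^+ 2 / cellV T e).

Definition FhQ : set ('cV[R]_3 -> 'cV[R]_3) :=
  [set u | Uh Om T p u /\ forall e, qQ u e = 0].

(* All norms on the finite-dimensional space are equivalent, so neighbourhoods
   of 0 are taken in the H^1 norm. *)
Definition local_error_bound (theta : R) : Prop :=
  exists C delta : R, [/\ 0 < C, 0 < delta &
    forall u, Uh Om T p u -> H1norm Om u < delta ->
      distH1 Om u FhQ <= C * qnorm (qQ u) `^ theta].

Definition optimal_exponent (theta : R) : Prop :=
  local_error_bound theta /\
  forall theta', theta < theta' -> ~ local_error_bound theta'.

Definition comb3 (U : 'I_3 -> 'cV[R]_3 -> 'cV[R]_3) (a : 'I_3 -> R)
    (x : 'cV[R]_3) : 'cV[R]_3 := \sum_i a i *: U i x.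

Definition max3 (a : 'I_3 -> R) : R := \big[Num.max/0]_i `|a i|.

(* A function of [a] is affine in each [a i] separately exactly when it is a
   combination of the monomials [\prod_(i in S) a i], [S : {set 'I_3}]. *)
Definition cell_admission (gamma0 L2 Linf : R) (e : 'I_m) : Prop :=
  exists (U : 'I_3 -> 'cV[R]_3 -> 'cV[R]_3) (gamma : R),
  [/\ forall i, Uh Om T p (U i) /\ (forall x, ~ (cell T e)° x -> U i x = 0),
      forall u, Uh Om T p u ->
        (exists2 c : {set 'I_3} -> R, c [set: 'I_3]%SET = gamma &
           forall a, qQ (fun x => u x + comb3 U a x) e
                     = \sum_(S : {set 'I_3}) c S * \prod_(i in S) a i) /\
        (forall a f, f != e -> qQ (fun x => u x + comb3 U a x) f = qQ u f),
      gamma0 * cellV T e <= `|gamma|,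
      forall a, Num.sqrt (int3 (cell T e) (fun x => frob2 (Dmx (comb3 U a) x)))
                <= L2 * Num.sqrt (cellV T e) * max3 a &
      forall a, (Lnorm leb3 +oo (fun x =>
                   (Num.sqrt (frob2 (Dmx (comb3 U a) (pt3 x)))
                      * \1_(cell T e) (pt3 x))%:E)
                 <= (Linf * max3 a)%:E)%E].

End Residual.

Section Direction.
Context {R : realType} {m : nat}.
Variables (T : hexes R m) (p n : nat).

Definition bumpA (t : R) : R := 1 - t ^+ 2.
Definition bumpB (t : R) : R := t * (1 - t ^+ 2).

Definition expd : nat := (2 * n - 2 * p + 1)%N.

Definition bumpf (x : R) : R := x ^+ (expd - 2) * (1 - x ^+ 2).
Definition bumpg (x : R) : R := x ^+ (p - 2) * (1 - x ^+ 2).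

Definition W1 (xi : 'cV[R]_3) : 'cV[R]_3 :=
  vec3 (bumpf (xi 0 0) * bumpA (xi 1 0) * bumpA (xi 2%:R 0)) 0 0.
Definition W2 (xi : 'cV[R]_3) : 'cV[R]_3 :=
  vec3 0 (bumpg (xi 0 0) * bumpB (xi 1 0) * bumpA (xi 2%:R 0)) 0.
Definition W3 (xi : 'cV[R]_3) : 'cV[R]_3 :=
  vec3 0 0 (bumpg (xi 0 0) * bumpA (xi 1 0) * bumpB (xi 2%:R 0)).

Definition cell_field (e : 'I_m) (W : 'cV[R]_3 -> 'cV[R]_3) (x : 'cV[R]_3)
    : 'cV[R]_3 :=
  if x \in cell T e then hexA T e *m W (cellXinv T e x) else 0.

Definition dirv (e : 'I_m) (x : 'cV[R]_3) : 'cV[R]_3 :=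
  cell_field e W1 x + cell_field e W2 x + cell_field e W3 x.

End Direction.

(* Main.v *)
Require Import Defs.
From HB Require Import structures.
From mathcomp Require Import all_boot all_order all_algebra.
From mathcomp Require Import all_classical all_reals all_analysis.
From mathcomp Require Import measurable_realfun borel_hierarchy.
From mathcomp Require polyrcf.
From mathcomp Require Import ring lra zify.

Set Implicit Arguments.
Unset Strict Implicit.
Unset Printing Implicit Defensive.

Import Order.TTheory GRing.Theory Num.Theory.
Import numFieldTopology.Exports numFieldNormedType.Exports.

Local Open Scope classical_set_scope.
Local Open Scope ring_scope.

(** Let [G] be the gradient of a discrete field [u] on a cell with matrix [A].
    The volume defect is [\det A * (\det (1 + G) - 1)]: a linear and a quadratic
    part in [G], plus [\det G] (vol_defectE). The first two parts have degree at
    most [2 * p] per coordinate, so the Gauss rule with at least [p + 1] points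
    integrates them exactly, and they are null Lagrangians, so their integrals
    over all cells add up to zero because [u] vanishes on the boundary
    (sum_minors0). Hence the sum of all residuals is a cubic form in the
    gradients at the quadrature nodes (sum_qQ). Null Lagrangian identities are
    proved for Lipschitz fields: for central differences they are exact
    consequences of translation invariance, and dominated convergence gives
    the limit (null_lagrangian).

    Residual of the direction. For [v] the Jacobian determinant in the reference
    cell is a sum of products of one-variable polynomials. The tangential factors
    are integrated exactly and contribute [3 * beta ^+ 2] with [beta != 0]; the
    remaining factor is the derivative of [f * g ^+ 2]. Its exact integral is a
    boundary term, which is zero, whereas its degree is exactly [2 * n], where
    the rule is off by a multiple of the integral of the squared nodal
    polynomial (gauss1_defect). So the exact residual of [t v] is zero, and the
    quadrature residual is [t ^+ 3] times a positive constant in the cell of [v]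
    and zero elsewhere (qI_tv, qQ_tv).

    Distance of the direction. The weights of the rule are positive and the
    squared gradient is integrated exactly, so the H1 norm controls the gradient
    at every node (node_gradient_le). The sum of the residuals is therefore
    continuous in the H1 norm; it vanishes on the constraint set and is positive
    at [v], so [v] keeps a positive distance from its zero set (dirv_far). The
    zero set is a cone, since the sum is cubic, and the distance of [t v] is at
    least [c * t]; it is at most a multiple of [t] because 0 satisfies the
    constraints. Comparing [t] with [t ^+ (3 * theta)] excludes every exponent
    [theta > 3^-1] (no_better_exponent).

    Upper bound. In an admissible cell the residual is a multi-affine function
    of three parameters. If it is [q] at the origin and its top coefficient is
    [gamma], it has a zero whose parameters are at most the cube root of
    [|q / gamma|]: among the vertices of the cube with this half-width, one has a
    value of sign opposite to [q] (multiaffine_root). Correcting the cells one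
    after the other reaches the constraint set (cellwise_correction). Each
    correction is supported in one cell and belongs to H^1_0, as multiplication
    by cutoffs shows (cell_field_H10), so the Poincare inequality applies to it;
    Jensen's inequality then sums the contributions of the cells
    (distance_le). *)

(** * Gauss-Legendre quadrature on [-1, 1] *)

Section PolynomialIntegral.
Context {R : realType}.
Implicit Types p q : {poly R}.

(** Integrals of polynomials over [-1, 1] are kept algebraic, so that linearity
    and integration by parts need no integrability argument. *)
Definition antideriv p : {poly R} := \poly_(i < (size p).+1) (p`_i.-1 / i%:R).

Lemma deriv_antideriv p : (antideriv p)^`() = p.
Proof.
apply/polyP => i; rewrite coef_deriv coef_poly ltnS /=.
case: ltnP => [ip|pi]; last by rewrite mul0rn nth_default.
by rewrite -[LHS]mulr_natr mulfVK// pnatr_eq0.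
Qed.

Definition pint p : R := (antideriv p).[1] - (antideriv p).[-1].

Lemma pint_deriv p : pint p^`() = p.[1] - p.[-1].
Proof.
rewrite /pint; set Q := antideriv _.
have dQ : (Q - p)^`() = 0 by rewrite derivB deriv_antideriv subrr.
have QpE : Q - p = ((Q - p)`_0)%:P.
  apply/polyP => -[|i]; rewrite coefC//=.
  move/polyP : dQ => /(_ i); rewrite coef_deriv coef0 => /eqP.
  by rewrite mulrn_eq0/= => /eqP.
have E x : Q.[x] = p.[x] + (Q - p)`_0.
  have := congr1 (horner^~ x) QpE; rewrite /= hornerD hornerN hornerC => <-.
  by rewrite [RHS]addrC subrK.
by rewrite !E; ring.
Qed.

Lemma pintD p q : pint (p + q) = pint p + pint q.
Proof.
rewrite -{1}(deriv_antideriv p) -{1}(deriv_antideriv q) -derivD.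
by rewrite pint_deriv !hornerD /pint; ring.
Qed.

Lemma pintZ a p : pint (a *: p) = a * pint p.
Proof.
rewrite -{1}(deriv_antideriv p) -derivZ.
by rewrite pint_deriv !hornerZ /pint; ring.
Qed.

Lemma pint_sum (I : Type) (r : seq I) (F : I -> {poly R}) :
  pint (\sum_(i <- r) F i) = \sum_(i <- r) pint (F i).
Proof.
elim: r => [|i r IH]; last by rewrite !big_cons pintD IH.
by rewrite !big_nil -(scale0r 0) pintZ mul0r.
Qed.

Lemma Rintegral_horner p :
  \int[@lebesgue_measure R]_(t in `[-1, 1]) p.[t] = pint p.
Proof.
have l11 : (-1 : R) < 1 by lra.
rewrite /Rintegral (@continuous_FTC2 _ (horner p) (horner (antideriv p)) _ _ l11) //.
- exact/continuous_subspaceT/continuous_horner.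
- split=> [x _| |].
  + by apply: derivable_horner.
  + by apply: cvg_at_right_filter; exact: continuous_horner.
  + by apply: cvg_at_left_filter; exact: continuous_horner.
- by move=> x _; rewrite -derivE deriv_antideriv.
Qed.

(** A primitive of a square is nondecreasing; if its values at the endpoints
    agreed it would take that value at infinitely many points. *)
Lemma pint_sqr_gt0 p : p != 0 -> 0 < pint (p ^+ 2).
Proof.
move=> p0; set Q := antideriv (p ^+ 2).
have dQ x : Q^`().[x] = p.[x] ^+ 2 by rewrite deriv_antideriv horner_exp.
have Qmono : {in `[-1, 1] &, {homo horner Q : x y / x <= y}}.
  by apply: polyrcf.ler_hornerW => x _; rewrite dQ sqr_ge0.
rewrite /pint -/Q subr_gt0 lt_neqAle; apply/andP; split; last first.
  by apply: Qmono; rewrite ?in_itv /= ?lexx/=; lra.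
apply/eqP => E; move: p0; rewrite -sqrf_eq0 => /eqP; apply.
rewrite -(deriv_antideriv (p ^+ 2)) -/Q.
suff -> : Q = (Q.[1])%:P by rewrite derivC.
apply/eqP; rewrite -subr_eq0; apply/eqP.
set D := Q - _.
pose rs := [seq (k.+1%:R : R)^-1 | k <- iota 0 (size D)].
apply: (@polyrcf.poly_ltsp_roots _ _ rs).
- by rewrite size_map size_iota.
- rewrite map_inj_uniq ?iota_uniq// => a b /invr_inj /eqP.
  by rewrite eqr_nat => /eqP[].
- apply/allP => _ /mapP[k _ ->]; rewrite rootE !hornerE subr_eq0.
  have k1 : (k.+1%:R : R)^-1 <= 1 by rewrite invf_le1 ?ltr0n// ler1n.
  have k0 : 0 < (k.+1%:R : R)^-1 by rewrite invr_gt0 ltr0n.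
  move: (_^-1) k0 k1 => v k0 k1.
  have I1 : (1 : R) \in `[-1, 1] by rewrite in_itv/=; lra.
  have I2 : (-1 : R) \in `[-1, 1] by rewrite in_itv/=; lra.
  have I3 : v \in `[-1, 1] by rewrite in_itv/=; lra.
  rewrite eq_le Qmono //=; rewrite -E Qmono//; lra.
Qed.

End PolynomialIntegral.

Section GaussLegendre.
Context {R : realType}.
Implicit Types p q : {poly R}.

Definition rodrigues n : {poly R} := ('X^2 - 1) ^+ n.

Lemma dvdp_derivn_rodrigues n k : (k <= n)%N ->
  exists q, (rodrigues n)^`(k) = ('X^2 - 1) ^+ (n - k) * q.
Proof.
elim: k => [_|k IH kn]; first by exists 1; rewrite subn0 mulr1.
have [|q E] := IH; first exact: ltnW.
have [m nk nk1] : exists2 m, (n - k = m.+1)%N & (n - k.+1 = m)%N.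
  by exists (n - k.+1)%N => //; lia.
rewrite derivnS E nk nk1 derivM deriv_exp -pred_Sn; set d := deriv _.
exists (m.+1%:R * d * q + ('X^2 - 1) * q^`()).
rewrite -mulr_natl; move: d (m.+1%:R : {poly R}) ('X^2 - 1) (q^`()) => d c U dq.
by rewrite exprS; ring.
Qed.

Lemma horner_derivn_rodrigues n k (x : R) : (k < n)%N -> x ^+ 2 = 1 ->
  (rodrigues n)^`(k).[x] = 0.
Proof.
move=> kn x1; have [q ->] := @dvdp_derivn_rodrigues n k (ltnW kn).
rewrite hornerM horner_exp !hornerE x1 subrr expr0n.
by rewrite subn_eq0 leqNgt kn mul0r.
Qed.

(** Repeated integration by parts: the boundary terms vanish because both
    endpoints are zeros of order [n] of the Rodrigues polynomial. *)
Lemma rodrigues_orthogonal n k q : (k <= n)%N -> (size q <= k)%N ->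
  pint (q * (rodrigues n)^`(k)) = 0.
Proof.
elim: k q => [|k IH] q kn qk.
  move: qk; rewrite leqn0 size_poly_eq0 => /eqP ->.
  by rewrite mul0r -(scale0r 0) pintZ mul0r.
have bd : pint (q * (rodrigues n)^`(k))^`() = 0.
  by rewrite pint_deriv !hornerM !horner_derivn_rodrigues ?expr1n//
    ?sqrrN ?expr1n// !mulr0 subrr.
move: bd; rewrite derivM pintD -derivnS IH ?add0r//; first exact: ltnW.
have [->|q0] := eqVneq q 0; first by rewrite linear0 size_poly0.
by rewrite -ltnS (leq_trans (lt_size_deriv q0)).
Qed.

(** Rolle's theorem between consecutive zeros. Keeping the new zeros below the
    last old one lets the argument be iterated up to the endpoint 1. *)
Lemma rolle_path p (a : R) s : path <%R a s -> all (root p) (a :: s) ->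
  exists s', [/\ path <%R a s', size s' = size s, all (root p^`()) s' &
    all (fun x => x < last a s) s'].
Proof.
elim: s a => [|b s IH] a /=; first by exists [::].
move=> /andP[ab bs] /and3P[pa pb ps].
have [|s' [s'1 s'2 s'3 s'4]] := IH b bs; first by rewrite /= pb.
have [c cab dc] : {c | c \in `]a, b[ & p^`().[c] = 0}.
  apply: polyrcf.poly_rolle => //; rewrite (eqP pa).
  by rewrite (eqP pb).
move: cab; rewrite in_itv/= => /andP[ac cb].
exists (c :: s'); split => /=.
- rewrite ac; case: s' s'1 {s'2 s'3 s'4} => //= d s' /andP[bd ->].
  by rewrite (lt_trans cb bd).
- by rewrite s'2.
- by rewrite rootE dc eqxx.
- rewrite s'4 andbT (lt_le_trans cb)//.
  elim: s b bs {IH ab pb ps s'1 s'2 s'3 s'4 cb dc} => //= d s IH b.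
  by move=> /andP[/ltW bd ds]; rewrite (le_trans bd)// IH.
Qed.

(** Each derivative of order below [n] still vanishes at both endpoints, so
    Rolle's theorem yields one more interior zero at every differentiation. *)
Lemma roots_derivn_rodrigues n k : (k <= n)%N ->
  exists s, [/\ path <%R (-1 : R) s, size s = k,
    all (root (rodrigues n)^`(k)) s & all (fun x => x < 1) s].
Proof.
elim: k => [_|k IH kn]; first by exists [::].
have [|s [s1 s2 s3 s4]] := IH; first exact: ltnW.
have [||s' [t1 t2 t3 t4]] := @rolle_path (rodrigues n)^`(k) (-1) (rcons s 1).
- rewrite rcons_path s1/=; have := mem_last (-1) s.
  rewrite inE => /orP[/eqP ->|]; first by lra.
  by move/(allP s4).
- rewrite /= all_rcons s3 !rootE !horner_derivn_rodrigues ?eqxx ?expr1n//.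
  by rewrite sqrrN expr1n.
- exists s'; split => //; first by rewrite t2 size_rcons s2.
  by move: t4; rewrite last_rcons.
Qed.

Lemma size_rodrigues n : size (rodrigues n) = (n + n).+1.
Proof.
rewrite /rodrigues polyrcf.my_size_exp ?size_XnsubC//; first by lia.
by rewrite -size_poly_eq0 -[1]/(1%:P) size_XnsubC.
Qed.

Lemma legendreE n : exists2 c : R, c != 0 &
  legendre n = c *: (rodrigues n)^`(n).
Proof.
exists (2 ^+ n * n`!%:R)^-1 => //.
Qed.

Lemma legendre_neq0 n : legendre n != 0 :> {poly R}.
Proof.
have [c c0 ->] := legendreE n; rewrite scaler_eq0 (negbTE c0)/=.
apply/eqP => /polyP/(_ n)/eqP; rewrite coef0 coef_derivn -mulr_natr.
apply/negP; rewrite mulf_neq0//; last first.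
  by rewrite pnatr_eq0 -lt0n ffact_gt0 leq_addr.
have : lead_coef (rodrigues n) != 0.
  by rewrite lead_coef_eq0 -size_poly_eq0 size_rodrigues.
by rewrite /lead_coef size_rodrigues.
Qed.

Lemma size_legendre n : (size (legendre n : {poly R}) <= n.+1)%N.
Proof.
have [c c0 ->] := legendreE n; rewrite size_scale//.
apply/leq_sizeP => j nj; rewrite coef_derivn nth_default ?mul0rn//.
by rewrite size_rodrigues; lia.
Qed.

Lemma size_gl_nodes n : size (gl_nodes n : seq R) = n.
Proof.
apply/eqP; rewrite eqn_leq; apply/andP; split.
  have := @max_poly_roots R (legendre n) (gl_nodes n) (legendre_neq0 n).
  move=> /(_ _ (polyrcf.uniq_roots _ _ _)) H; rewrite -ltnS.
  apply: leq_trans (size_legendre n); apply: H.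
  by apply/allP => x /polyrcf.root_roots.
have [s [s1 s2 s3 s4]] := roots_derivn_rodrigues (leqnn n).
rewrite -[X in (X <= _)%N]s2; apply: uniq_leq_size.
  by apply: lt_sorted_uniq; apply: path_sorted s1.
move=> x xs; apply: polyrcf.root_in_roots; first exact: legendre_neq0.
  rewrite in_itv/= (allP s4)// andbT.
  by move: s1; rewrite lt_path_sortedE => /andP[/allP/(_ _ xs)].
have [c c0 ->] := legendreE n.
by rewrite rootE hornerZ (eqP (allP s3 _ xs)) mulr0.
Qed.

Lemma gl_nodes_itv n (x : R) : x \in gl_nodes n -> -1 < x < 1.
Proof. by move=> /polyrcf.roots_in; rewrite in_itv. Qed.

Definition nodal n : {poly R} := \prod_(x <- gl_nodes n) ('X - x%:P).

Lemma uniq_gl_nodes n : uniq (gl_nodes n : seq R).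
Proof. exact: polyrcf.uniq_roots. Qed.

Lemma monic_nodal n : nodal n \is monic.
Proof. exact: monic_prod_XsubC. Qed.

Lemma size_nodal n : size (nodal n) = n.+1.
Proof. by rewrite size_prod_XsubC size_gl_nodes. Qed.

(** The nodal polynomial is a multiple of the Legendre polynomial, which has
    exactly the nodes as zeros. *)
Lemma nodal_orthogonal n q : (size q <= n)%N -> pint (q * nodal n) = 0.
Proof.
move=> qn; set l := lead_coef (legendre n : {poly R}).
have ar : all (root (legendre n)) (gl_nodes n : seq R).
  by apply/allP => x /polyrcf.root_roots.
have E : legendre n = l *: nodal n.
  apply: all_roots_prod_XsubC => //; last by rewrite uniq_rootsE uniq_gl_nodes.
  apply/eqP; rewrite eqn_leq size_gl_nodes size_legendre/=.
  have := max_poly_roots (legendre_neq0 n) ar (uniq_gl_nodes n).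
  by rewrite size_gl_nodes.
have l0 : l != 0 by rewrite lead_coef_eq0 legendre_neq0.
have [c c0 cE] := legendreE n.
have -> : nodal n = (l^-1 * c) *: (rodrigues n)^`(n).
  by rewrite -scalerA -cE E scalerA mulVf// scale1r.
by rewrite -scalerAr pintZ (rodrigues_orthogonal (leqnn n) qn) mulr0.
Qed.

Definition lagrange n (x : R) : {poly R} :=
  \prod_(y <- gl_nodes n | y != x) ((x - y)^-1 *: ('X - y%:P)).

Lemma gl_weightE n (x : R) : gl_weight n x = pint (lagrange n x).
Proof.
rewrite -Rintegral_horner; apply: eq_Rintegral => t _.
rewrite horner_prod; apply: eq_bigr => y _.
by rewrite hornerZ !hornerE mulrC.
Qed.

Lemma horner_lagrange n (x y : R) : x \in gl_nodes n -> y \in gl_nodes n ->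
  (lagrange n x).[y] = (y == x)%:R.
Proof.
move=> xn yn; rewrite horner_prod; case: eqVneq => [->|yx].
  rewrite big1// => z zx; rewrite hornerZ !hornerE mulVf// subr_eq0.
  by rewrite eq_sym.
apply/eqP; rewrite prodf_seq_eq0; apply/hasP; exists y => //.
by rewrite yx hornerZ !hornerE subrr mulr0/=.
Qed.

Lemma size_lagrange n (x : R) : x \in gl_nodes n -> (size (lagrange n x) <= n)%N.
Proof.
move=> xn; rewrite /lagrange; under eq_bigr do rewrite -mul_polyC.
rewrite big_split/= -big_filter -rmorph_prod mul_polyC.
apply: leq_trans (size_scale_leq _ _) _.
rewrite -big_filter size_prod_XsubC -rem_filter ?uniq_gl_nodes//.
rewrite size_rem// size_gl_nodes prednK//.
by rewrite -(size_gl_nodes n); case: (gl_nodes n) xn.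
Qed.

Definition gauss1 n p : R := \sum_(x <- gl_nodes n) gl_weight n x * p.[x].

Lemma gauss1D n p q : gauss1 n (p + q) = gauss1 n p + gauss1 n q.
Proof. by rewrite -big_split; apply: eq_bigr => x _; rewrite hornerD mulrDr. Qed.

Lemma gauss1Z n a p : gauss1 n (a *: p) = a * gauss1 n p.
Proof. by rewrite mulr_sumr; apply: eq_bigr => x _; rewrite hornerZ mulrCA. Qed.

Lemma horner_nodal n (x : R) : x \in gl_nodes n -> (nodal n).[x] = 0.
Proof. by move=> xn; apply/eqP; rewrite -rootE root_prod_XsubC. Qed.

Lemma gauss1_interpolation n q : (size q <= n)%N -> gauss1 n q = pint q.
Proof.
move=> qn.
have -> : q = \sum_(x <- gl_nodes n) q.[x] *: lagrange n x.
  set r := \sum_(_ <- _) _; apply/eqP; rewrite -subr_eq0; apply/eqP.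
  apply: (@polyrcf.poly_ltsp_roots _ _ (gl_nodes n)) => //.
  - rewrite size_gl_nodes (leq_trans (size_polyD _ _))// geq_max qn size_polyN.
    rewrite /r big_seq; apply: (big_ind (fun p => size p <= n)%N) => //.
    + by rewrite size_poly0.
    + by move=> a b an bn; rewrite (leq_trans (size_polyD _ _))// geq_max an.
    + by move=> x xn; rewrite (leq_trans (size_scale_leq _ _))// size_lagrange.
  - exact: uniq_gl_nodes.
  - apply/allP => y yn; rewrite rootE hornerD hornerN horner_sum.
    rewrite (bigD1_seq y) ?uniq_gl_nodes//= hornerZ horner_lagrange// eqxx mulr1.
    rewrite big_seq_cond big1 ?addr0 ?subrr// => x /andP[xn xy].
    by rewrite hornerZ horner_lagrange// eq_sym (negbTE xy) mulr0.
rewrite pint_sum /gauss1 [LHS]big_seq [RHS]big_seq; apply: eq_bigr => x xn.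
rewrite pintZ gl_weightE mulrC; congr (_ * _).
rewrite horner_sum (bigD1_seq x) ?uniq_gl_nodes//= hornerZ horner_lagrange//.
rewrite eqxx mulr1 big_seq_cond big1 ?addr0// => y /andP[yn yx].
by rewrite hornerZ horner_lagrange// eq_sym (negbTE yx) mulr0.
Qed.

(** Dividing by the nodal polynomial leaves a remainder that interpolation
    integrates, and a multiple of the nodal polynomial that vanishes at the
    nodes and, by orthogonality, has zero integral. *)
Lemma gauss1_exact n q : (size q <= n + n)%N -> gauss1 n q = pint q.
Proof.
move=> qn; have N0 := monic_nodal n.
have Nn0 : nodal n != 0 by exact: monic_neq0.
rewrite (divp_eq q (nodal n)) gauss1D pintD nodal_orthogonal; last first.
  by rewrite size_divp// size_nodal leq_subLR.
rewrite (gauss1_interpolation (q := q %% _)); last first.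
  by have := ltn_modp q (nodal n); rewrite Nn0 size_nodal ltnS.
congr (_ + _); rewrite /gauss1 big_seq big1// => x xn.
by rewrite hornerM horner_nodal// !mulr0.
Qed.

(** The squared Lagrange polynomial of a node has degree [2 * n - 2], within
    the exactness range, and only that node contributes to its quadrature. *)
Lemma gl_weight_gt0 n (x : R) : x \in gl_nodes n -> 0 < gl_weight n x.
Proof.
move=> xn; have sl := size_lagrange xn.
have l0 : lagrange n x != 0.
  apply/eqP => /(congr1 (horner^~ x)) /eqP; rewrite horner_lagrange// eqxx.
  by rewrite horner0 oner_eq0.
have := pint_sqr_gt0 l0; rewrite -(@gauss1_exact n); last first.
  by rewrite expr2 (leq_trans (size_polyMleq _ _))//; lia.
rewrite /gauss1 (bigD1_seq x) ?uniq_gl_nodes//=.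
rewrite horner_exp horner_lagrange// eqxx expr1n mulr1.
rewrite big_seq_cond big1 ?addr0// => y /andP[yn yx].
by rewrite horner_exp horner_lagrange// (negbTE yx) expr0n mulr0.
Qed.

(** The first degree at which the rule fails: the squared nodal polynomial is
    invisible to the rule and has a positive integral. *)
Lemma gauss1_defect n q : (size q <= n + n)%N ->
  gauss1 n ('X^(n + n) + q) = pint ('X^(n + n) + q) - pint (nodal n ^+ 2).
Proof.
move=> qn; have sP : size (nodal n ^+ 2) = (n + n).+1.
  by rewrite polyrcf.my_size_exp ?monic_neq0 ?monic_nodal// size_nodal; lia.
have -> : 'X^(n + n) + q = nodal n ^+ 2 + ('X^(n + n) + q - nodal n ^+ 2).
  by rewrite [RHS]addrC subrK.
rewrite gauss1D pintD (@gauss1_exact _ (_ - _)).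
  have -> : gauss1 n (nodal n ^+ 2) = 0.
    rewrite /gauss1 big_seq big1// => x xn.
    by rewrite horner_exp horner_nodal// expr0n mulr0.
  by ring.
apply/leq_sizeP => j; rewrite leq_eqVlt => /orP[/eqP <-|nj].
  have : lead_coef (nodal n ^+ 2) = 1 by rewrite lead_coef_exp (eqP (monic_nodal n)) expr1n.
  rewrite /lead_coef sP/= coefB coefD coefXn eqxx => ->.
  by rewrite nth_default// addr0 subrr.
have qj : q`_j = 0 by rewrite nth_default// (leq_trans qn (ltnW nj)).
have Pj : (nodal n ^+ 2)`_j = 0 by rewrite nth_default// sP.
by rewrite coefB coefD coefXn gtn_eqF// qj Pj addr0 subr0.
Qed.

End GaussLegendre.

(** * Null sets and measurability in space *)

Section NullSets.
Import HBNNSimple.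
Context d (T : measurableType d) {R : realType}.
Variable mu : {measure set T -> \bar R}.
Local Open Scope ereal_scope.

Let ge0_le_integral_null (N D : set T) (f g : T -> \bar R) :
  measurable N -> mu N = 0 ->
  (forall x, 0 <= f x) -> (forall x, 0 <= g x) ->
  (forall x, ~ N x -> D x -> f x = g x) ->
  \int[mu]_(x in D) f x <= \int[mu]_(x in D) g x.
Proof.
move=> mN N0 f0 g0 fg; rewrite ge0_integralE// ge0_integralE//.
apply: ge_ereal_sup => _ [h hf <-].
apply: ereal_sup_ubound; exists (proj_nnsfun h (measurableC mN)).
  move=> x; rewrite -mrestrict patchE; case: ifPn => [/set_mem xN|_].
    move: (hf x); rewrite !patchE.
    by case: ifP => [/set_mem xD|//]; rewrite fg.
  by rewrite patchE; case: ifP.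
rewrite -!integralT_nnsfun; apply: ge0_ae_eq_integral => //.
- by apply/measurable_EFinP; exact: measurable_funP.
- by apply/measurable_EFinP; exact: measurable_funP.
- by move=> x _; rewrite lee_fin.
- by move=> x _; rewrite lee_fin.
- exists N; split => // x H; apply: contrapT => Nx; apply: H => _.
  by congr EFin; rewrite -mrestrict patchE mem_set.
Qed.

(** The integral is a supremum over simple functions, each of which may be
    replaced by zero on the null set. *)
Lemma integral_eq_off_null (N D : set T) (f g : T -> \bar R) :
  measurable N -> mu N = 0 -> (forall x, ~ N x -> D x -> f x = g x) ->
  \int[mu]_(x in D) f x = \int[mu]_(x in D) g x.
Proof.
move=> mN N0 fg; rewrite integralE [in RHS]integralE.
have fgp x : ~ N x -> D x -> f^\+ x = g^\+ x.
  by move=> Nx Dx; rewrite !funeposE fg.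
have fgn x : ~ N x -> D x -> f^\- x = g^\- x.
  by move=> Nx Dx; rewrite !funenegE fg.
by congr (_ - _); apply/eqP; rewrite eq_le; apply/andP; split;
  apply: (@ge0_le_integral_null N) => // x Nx Dx; rewrite ?fgp ?fgn.
Qed.

Lemma integral_eq_domain_off_null (N D E : set T) (f g : T -> \bar R) :
  measurable N -> mu N = 0 -> (forall x, ~ N x -> D x <-> E x) ->
  (forall x, ~ N x -> D x -> f x = g x) ->
  \int[mu]_(x in D) f x = \int[mu]_(x in E) g x.
Proof.
move=> mN N0 DE fg; rewrite integral_mkcond [in RHS]integral_mkcond.
apply: (@integral_eq_off_null N) => // x Nx _; rewrite !patchE.
have [xD|xD] := boolP (x \in D).
  by rewrite mem_set ?fg//; [exact: set_mem | apply/DE => //; exact: set_mem].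
by rewrite ifN//; apply: contra xD => /set_mem/(DE _ Nx) Dx; exact: mem_set.
Qed.

End NullSets.

Section Space.
Context {R : realType}.
Notation mR := (measurableTypeR R).
Notation R3 := (mR * mR * mR)%type.
Notation cV3 := 'cV[R]_3.

Definition unpt3 (v : cV3) : R3 := (v 0 0, v 1 0, v 2%:R 0).

Lemma vec3E0 (x y z : R) : vec3 x y z 0 0 = x. Proof. by rewrite mxE. Qed.
Lemma vec3E1 (x y z : R) : vec3 x y z 1 0 = y. Proof. by rewrite mxE. Qed.
Lemma vec3E2 (x y z : R) : vec3 x y z 2%:R 0 = z. Proof. by rewrite mxE. Qed.

Lemma ord3P (P : 'I_3 -> Prop) : P 0 -> P 1 -> P 2%:R -> forall i, P i.
Proof.
move=> P0 P1 P2 [[|[|[|//]]] i].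
- by have -> : Ordinal i = 0 by apply: val_inj.
- by have -> : Ordinal i = 1 by apply: val_inj.
- by have -> : Ordinal i = 2%:R by apply: val_inj.
Qed.

Lemma cV3P (u v : cV3) : u 0 0 = v 0 0 -> u 1 0 = v 1 0 ->
  u 2%:R 0 = v 2%:R 0 -> u = v.
Proof.
by move=> u0 u1 u2; apply/matrixP => i j; rewrite ord1; move: i; apply: ord3P.
Qed.

Lemma unpt3K : cancel unpt3 pt3.
Proof. by move=> v; apply: cV3P; rewrite /pt3 ?vec3E0 ?vec3E1 ?vec3E2. Qed.

Lemma sum3E (V : nmodType) (F : 'I_3 -> V) : \sum_i F i = F 0 + F 1 + F 2%:R.
Proof.
rewrite !big_ord_recl big_ord0 addr0 addrA.
by congr (_ + _ + _); congr (F _); apply: val_inj.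
Qed.

(** Open sets are countable unions of cubes with rational centres and radii. *)
Lemma measurable_open3 (D : set cV3) : open D -> measurable (pt3 @^-1` D : set R3).
Proof.
move=> oD.
pose box (q : rat * rat * rat * rat) : set R3 :=
  (ball (ratr q.1.1.1 : R) (ratr q.2) `*` ball (ratr q.1.1.2 : R) (ratr q.2))
   `*` ball (ratr q.1.2 : R) (ratr q.2).
pose Q := [set q | box q `<=` pt3 @^-1` D].
have -> : pt3 @^-1` D = \bigcup_(q in Q) box q.
  apply/seteqP; split => [x /= Dx|x [q Qq]]; last exact: Qq.
  have /nbhs_ballP[e /= e0 eD] : nbhs (pt3 x) D by exact: open_nbhs_nbhs.
  have [r /andP[r0 re]] : exists r : rat, 0 < (ratr r : R) < e / 2.
    by have [r] := @rat_in_itvoo R 0 (e / 2) (divr_gt0 e0 (ltr0n _ 2));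
       rewrite in_itv => ?; exists r.
  have H (t : R) : exists q : rat, `|ratr q - t| < ratr r.
    have [|q] := @rat_in_itvoo R (t - ratr r) (t + ratr r); first by lra.
    by rewrite in_itv/= => /andP[? ?]; exists q; rewrite ltr_norml; lra.
  have [q0 h0] := H x.1.1; have [q1 h1] := H x.1.2; have [q2 h2] := H x.2.
  exists (q0, q1, q2, r) => //= y [[/= y0 y1] y2]; apply: eD.
  move: y0 y1 y2; rewrite /ball/= => y0 y1 y2.
  have tri (q : rat) (a b : R) : `|ratr q - a| < ratr r -> `|ratr q - b| < ratr r ->
    `|a - b| < e.
    rewrite !ltr_norml => /andP[? ?] /andP[? ?]; lra.
  split=> // i j; rewrite ord1; move: i.
  apply: ord3P; rewrite /pt3 ?vec3E0 ?vec3E1 ?vec3E2 /ball/=.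
  - exact: tri h0 y0.
  - exact: tri h1 y1.
  - exact: tri h2 y2.
rewrite bigcup_mkcond; apply: countable_bigcupT_measurable => [|q].
  exact: countableP.
by case: ifP => // _; apply: measurableX; first apply: measurableX;
  exact: measurable_ball.
Qed.

Lemma measurable_continuous3 (f : cV3 -> R) : continuous f ->
  measurable_fun setT (f \o pt3 : R3 -> R).
Proof.
move=> cf; apply: (measurability _ (RGenOpens.measurableE R)).
move=> _ [_ [a [b ->]] <-]; rewrite setTI.
have /measurable_open3 : open (f @^-1` `]a, b[).
  by apply: open_comp => //; exact: interval_open.
by rewrite comp_preimage.
Qed.

Lemma measurable_pt3_linear (A : 'M[R]_3) (b : cV3) i :
  measurable_fun setT (fun x : R3 => (b + A *m pt3 x) i 0 : R).
Proof.
under eq_fun do rewrite !mxE sum3E !mxE/=.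
have m1 : measurable_fun setT (fun x : R3 => x.1.1 : R).
  by apply: (measurableT_comp measurable_fst measurable_fst).
have m2 : measurable_fun setT (fun x : R3 => x.1.2 : R).
  by apply: (measurableT_comp measurable_snd measurable_fst).
have m3 : measurable_fun setT (fun x : R3 => x.2 : R) by exact: measurable_snd.
by repeat apply: measurable_funD => //; apply: measurable_funM.
Qed.

Lemma measurable_affine3 (A : 'M[R]_3) (b : cV3) :
  measurable_fun setT (fun x : R3 => unpt3 (b + A *m pt3 x)).
Proof.
by apply: measurable_fun_pair; first apply: measurable_fun_pair;
  exact: measurable_pt3_linear.
Qed.

End Space.

(** * Affine changes of variables *)

Section Matrix3.

Lemma det3E (F : comRingType) (M : 'M[F]_3) : \det M =
  (M 0 0 * (M 1 1 * M 2%:R 2%:R - M 1 2%:R * M 2%:R 1)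
   - M 0 1 * (M 1 0 * M 2%:R 2%:R - M 1 2%:R * M 2%:R 0)
   + M 0 2%:R * (M 1 0 * M 2%:R 1 - M 1 1 * M 2%:R 0))%R.
Proof.
have det2 (N : 'M[F]_2) : \det N = N 0 0 * N 1 1 - N 0 1 * N 1 0.
  rewrite (expand_det_row _ 0) !big_ord_recl big_ord0 /cofactor !det_mx11 !mxE.
  have -> : lift (0 : 'I_2) (0 : 'I_1) = 1 by apply: val_inj.
  have -> : lift (1 : 'I_2) (0 : 'I_1) = 0 by apply: val_inj.
  by rewrite -[ord0]/(0 : 'I_2) /=; ring.
rewrite (expand_det_row _ 0) sum3E /cofactor !det2 !mxE/=.
have l00 : lift (0 : 'I_3) (0 : 'I_2) = 1 by apply: val_inj.
have l01 : lift (0 : 'I_3) (1 : 'I_2) = 2%:R by apply: val_inj.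
have l10 : lift (1 : 'I_3) (0 : 'I_2) = 0 by apply: val_inj.
have l11 : lift (1 : 'I_3) (1 : 'I_2) = 2%:R by apply: val_inj.
have l20 : lift (2%:R : 'I_3) (0 : 'I_2) = 0 by apply: val_inj.
have l21 : lift (2%:R : 'I_3) (1 : 'I_2) = 1 by apply: val_inj.
by rewrite l00 l01 l10 l11 l20 l21; ring.
Qed.

Lemma mx3P (F : Type) (M N : 'M[F]_3) :
  (M 0 0 = N 0 0) * (M 0 1 = N 0 1) * (M 0 2%:R = N 0 2%:R) ->
  (M 1 0 = N 1 0) * (M 1 1 = N 1 1) * (M 1 2%:R = N 1 2%:R) ->
  (M 2%:R 0 = N 2%:R 0) * (M 2%:R 1 = N 2%:R 1) * (M 2%:R 2%:R = N 2%:R 2%:R) ->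
  M = N.
Proof.
by move=> [[? ?] ?] [[? ?] ?] [[? ?] ?]; apply/matrixP;
  apply: ord3P; apply: ord3P.
Qed.

End Matrix3.

Section LinearChange.
Context {R : realType}.
Notation mR := (measurableTypeR R).
Notation R3 := (mR * mR * mR)%type.
Notation cV3 := 'cV[R]_3.
Notation leb := (@lebesgue_measure R).

Let lebesgue_affine_itv (a b u v : R) : a != 0 -> u <= v ->
  leb ((fun t : mR => a * t + b : mR) @^-1` `]u, v]) = ((v - u) / `|a|)%:E.
Proof.
move=> a0 uv.
have [a_gt0|a_lt0|] := ltgtP 0 a; last by move/esym/eqP; rewrite (negbTE a0).
- have -> : (fun t : mR => a * t + b : mR) @^-1` `]u, v] =
     `](u - b) / a, (v - b) / a]%classic.
    apply/seteqP; split => t /=; rewrite !in_itv/= ltr_pdivrMr// ler_pdivlMr//;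
      rewrite (mulrC t); lra.
  rewrite lebesgue_measure_itv/= lte_fin (gtr0_norm a_gt0).
  rewrite ltr_pM2r ?invr_gt0//; case: ltP => h.
    by rewrite -EFinD; congr EFin; field.
  have -> : v - u = 0 by lra.
  by rewrite mul0r.
- have na : 0 < - a by lra.
  have -> : (fun t : mR => a * t + b : mR) @^-1` `]u, v] =
     `[(b - v) / (- a), (b - u) / (- a)[%classic.
    apply/seteqP; split => t /=; rewrite !in_itv/= ltr_pdivlMr// ler_pdivrMr//;
      rewrite mulrN (mulrC t); lra.
  rewrite lebesgue_measure_itv/= lte_fin (ltr0_norm a_lt0).
  rewrite ltr_pM2r ?invr_gt0//; case: ltP => h.
    by rewrite -EFinD; congr EFin; field; lra.
  have -> : v - u = 0 by lra.
  by rewrite mul0r.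
Qed.

Local Open Scope ereal_scope.

Lemma ge0_integral_affine (a b : R) (g : mR -> \bar R) : a != 0%R ->
  measurable_fun setT g -> (forall t, 0 <= g t) ->
  \int[leb]_t g t = `|a|%:E * \int[leb]_t g (a * t + b)%R.
Proof.
move=> a0 mg g0.
have mphi : measurable_fun setT (fun t : mR => (a * t + b)%R : mR).
  by apply: measurable_funD => //; apply: measurable_funM.
pose P : {mfun mR >-> mR} := HB.pack (fun t : mR => (a * t + b)%R : mR)
  (isMeasurableFun.Build _ _ _ _ _ mphi).
pose k := NngNum (normr_ge0 a).
rewrite (eq_measure_integral (mscale k (pushforward leb P))).
  rewrite ge0_integral_mscale//; congr (_ * _).
  by rewrite ge0_integral_pushforward.
move=> A mA _; apply: lebesgue_measure_unique => // X /ocitvP[->|[[u v] /= uv ->]].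
  by rewrite !measure0.
rewrite /mscale/= /pushforward/= lebesgue_affine_itv//; last exact: ltW.
rewrite lebesgue_measure_itv/= lte_fin uv -EFinM -EFinD; congr EFin.
by rewrite mulrC divfK// normr_eq0.
Qed.

Let sigma_finite_leb2 : sigma_finite setT (leb \x leb)%E.
Proof.
exists (fun n => (`[-n%:R, n%:R]%classic%R : set mR) `*`
  (`[-n%:R, n%:R]%classic%R : set mR)).
  apply/esym; rewrite -subTset => -[x y] _.
  have [n] : exists n : nat, (`|x| + `|y| <= n%:R)%R.
    by exists (Num.truncn (`|x| + `|y|)%R).+1; rewrite ltW// truncnS_gt.
  move=> xy; exists n => //; split; rewrite /= in_itv/=.
  - by rewrite -ler_norml (le_trans _ xy)// lerDl.
  - by rewrite -ler_norml (le_trans _ xy)// lerDr.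
move=> n; split; first exact: measurableX.
rewrite product_measure1E//= lebesgue_measure_itv/=.
by case: ifP; rewrite ?mule0 -?EFinD -?EFinM ?ltry.
Qed.

Definition leb2 : {sigma_finite_measure set (mR * mR)%type -> \bar R} :=
  HB.pack (leb \x leb)%E
    (Measure_isSigmaFinite.Build _ _ _ (leb \x leb)%E sigma_finite_leb2).

Lemma tonelli_leb3_2 (f : R3 -> \bar R) : measurable_fun setT f ->
  (forall x, 0 <= f x) ->
  \int[leb3]_x f x = \int[leb2]_w \int[leb]_t f (w, t).
Proof. by move=> mf f0; exact: (@fubini_tonelli1 _ _ _ _ R leb2 leb f mf f0). Qed.

Let tonelli_leb3 (f : R3 -> \bar R) : measurable_fun setT f ->
  (forall x, 0 <= f x) ->
  \int[leb3]_x f x = \int[leb]_z \int[leb2]_w f (w, z).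
Proof. by move=> mf f0; exact: (@fubini_tonelli2 _ _ _ _ R leb2 leb f mf f0). Qed.

(** Tonelli's theorem for the triple product, with each coordinate in turn
    integrated first. *)
Lemma tonelli_leb3_1 (f : R3 -> \bar R) : measurable_fun setT f ->
  (forall x, 0 <= f x) ->
  \int[leb3]_x f x = \int[leb]_z \int[leb]_x \int[leb]_y f (x, y, z).
Proof.
move=> mf f0; rewrite tonelli_leb3//; apply: eq_integral => z _.
apply: (@fubini_tonelli1 _ _ _ _ R leb leb (fun w => f (w, z))) => //.
by apply: (measurableT_comp mf); exact: measurable_pair2.
Qed.

Lemma tonelli_leb3_0 (f : R3 -> \bar R) : measurable_fun setT f ->
  (forall x, 0 <= f x) ->
  \int[leb3]_x f x = \int[leb]_z \int[leb]_y \int[leb]_x f (x, y, z).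
Proof.
move=> mf f0; rewrite tonelli_leb3//; apply: eq_integral => z _.
apply: (@fubini_tonelli2 _ _ _ _ R leb leb (fun w => f (w, z))) => //.
by apply: (measurableT_comp mf); exact: measurable_pair2.
Qed.

Definition change_of_variables (M : 'M[R]_3) (b : cV3) :=
  forall f : R3 -> \bar R, measurable_fun setT f -> (forall x, 0 <= f x) ->
  \int[leb3]_x f x =
    `|\det M|%:E * \int[leb3]_x f (unpt3 (b + M *m pt3 x)).

Lemma change_of_variablesM M b N c :
  change_of_variables M b -> change_of_variables N c ->
  change_of_variables (M *m N)%R (b + M *m c)%R.
Proof.
move=> cM cN f mf f0; rewrite cM// cN//.
  rewrite muleA -EFinM det_mulmx normrM; congr (_ * _).
  by apply: eq_integral => x _; rewrite unpt3K mulmxDr mulmxA addrA.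
by apply: measurableT_comp => //; exact: measurable_affine3.
Qed.

Definition row_elem (i : 'I_3) (r : 'I_3 -> R) : 'M[R]_3 :=
  \matrix_(k, l) (if k == i then r l else (k == l)%:R)%R.

Let row_elem_fun (i : 'I_3) (r : 'I_3 -> R) (c : R) (x : R3) :
  unpt3 (c *: delta_mx i 0 + row_elem i r *m pt3 x)%R =
  (if i == 0 then (c + r 0 * x.1.1 + r 1 * x.1.2 + r 2%:R * x.2, x.1.2, x.2)
   else if i == 1 then (x.1.1, c + r 0 * x.1.1 + r 1 * x.1.2 + r 2%:R * x.2, x.2)
   else (x.1.1, x.1.2, c + r 0 * x.1.1 + r 1 * x.1.2 + r 2%:R * x.2))%R.
Proof.
move: i; apply: ord3P; rewrite /unpt3 !mxE !sum3E !mxE/=;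
  by congr (_, _, _); ring.
Qed.

Let det_row_elem i r : \det (row_elem i r) = r i.
Proof. by move: i; apply: ord3P; rewrite det3E !mxE/=; ring. Qed.

(** Fubini reduces a map acting on one coordinate to the one-dimensional
    case, that coordinate being integrated first. *)
Lemma change_of_variables_elem i r c : r i != 0%R ->
  change_of_variables (row_elem i r) (c *: delta_mx i 0)%R.
Proof.
move=> ri f mf f0; rewrite det_row_elem.
pose h x := f (unpt3 (c *: delta_mx i 0 + row_elem i r *m pt3 x)%R).
have mh : measurable_fun setT h.
  by apply: measurableT_comp => //; exact: measurable_affine3.
have mh' : measurable_fun setT (fun x => `|r i|%:E * h x).
  by apply: emeasurable_funM.
have h0 x : 0 <= h x by exact: f0.
have h'0 x : 0 <= `|r i|%:E * h x by rewrite mule_ge0.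
transitivity (\int[leb3]_x (`|r i|%:E * h x)); last by rewrite ge0_integralZl.
have sec0 (g : R3 -> \bar R) y z : measurable_fun setT g ->
    measurable_fun setT (fun x : mR => g (x, y, z)).
  move=> mg; apply: (measurableT_comp mg).
  by apply: measurable_fun_pair => //; apply: measurable_fun_pair.
have sec1 (g : R3 -> \bar R) x z : measurable_fun setT g ->
    measurable_fun setT (fun y : mR => g (x, y, z)).
  move=> mg; apply: (measurableT_comp mg).
  by apply: measurable_fun_pair => //; apply: measurable_fun_pair.
have sec2 (g : R3 -> \bar R) w : measurable_fun setT g ->
    measurable_fun setT (fun z : mR => g (w, z)).
  by move=> mg; apply: (measurableT_comp mg); exact: measurable_fun_pair.
have hE x : h x = f (unpt3 (c *: delta_mx i 0 + row_elem i r *m pt3 x)%R) by [].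
move: i ri h mh mh' h0 h'0 hE; apply: ord3P => ri h mh mh' h0 h'0 hE.
- rewrite (tonelli_leb3_0 mf f0) (tonelli_leb3_0 mh' h'0); apply: eq_integral => z _; apply: eq_integral => y _.
  rewrite (ge0_integral_affine (c + r 1 * y + r 2%:R * z)%R ri)//; last exact: sec0.
  rewrite ge0_integralZl//; last exact: sec0.
  congr (_ * _); apply: eq_integral => x _; rewrite hE row_elem_fun/=.
  by congr (f (_, _, _)); ring.
- rewrite (tonelli_leb3_1 mf f0) (tonelli_leb3_1 mh' h'0); apply: eq_integral => z _; apply: eq_integral => x _.
  rewrite (ge0_integral_affine (c + r 0 * x + r 2%:R * z)%R ri)//; last exact: sec1.
  rewrite ge0_integralZl//; last exact: sec1.
  congr (_ * _); apply: eq_integral => y _; rewrite hE row_elem_fun/=.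
  by congr (f (_, _, _)); ring.
- rewrite (tonelli_leb3_2 mf f0) (tonelli_leb3_2 mh' h'0); apply: eq_integral => -[x y] _.
  rewrite (ge0_integral_affine (c + r 0 * x + r 1 * y)%R ri)//; last exact: sec2.
  rewrite ge0_integralZl//; last exact: sec2.
  congr (_ * _); apply: eq_integral => z _; rewrite hE row_elem_fun/=.
  by congr (f (_, _, _)); ring.
Qed.

Local Close Scope ereal_scope.

Let one_elem i c : change_of_variables 1%:M (c *: delta_mx i 0)%R.
Proof.
have -> : 1%:M = row_elem i (fun j => (i == j)%:R) :> 'M[R]_3.
  by apply/matrixP => k l; rewrite !mxE; case: (eqVneq k i) => // ->.
by apply: change_of_variables_elem; rewrite eqxx oner_eq0.
Qed.

Let translate M b : change_of_variables M 0%R -> change_of_variables M b.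
Proof.
move=> cM.
have cb : change_of_variables 1%:M b.
  have := change_of_variablesM (change_of_variablesM
    (one_elem 0 (b 0 0)) (one_elem 1 (b 1 0))) (one_elem 2%:R (b 2%:R 0)).
  rewrite !mul1mx; congr change_of_variables.
  by apply: cV3P; rewrite !mxE/=; ring.
by have := change_of_variablesM cb cM; rewrite !mul1mx addr0.
Qed.

(** The elementary row matrices generate the invertible matrices: the rows are
    brought to those of the identity from the first to the last, a shear
    creating a nonzero pivot where needed. *)
Lemma change_of_variablesP M b : \det M != 0%R -> change_of_variables M b.
Proof.
move=> dM; apply: translate.
pose good M := change_of_variables M 0%R.
have elem i r : r i != 0%R -> good (row_elem i r).
  by move=> ri; have := @change_of_variables_elem i r 0%R ri; rewrite scale0r.
have goodM A B : good A -> good B -> good (A *m B)%R.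
  by move=> gA gB; have := change_of_variablesM gA gB; rewrite mulmx0 addr0.
(* [mk] undoes one elementary step, multiplication on the right by the
   matrix of [r']; the names [s2], [s1], [s0] count the rows already equal to
   those of the identity, a prime marking a nonzero pivot. *)
pose vec a b c : 'I_3 -> R := fun i => [:: a; b; c]`_i.
have mk A i r r' : r i != 0%R -> (row_elem i r' *m row_elem i r)%R = 1%:M ->
    good (A *m row_elem i r')%R -> good A.
  move=> ri E gA; rewrite -(mulmx1 A) -E mulmxA; apply: goodM => //.
  exact: elem.
have s2 (A : 'M[R]_3) : \det A != 0%R -> row 0 A = row 0 1%:M ->
   row 1 A = row 1 1%:M -> good A.
  move=> dA /rowP r0 /rowP r1.
  have E : A = row_elem 2%:R (A 2%:R).
    by apply: mx3P; split; [split | | split | | split |];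
      rewrite ?mxE//=; [have := r0 0|have := r0 1|have := r0 2%:R
        |have := r1 0|have := r1 1|have := r1 2%:R]; rewrite !mxE.
  by rewrite E; apply: elem; rewrite -(det_row_elem 2%:R) -E.
have s1' (A : 'M[R]_3) : \det A != 0%R -> row 0 A = row 0 1%:M ->
   A 1 1 != 0%R -> good A.
  move=> dA /rowP r0 p.
  apply: (mk _ 1 (A 1) (vec (- A 1 0 / A 1 1) (A 1 1)^-1 (- A 1 2%:R / A 1 1))%R) => //.
    apply: mx3P; split; [split | | split | | split |];
      rewrite !mxE sum3E !mxE/= /vec/=; by field.
  apply: s2; first by rewrite det_mulmx det_row_elem mulf_neq0// invr_eq0.
  - apply/rowP => j; rewrite !mxE sum3E; have := r0 0; have := r0 1; have := r0 2%:R.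
    rewrite !mxE/= => -> -> ->; move: j; apply: ord3P; rewrite ?mxE/= /vec/=; ring.
  - apply/rowP; apply: ord3P; rewrite !mxE sum3E !mxE/= /vec/=; by field.
have s1 (A : 'M[R]_3) : \det A != 0%R -> row 0 A = row 0 1%:M -> good A.
  move=> dA r0; have [p|p] := eqVneq (A 1 1) 0%R; last exact: s1'.
  have p' : A 1 2%:R != 0%R.
    apply: contra dA => /eqP p'; rewrite det3E; move/rowP : r0 => r0.
    have := r0 1; have := r0 2%:R; rewrite !mxE/= => -> ->.
    by rewrite p p'; apply/eqP; ring.
  apply: (mk _ 2%:R (vec 0 (-1) 1)%R (vec 0 1 1)%R); rewrite ?oner_neq0//.
    apply: mx3P; split; [split | | split | | split |];
      rewrite !mxE sum3E !mxE/= /vec/=; ring.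
  apply: s1'; first by rewrite det_mulmx det_row_elem mulr1.
  - move/rowP : r0 => r0; have := r0 0; have := r0 1; have := r0 2%:R.
    rewrite !mxE/= => E2 E1 E0; apply/rowP; apply: ord3P;
      rewrite !mxE sum3E !mxE/= /vec/= E0 E1 E2; ring.
  - by rewrite !mxE sum3E !mxE/= /vec/= p mulr0 mul0r !add0r mulr1.
have s0' (A : 'M[R]_3) : \det A != 0%R -> A 0 0 != 0%R -> good A.
  move=> dA p.
  apply: (mk _ 0 (A 0) (vec (A 0 0)^-1 (- A 0 1 / A 0 0) (- A 0 2%:R / A 0 0))%R) => //.
    apply: mx3P; split; [split | | split | | split |];
      rewrite !mxE sum3E !mxE/= /vec/=; by field.
  apply: s1; first by rewrite det_mulmx det_row_elem mulf_neq0// invr_eq0.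
  apply/rowP; apply: ord3P; rewrite !mxE sum3E !mxE/= /vec/=; by field.
have s0 (A : 'M[R]_3) : \det A != 0%R -> good A.
  move=> dA; have [p|p] := eqVneq (A 0 0) 0%R; last exact: s0'.
  have [p1|p1] := eqVneq (A 0 1) 0%R.
    have p2 : A 0 2%:R != 0%R.
      apply: contra dA => /eqP p2; rewrite det3E p p1 p2; apply/eqP; ring.
    apply: (mk _ 2%:R (vec (-1) 0 1)%R (vec 1 0 1)%R); rewrite ?oner_neq0//.
      apply: mx3P; split; [split | | split | | split |];
        rewrite !mxE sum3E !mxE/= /vec/=; ring.
    apply: s0'; first by rewrite det_mulmx det_row_elem mulr1.
    by rewrite !mxE sum3E !mxE/= /vec/= p p1 !mul0r !add0r mulr1.
  apply: (mk _ 1 (vec (-1) 1 0)%R (vec 1 1 0)%R); rewrite ?oner_neq0//.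
    apply: mx3P; split; [split | | split | | split |];
      rewrite !mxE sum3E !mxE/= /vec/=; ring.
  apply: s0'; first by rewrite det_mulmx det_row_elem mulr1.
  by rewrite !mxE sum3E !mxE/= /vec/= p !mul0r !mulr0 add0r addr0 mulr1.
exact: s0.
Qed.

End LinearChange.

(** * Tensor polynomials *)

Section TensorPolynomials.
Context {R : realType}.
Notation cV3 := 'cV[R]_3.
Notation trip := ({poly R} * {poly R} * {poly R})%type.

Definition teval (t : trip) (x : cV3) : R :=
  t.1.1.[x 0 0] * t.1.2.[x 1 0] * t.2.[x 2%:R 0].

Definition seval (s : seq trip) (x : cV3) : R := \sum_(t <- s) teval t x.

Definition tsize N (t : trip) : bool :=
  [&& (size t.1.1 <= N)%N, (size t.1.2 <= N)%N & (size t.2 <= N)%N].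

(** The finite sum of products is existentially hidden: derivatives, products
    and the exactness of quadrature only need that some such form exists. *)
Definition tensor_poly N (F : cV3 -> R) : Prop :=
  exists2 s, all (tsize N) s & forall x, F x = seval s x.

Lemma tensor_poly_ext N F G : F =1 G -> tensor_poly N G -> tensor_poly N F.
Proof. by move=> FG [s sN GE]; exists s => // x; rewrite FG. Qed.

Lemma tensor_polyW N N' F : (N <= N')%N -> tensor_poly N F -> tensor_poly N' F.
Proof.
move=> NN [s sN FE]; exists s => //; apply: sub_all sN => t /and3P[a b c].
by rewrite /tsize !(leq_trans _ NN).
Qed.

Lemma tensor_polyD N F G : tensor_poly N F -> tensor_poly N G ->
  tensor_poly N (fun x => F x + G x).
Proof.
move=> [s sN FE] [s' s'N GE]; exists (s ++ s') => [|x].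
  by rewrite all_cat sN.
by rewrite FE GE /seval big_cat.
Qed.

Lemma tensor_polyZ N a F : tensor_poly N F -> tensor_poly N (fun x => a * F x).
Proof.
move=> [s sN FE]; exists [seq (a *: t.1.1, t.1.2, t.2) | t <- s] => [|x].
  rewrite all_map; apply: sub_all sN => t /and3P[h1 h2 h3]; apply/and3P.
  by split => //=; rewrite (leq_trans (size_scale_leq _ _)).
rewrite FE /seval big_map mulr_sumr; apply: eq_bigr => t _.
by rewrite /teval/= hornerZ !mulrA.
Qed.

Lemma tensor_polyN N F : tensor_poly N F -> tensor_poly N (fun x => - F x).
Proof.
move=> /(tensor_polyZ (-1)); apply: tensor_poly_ext => x.
by rewrite mulN1r.
Qed.

Lemma tensor_polyB N F G : tensor_poly N F -> tensor_poly N G ->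
  tensor_poly N (fun x => F x - G x).
Proof. by move=> FN /tensor_polyN GN; exact: tensor_polyD FN GN. Qed.

Lemma tensor_poly0 N : tensor_poly N (fun=> 0).
Proof. by exists [::] => // x; rewrite /seval big_nil. Qed.

Lemma tensor_poly_cst N a : (0 < N)%N -> tensor_poly N (fun=> a).
Proof.
move=> N0; exists [:: (a%:P, 1%:P, 1%:P)] => [|x].
  by rewrite /= /tsize/= !(leq_trans (polyrcf.leq1_size_polyC _)).
by rewrite /seval big_seq1 /teval/= !hornerC !mulr1.
Qed.

Lemma tensor_poly_sum N (I : Type) (r : seq I) (P : pred I) (F : I -> cV3 -> R) :
  (forall i, P i -> tensor_poly N (F i)) ->
  tensor_poly N (fun x => \sum_(i <- r | P i) F i x).
Proof.
move=> FN; elim: r => [|i r IH].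
  by apply: tensor_poly_ext (tensor_poly0 N) => x; rewrite big_nil.
case: (boolP (P i)) => Pi.
  apply: tensor_poly_ext (tensor_polyD (FN i Pi) IH) => x.
  by rewrite big_cons Pi.
by apply: tensor_poly_ext IH => x; rewrite big_cons (negbTE Pi).
Qed.

Lemma tensor_polyM N N' F G : tensor_poly N F -> tensor_poly N' G ->
  tensor_poly (N + N').-1 (fun x => F x * G x).
Proof.
move=> [s sN FE] [s' s'N GE].
pose mul (t t' : trip) := (t.1.1 * t'.1.1, t.1.2 * t'.1.2, t.2 * t'.2).
exists [seq mul t t' | t <- s, t' <- s'] => [|x].
  apply/allP => _ /allpairsP[[t t'] /= [ts t's' ->]].
  move: (allP sN _ ts) (allP s'N _ t's') => /and3P[a b c] /and3P[a' b' c'].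
  have H (p q : {poly R}) : (size p <= N)%N -> (size q <= N')%N ->
      (size (p * q)%R <= (N + N').-1)%N.
    move=> pN qN; apply: leq_trans (size_polyMleq _ _) _.
    by rewrite -!subn1 leq_sub2r// leq_add.
  by apply/and3P; split; apply: H.
rewrite FE GE /seval big_allpairs_dep big_distrlr/=.
apply: eq_bigr => t _; apply: eq_bigr => t' _.
by rewrite /teval/= !hornerM; ring.
Qed.

Definition dtrip (j : 'I_3) (t : trip) : trip :=
  if j == 0 then (t.1.1^`(), t.1.2, t.2)
  else if j == 1 then (t.1.1, t.1.2^`(), t.2)
  else (t.1.1, t.1.2, t.2^`()).

Lemma tsize_dtrip N j t : tsize N t -> tsize N (dtrip j t).
Proof.
have H (p : {poly R}) : (size p <= N)%N -> (size p^`() <= N)%N.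
  move=> pN; have [->|p0] := eqVneq p 0; first by rewrite deriv0 size_poly0.
  by rewrite ltnW// (leq_trans (lt_size_deriv p0)).
move=> /and3P[a b c]; move: j; apply: ord3P; rewrite /dtrip/= /tsize/=;
  by rewrite ?a ?b ?c ?H.
Qed.

Lemma is_diff_coord3 (x : cV3) i :
  is_diff x (fun y : cV3 => y i 0 : R) (fun v => v i 0).
Proof.
have @f : {linear cV3 -> R}.
  by exists (fun N : cV3 => N i 0); do 2![eexists]; do ?[constructor];
     rewrite ?mxE// => ? *; rewrite ?mxE//; move=> ?; rewrite !mxE.
apply: DiffDef; first exact: differentiable_coord.
have /= := @diff_lin _ _ _ f x; apply; exact: coord_continuous.
Qed.

Lemma is_diff_horner_coord (x : cV3) (p : {poly R}) i :
  is_diff x (fun y : cV3 => p.[y i 0]) (fun v => v i 0 * p^`().[x i 0]).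
Proof.
have dp (t : R) : is_diff t (horner p) (fun h => h * p^`().[t]).
  have d : differentiable (horner p) t.
    exact/derivable1_diffP/derivable_horner.
  by apply: DiffDef => //; rewrite diff1E// -derivE.
exact: (@is_diff_comp _ _ _ _ _ _ _ _ _ (is_diff_coord3 x i) (dp _)).
Qed.

Lemma is_diff_teval (x : cV3) t : is_diff x (teval t)
  (fun v => \sum_j v j 0 * teval (dtrip j t) x).
Proof.
have d0 := is_diff_horner_coord x t.1.1 0.
have d1 := is_diff_horner_coord x t.1.2 1.
have d2 := is_diff_horner_coord x t.2 2%:R.
have -> : teval t = (fun y : cV3 => t.1.1.[y 0 0]) *
  (fun y : cV3 => t.1.2.[y 1 0]) * (fun y : cV3 => t.2.[y 2%:R 0]) by [].
apply: (@is_diff_eq _ _ _ _ _ _ _ (is_diffM (is_diffM d0 d1) d2)).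
apply/funext => v; rewrite sum3E /teval /dtrip/= !fctE /=.
by rewrite /GRing.scale/=; ring.
Qed.

Lemma is_diff_seval (x : cV3) s : is_diff x (seval s)
  (fun v => \sum_j v j 0 * seval [seq dtrip j t | t <- s] x).
Proof.
elim: s => [|t s IH].
  apply: DiffDef.
    have -> : seval [::] = cst 0 by apply/funext => y; rewrite /seval big_nil.
    exact: differentiable_cst.
  have -> : seval [::] = cst 0 by apply/funext => y; rewrite /seval big_nil.
  rewrite diff_cst; apply/funext => v; rewrite big1// => j _.
  by rewrite /= mulr0.
have -> : seval (t :: s) = teval t + seval s.
  by apply/funext => y; rewrite /seval big_cons.
apply: (is_diff_eq (is_diffD (is_diff_teval x t) IH)).
apply/funext => v; rewrite !fctE -big_split/=; apply: eq_bigr => j _.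
by rewrite /seval/= big_cons mulrDr.
Qed.

Lemma tensor_poly_diff N F : tensor_poly N F ->
  exists2 dF : 'I_3 -> cV3 -> R, (forall j, tensor_poly N (dF j)) &
    forall x, is_diff x F (fun v => \sum_j v j 0 * dF j x).
Proof.
move=> [s sN FE]; exists (fun j => seval [seq dtrip j t | t <- s]).
  move=> j; exists [seq dtrip j t | t <- s] => //.
  by rewrite all_map; apply: sub_all sN => t; exact: tsize_dtrip.
have -> : F = seval s by apply/funext.
by move=> x; exact: is_diff_seval.
Qed.

Lemma tensor_poly_continuous N F : tensor_poly N F -> continuous F.
Proof.
move=> /tensor_poly_diff[dF _ FdF] x; apply: differentiable_continuous.
by have [] := FdF x.
Qed.

Lemma tensor_poly_bounded N F (B : R) : tensor_poly N F ->
  exists C, forall x : cV3, (forall i, `|x i 0| <= B) -> `|F x| <= C.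
Proof.
move=> [s _ FE].
have [C CP] : exists C, forall x : cV3, (forall i, `|x i 0| <= B) -> `|seval s x| <= C.
  elim: s {FE} => [|t s [C CP]].
    by exists 0 => x _; rewrite /seval big_nil normr0.
  have [C0 H0] := poly_itv_bound t.1.1 (- B) B.
  have [C1 H1] := poly_itv_bound t.1.2 (- B) B.
  have [C2 H2] := poly_itv_bound t.2 (- B) B.
  exists (C0 * C1 * C2 + C) => x xB; rewrite /seval big_cons.
  apply: le_trans (ler_normD _ _) _; apply: lerD; last exact: CP.
  rewrite /teval !normrM.
  by apply: ler_pM; rewrite ?mulr_ge0//; [apply: ler_pM => //; [apply: H0|apply: H1]
    |apply: H2]; rewrite -ler_norml.
by exists C => x; rewrite FE; exact: CP.
Qed.

Lemma Qp_tensor_poly p (F : cV3 -> R) : Qp p F ->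
  exists2 G, tensor_poly p.+1 G & forall x, cube x -> F x = G x.
Proof.
move=> [c FE].
exists (fun xi => \sum_i \sum_j \sum_k
  c i j k * xi 0 0 ^+ i * xi 1 0 ^+ j * xi 2%:R 0 ^+ k) => //.
do 3 apply: tensor_poly_sum => ? _.
set i := (X in c X _ _); set j := (X in c _ X _); set k := (X in c _ _ X).
exists [:: (c i j k *: 'X^i, 'X^j, 'X^k)] => [|x].
  rewrite /= /tsize/= (leq_trans (size_scale_leq _ _)) ?size_polyXn ?ltn_ord//.
by rewrite /seval big_seq1 /teval/= hornerZ !hornerXn.
Qed.

Lemma tensor_poly_Qp p (F : cV3 -> R) : tensor_poly p.+1 F -> Qp p F.
Proof.
move=> [s sp FE].
exists (fun i j k => \sum_(t <- s) t.1.1`_i * t.1.2`_j * t.2`_k) => x _.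
rewrite FE /seval.
transitivity (\sum_(t <- s) \sum_(i < p.+1) \sum_(j < p.+1) \sum_(k < p.+1)
    t.1.1`_i * t.1.2`_j * t.2`_k * x 0 0 ^+ i * x 1 0 ^+ j * x 2%:R 0 ^+ k).
  rewrite !big_seq; apply: eq_bigr => t /(allP sp)/and3P[h0 h1 h2].
  rewrite /teval (horner_coef_wide _ h0) (horner_coef_wide _ h1).
  rewrite (horner_coef_wide _ h2) big_distrlr/= mulr_suml; apply: eq_bigr => i _.
  rewrite mulr_suml; apply: eq_bigr => j _; rewrite mulr_sumr.
  by apply: eq_bigr => k _; ring.
rewrite exchange_big; apply: eq_bigr => i _.
rewrite exchange_big; apply: eq_bigr => j _.
rewrite exchange_big; apply: eq_bigr => k _.
by rewrite !mulr_suml.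
Qed.

Lemma gauss3_seval n s : gauss3 n (seval s) =
  \sum_(t <- s) gauss1 n t.1.1 * gauss1 n t.1.2 * gauss1 n t.2.
Proof.
rewrite /gauss3 /seval.
transitivity (\sum_(x <- gl_nodes n) \sum_(y <- gl_nodes n)
   \sum_(z <- gl_nodes n) \sum_(t <- s) gl_weight n x * gl_weight n y *
     gl_weight n z * (t.1.1.[x] * t.1.2.[y] * t.2.[z])).
  apply: eq_bigr => x _; apply: eq_bigr => y _; apply: eq_bigr => z _.
  rewrite mulr_sumr; apply: eq_bigr => t _.
  by rewrite /teval vec3E0 vec3E1 vec3E2.
under eq_bigr do under eq_bigr do rewrite exchange_big.
under eq_bigr do rewrite exchange_big.
rewrite exchange_big; apply: eq_bigr => t _.
rewrite /gauss1 big_distrlr/= mulr_suml; apply: eq_bigr => x _.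
rewrite mulr_suml; apply: eq_bigr => y _; rewrite mulr_sumr.
by apply: eq_bigr => z _; ring.
Qed.

End TensorPolynomials.

(** * Bounded functions of bounded support *)

Section Tame.
Context {R : realType}.
Notation mR := (measurableTypeR R).
Notation R3 := (mR * mR * mR)%type.
Notation cV3 := 'cV[R]_3.
Notation leb := (@lebesgue_measure R).

Definition in_box (C : R) : set cV3 := [set x | forall i, `|x i 0| <= C].

(** Bounded measurable functions with bounded support: a class on which
    integration is linear, closed under the operations needed below. *)
Definition tame (f : cV3 -> R) : Prop :=
  measurable_fun setT (f \o pt3 : R3 -> R) /\
  exists C, forall x, `|f x| <= C /\ (f x != 0 -> in_box C x).

Lemma in_boxW (C D : R) : C <= D -> in_box C `<=` in_box D.
Proof. by move=> CD x xC i; rewrite (le_trans (xC i)). Qed.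

Lemma tame0 : tame (fun=> 0).
Proof.
split; first exact: measurable_cst.
by exists 0 => x; rewrite normr0 eqxx.
Qed.

Lemma tameD f g : tame f -> tame g -> tame (fun x => f x + g x).
Proof.
move=> [mf [C fC]] [mg [D gD]]; split; first exact: measurable_funD.
have [C0 D0] : 0 <= C /\ 0 <= D.
  by split; [have [h _] := fC 0|have [h _] := gD 0]; rewrite (le_trans _ h).
exists (C + D) => x; have [f1 f2] := fC x; have [g1 g2] := gD x; split.
  by rewrite (le_trans (ler_normD _ _))// lerD.
case: (eqVneq (f x) 0) => [->|/f2 + _].
  by rewrite add0r => /g2; apply: in_boxW; rewrite lerDr.
by apply: in_boxW; rewrite lerDl.
Qed.

Lemma tameM f g : tame f -> tame g -> tame (fun x => f x * g x).
Proof.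
move=> [mf [C fC]] [mg [D gD]]; split; first exact: measurable_funM.
have [C0 D0] : 0 <= C /\ 0 <= D.
  by split; [have [h _] := fC 0|have [h _] := gD 0]; rewrite (le_trans _ h).
exists (C * D + C) => x; have [f1 f2] := fC x; have [g1 g2] := gD x; split.
  by rewrite normrM (le_trans (ler_pM _ _ f1 g1))// lerDl.
rewrite mulf_eq0 negb_or => /andP[/f2 + _].
by apply: in_boxW; rewrite lerDr mulr_ge0.
Qed.

Lemma tameZ a f : tame f -> tame (fun x => a * f x).
Proof.
move=> [mf [C fC]]; split; first by apply: measurable_funM.
have C0 : 0 <= C by have [h _] := fC 0; rewrite (le_trans _ h).
exists (`|a| * C + C) => x; have [f1 f2] := fC x; split.
  by rewrite normrM (le_trans (ler_wpM2l _ f1))// lerDl.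
rewrite mulf_eq0 negb_or => /andP[_ /f2].
by apply: in_boxW; rewrite lerDr mulr_ge0.
Qed.

Lemma tameN f : tame f -> tame (fun x => - f x).
Proof.
by move=> /(tameZ (-1)); under eq_fun do rewrite mulN1r.
Qed.

Lemma tameB f g : tame f -> tame g -> tame (fun x => f x - g x).
Proof. by move=> tf /tameN tg; exact: tameD. Qed.

Lemma tame_sum (I : Type) (r : seq I) (F : I -> cV3 -> R) :
  (forall i, tame (F i)) -> tame (fun x => \sum_(i <- r) F i x).
Proof.
move=> tF; elim: r => [|i r IH].
  by under eq_fun do rewrite big_nil; exact: tame0.
by under eq_fun do rewrite big_cons; exact: tameD.
Qed.

Lemma in_box_bounded_affine (M : 'M[R]_3) b C :
  exists D, forall x, in_box C x -> in_box D (b + M *m x).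
Proof.
exists (\sum_i (`|b i 0| + \sum_j `|M i j| * `|C|)) => x xC i.
rewrite mxE (le_trans (ler_normD _ _))// mxE [leRHS](bigD1 i)//= -[leLHS]addr0.
apply: lerD; last by apply: sumr_ge0 => k _; rewrite addr_ge0// sumr_ge0// => *;
  rewrite mulr_ge0.
rewrite lerD2l (le_trans (ler_norm_sum _ _ _))// ler_sum// => j _.
by rewrite normrM ler_wpM2l// (le_trans (xC j)) ?ler_norm.
Qed.

Lemma tame_affine (M : 'M[R]_3) b f : M \in unitmx -> tame f ->
  tame (fun x => f (b + M *m x)).
Proof.
move=> uM [mf [C fC]]; split.
  have -> : (fun x => f (b + M *m x)) \o pt3 =
      (f \o pt3) \o (fun x : R3 => unpt3 (b + M *m pt3 x)).
    by apply/funext => x /=; rewrite unpt3K.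
  apply: (measurableT_comp mf); exact: measurable_affine3.
have [D DP] := in_box_bounded_affine (invmx M) (- (invmx M *m b)) C.
exists (`|C| + `|D|) => x; have [f1 f2] := fC (b + M *m x); split.
  by rewrite (le_trans f1)// (le_trans (ler_norm _))// lerDl.
move=> /f2/DP; rewrite mulmxDr mulmxA mulVmx// mul1mx addKr.
by apply: in_boxW; rewrite (le_trans (ler_norm _))// lerDr.
Qed.

Lemma tame_continuous f C : continuous f ->
  (forall x, `|f x| <= C /\ (f x != 0 -> in_box C x)) -> tame f.
Proof. by move=> cf fC; split; [exact: measurable_continuous3|exists C]. Qed.

Lemma tame_indic (D : set cV3) f C : measurable (pt3 @^-1` D : set R3) ->
  D `<=` in_box C -> (forall x, D x -> `|f x| <= C) ->
  measurable_fun setT (f \o pt3 : R3 -> R) ->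
  tame (fun x => f x * \1_D x).
Proof.
move=> mD DC fC mf; split.
  apply: measurable_funM => //.
  apply: (eq_measurable_fun (\1_(pt3 @^-1` D) : R3 -> R)) => [x _|].
    by rewrite !indicE; congr (_%:R); apply/idP/idP => /set_mem h; exact/mem_set.
  exact: measurable_indic.
exists `|C| => x; rewrite indicE; case: (boolP (x \in D)) => xD.
  rewrite mulr1; split => [|_]; first by rewrite (le_trans (fC _ (set_mem xD)))// ler_norm.
  by apply: in_boxW (DC _ (set_mem xD)); exact: ler_norm.
by rewrite mulr0 eqxx normr0.
Qed.

Lemma leb3_box (A B C : set mR) : measurable A -> measurable B -> measurable C ->
  leb3 ((A `*` B) `*` C) = (leb A * leb B * leb C)%E.
Proof.
move=> mA mB mC.
have E1 := @product_measure1E _ _ _ _ R leb2 leb _ C (measurableX mA mB) mC.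
have E2 := @product_measure1E _ _ _ _ R leb leb A B mA mB.
by rewrite -E2; exact: E1.
Qed.

Lemma leb3_in_box C : 
  measurable (pt3 @^-1` in_box C : set R3) /\ (leb3 (pt3 @^-1` in_box C) < +oo)%E.
Proof.
have -> : pt3 @^-1` in_box C = (`[-C, C]%classic `*` `[-C, C]%classic)
    `*` `[-C, C]%classic :> set R3.
  apply/seteqP; split => [x /= xC|x [[x0 x1] x2]].
    have := xC 0; have := xC 1; have := xC 2%:R.
    by rewrite /pt3 vec3E0 vec3E1 vec3E2 !in_itv/= !ler_norml => -> -> ->.
  by move: x0 x1 x2; rewrite /= !in_itv/= -!ler_norml => ? ? ?; apply: ord3P;
    rewrite /pt3 ?vec3E0 ?vec3E1 ?vec3E2.
split; first by apply: measurableX => //; apply: measurableX.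
rewrite leb3_box// lebesgue_measure_itv/=.
by case: ifP => _; rewrite ?mule0 -?EFinD -?EFinM ltry.
Qed.

Lemma tame_integrable f : tame f ->
  leb3.-integrable setT (EFin \o (f \o pt3)).
Proof.
move=> [mf [C fC]]; have [mB B_fin] := leb3_in_box C.
have -> : EFin \o (f \o pt3) = (EFin \o (f \o pt3)) \_ (pt3 @^-1` in_box C).
  apply/funext => x; rewrite patchE; case: ifPn => // xC.
  congr EFin; apply/eqP; apply: contraNT xC => fx; rewrite inE.
  by have [_ /(_ fx)] := fC (pt3 x).
apply: (integrable_mkcond _ mB).1.
have bf : [bounded f (pt3 x) | x in pt3 @^-1` in_box C].
  exists C; split; first exact: num_real.
  by move=> M CM x _ /=; have [h _] := fC (pt3 x); rewrite (le_trans h)// ltW.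
have mf' := measurable_funS measurableT (@subsetT _ (pt3 @^-1` in_box C)) mf.
exact: measurable_bounded_integrable mB B_fin mf' bf.
Qed.

Definition integ (f : cV3 -> R) : R := int3 setT f.

Lemma integE f : integ f = fine (\int[leb3]_x (f (pt3 x))%:E)%E.
Proof. by []. Qed.

Lemma int3E D f : int3 D f = integ (fun x => f x * \1_D x).
Proof.
rewrite /integ /int3 Rintegral_mkcond [in RHS]Rintegral_mkcond.
rewrite preimage_setT; apply: eq_Rintegral => x _; rewrite !patchE/= in_setT.
rewrite indicE; have -> : (pt3 x \in D) = (x \in pt3 @^-1` D) by apply/idP/idP => /set_mem h; exact/mem_set.
by case: ifP; rewrite ?mulr1 ?mulr0.
Qed.

Lemma integD f g : tame f -> tame g ->
  integ (fun x => f x + g x) = integ f + integ g.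
Proof.
move=> tf tg; rewrite /integ /int3 preimage_setT RintegralD//;
  exact: tame_integrable.
Qed.

Lemma integZ a f : tame f -> integ (fun x => a * f x) = a * integ f.
Proof.
move=> tf; rewrite /integ /int3 preimage_setT RintegralZl//;
  exact: tame_integrable.
Qed.

Lemma integB f g : tame f -> tame g ->
  integ (fun x => f x - g x) = integ f - integ g.
Proof.
move=> tf tg; rewrite integD//; last exact: tameN.
by rewrite -mulN1r -integZ//; congr (_ + integ _); apply/funext => x;
  rewrite mulN1r.
Qed.

Lemma integ0 : integ (fun=> 0) = 0.
Proof.
by rewrite -[RHS](mul0r (integ (fun=> 0))) -integZ; [congr integ; apply/funext => x;
  rewrite mulr0 | exact: tame0].
Qed.

Lemma integ_sum (I : Type) (r : seq I) (F : I -> cV3 -> R) :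
  (forall i, tame (F i)) ->
  integ (fun x => \sum_(i <- r) F i x) = \sum_(i <- r) integ (F i).
Proof.
move=> tF; elim: r => [|i r IH].
  by rewrite big_nil -[RHS]integ0; congr integ; apply/funext => x; rewrite big_nil.
rewrite big_cons -IH -integD//; last exact: tame_sum.
by congr integ; apply/funext => x; rewrite big_cons.
Qed.

Lemma integ_ge0 f : (forall x, 0 <= f x) -> 0 <= integ f.
Proof. by move=> f0; apply: Rintegral_ge0. Qed.

Definition null3 (N : set cV3) : Prop :=
  measurable (pt3 @^-1` N : set R3) /\ leb3 (pt3 @^-1` N) = 0%E.

Lemma int3_off_null N D E f g : null3 N -> (forall x, ~ N x -> D x <-> E x) ->
  (forall x, ~ N x -> D x -> f x = g x) -> int3 D f = int3 E g.
Proof.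
move=> [mN N0] DE fg; rewrite /int3 /Rintegral; congr fine.
apply: (@integral_eq_domain_off_null _ _ _ leb3 _ _ _ _ _ mN N0) => x Nx.
  exact: DE.
by move=> Dx; rewrite /= fg.
Qed.

Lemma integ_affine (M : 'M[R]_3) b f : M \in unitmx -> tame f ->
  integ f = `|\det M| * integ (fun x => f (b + M *m x)).
Proof.
move=> uM tf; have dM : \det M != 0 by move: uM; rewrite unitmxE unitfE.
have ge0 g : (forall x, 0 <= g x) -> tame g ->
    integ g = `|\det M| * integ (fun x => g (b + M *m x)).
  move=> g0 tg; have tg' := tame_affine b uM tg.
  rewrite !integE (change_of_variablesP b dM)//.
  - rewrite fineM//; last first.
      apply: (@integrable_fin_num _ _ _ leb3) => //.
      have := tame_integrable tg'; congr (integrable _ _ _).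
      by apply/funext => x /=; rewrite unpt3K.
    by congr (_ * fine _); apply: eq_integral => x _; rewrite unpt3K.
  - by have := measurable_int _ (tame_integrable tg).
  - by move=> x; rewrite lee_fin.
have ta : tame (fun x => `|f x|).
  case: tf => mf [C fC]; split; first exact: measurableT_comp.
  by exists C => x; rewrite normr_id normr_eq0.
have tb := tameB ta tf.
have E y : `|f y| - (`|f y| - f y) = f y by rewrite opprB addrC subrK.
transitivity (integ (fun x => `|f x|) - integ (fun x => `|f x| - f x)).
  by rewrite -integB//; congr integ; apply/funext => x; rewrite E.
have b0 x : 0 <= `|f x| - f x by rewrite subr_ge0 ler_norm.
rewrite (ge0 _ (fun x => normr_ge0 (f x)) ta) (ge0 _ b0 tb) -mulrBr.
rewrite -(integB (tame_affine b uM ta) (tame_affine b uM tb)).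
by congr (_ * integ _); apply/funext => x; rewrite E.
Qed.

End Tame.

(** * Integrals over the reference cube *)

Section ProductIntegral.
Context d1 d2 (T1 : measurableType d1) (T2 : measurableType d2) {R : realType}.
Variables (m1 : {sigma_finite_measure set T1 -> \bar R})
  (m2 : {sigma_finite_measure set T2 -> \bar R}).
Variables (f : T1 -> R) (g : T2 -> R) (a b : R).
Hypothesis (intf : m1.-integrable setT (EFin \o f))
  (intg : m2.-integrable setT (EFin \o g)).
Hypothesis (fE : (\int[m1]_x (f x)%:E = a%:E)%E)
  (gE : (\int[m2]_x (g x)%:E = b%:E)%E).
Local Open Scope ereal_scope.

Let mfg : measurable_fun setT (fun w : T1 * T2 => (f w.1 * g w.2)%R).
Proof.
apply: measurable_funM; apply: measurableT_comp => //.
  by apply/measurable_EFinP; exact: measurable_int intf.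
by apply/measurable_EFinP; exact: measurable_int intg.
Qed.

Lemma integrable_tensor :
  (m1 \x m2).-integrable setT (fun w => (f w.1 * g w.2)%:E).
Proof.
have mf := measurable_int _ intf; have mg := measurable_int _ intg.
apply/integrable12ltyP; first exact/measurable_EFinP.
have /integrableP[_ f_fin] := intf; have /integrableP[_ g_fin] := intg.
have E x : \int[m2]_y `|(f (x, y).1 * g (x, y).2)%:E| =
    `|(f x)%:E| * \int[m2]_y `|(g y)%:E|.
  rewrite -ge0_integralZl//; last by apply: measurableT_comp.
  by apply: eq_integral => y _; rewrite EFinM abseM.
under eq_integral do rewrite E.
rewrite ge0_integralZr//; last 2 first.
- exact: measurableT_comp.
- exact: integral_ge0.
by rewrite lte_mul_pinfty ?integral_ge0// ge0_fin_numE// integral_ge0.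
Qed.

Lemma integral_tensor :
  \int[m1 \x m2]_w (f w.1 * g w.2)%:E = (a * b)%:E.
Proof.
rewrite -(integral12_prod_meas1 integrable_tensor) /fubini_F/=.
under eq_integral do under eq_integral do rewrite EFinM.
under eq_integral do rewrite integralZl// gE -EFinM mulrC EFinM.
by rewrite integralZl// fE -EFinM mulrC.
Qed.

End ProductIntegral.

Section CubeIntegral.
Context {R : realType}.
Notation mR := (measurableTypeR R).
Notation R3 := (mR * mR * mR)%type.
Notation cV3 := 'cV[R]_3.
Notation leb := (@lebesgue_measure R).

Lemma cubeE : (cube : set cV3) = in_box 1.
Proof.
by apply/seteqP; split => x xc i; have := xc i; rewrite ler_norml.
Qed.

Lemma measurable_cube : measurable (pt3 @^-1` (cube : set cV3) : set R3).
Proof. by rewrite cubeE; have [] := leb3_in_box (1 : R). Qed.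

Lemma tensor_poly_measurable N (F : cV3 -> R) : tensor_poly N F ->
  measurable_fun setT (F \o pt3 : R3 -> R).
Proof. by move=> /tensor_poly_continuous; exact: measurable_continuous3. Qed.

Lemma tame_tensor_poly N (F : cV3 -> R) (D : set cV3) C : tensor_poly N F ->
  measurable (pt3 @^-1` D : set R3) -> D `<=` in_box C ->
  tame (fun x => F x * \1_D x).
Proof.
move=> tF mD DC; have [B FB] := tensor_poly_bounded C tF.
apply: (@tame_indic _ _ _ (`|B| + `|C|)) => //; last exact: tensor_poly_measurable tF.
  by move=> x /DC; apply: in_boxW; rewrite (le_trans (ler_norm _))// lerDr.
by move=> x /DC/FB h; rewrite (le_trans h)// (le_trans (ler_norm _))// lerDl.
Qed.

Lemma tame_cube N (F : cV3 -> R) : tensor_poly N F ->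
  tame (fun x => F x * \1_cube x).
Proof.
move=> tF; apply: (@tame_tensor_poly N _ _ 1) => //; first exact: measurable_cube.
by rewrite cubeE.
Qed.

Let cut (p : {poly R}) (t : mR) : R := p.[t] * \1_(`[-1, 1]%classic : set R) t.

Let cut_patch p : EFin \o cut p = (EFin \o horner p) \_ (`[-1, 1]%classic : set R).
Proof.
apply/funext => t; rewrite /cut/= patchE indicE.
by case: ifP; rewrite ?mulr1 ?mulr0.
Qed.

Let integrable_cut p : leb.-integrable setT (EFin \o cut p).
Proof.
rewrite cut_patch; apply: (integrable_mkcond _ _).1 => //.
apply: continuous_compact_integrable; first exact: segment_compact.
exact/continuous_subspaceT/continuous_horner.
Qed.

Let integral_cut p : (\int[leb]_t (cut p t)%:E = (pint p)%:E)%E.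
Proof.
have := cut_patch p; rewrite /comp => ->.
rewrite -integral_mkcond -Rintegral_horner /Rintegral fineK//.
apply: integrable_fin_num => //.
apply: continuous_compact_integrable; first exact: segment_compact.
exact/continuous_subspaceT/continuous_horner.
Qed.

Lemma int3_cube_teval (t : {poly R} * {poly R} * {poly R}) :
  int3 cube (teval t) = pint t.1.1 * pint t.1.2 * pint t.2.
Proof.
rewrite int3E integE.
have i12 := integrable_tensor (integrable_cut t.1.1) (integrable_cut t.1.2).
have e12 := integral_tensor (integrable_cut t.1.1) (integrable_cut t.1.2)
  (integral_cut t.1.1) (integral_cut t.1.2).
have := @integral_tensor _ _ _ _ R leb2 leb
  (fun w => cut t.1.1 w.1 * cut t.1.2 w.2) (cut t.2) _ _ i12 (integrable_cut t.2)
  e12 (integral_cut t.2).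
move=> e123; rewrite -[RHS]/(fine (_%:E)) -e123; congr fine.
apply: eq_integral => -[[x y] z] _; congr EFin.
rewrite /teval /cut /pt3 vec3E0 vec3E1 vec3E2 /=.
have -> : \1_cube (vec3 x y z) = \1_(`[-1, 1]%classic : set R) x *
    \1_(`[-1, 1]%classic : set R) y * \1_(`[-1, 1]%classic : set R) z :> R.
  rewrite !indicE -!natrM !mulnb; congr (nat_of_bool _)%:R.
  apply/idP/idP => [/set_mem xyz|/andP[/andP[/set_mem h0 /set_mem h1] /set_mem h2]].
    have := xyz 0; have := xyz 1; have := xyz 2%:R.
    rewrite vec3E0 vec3E1 vec3E2 => h2 h1 h0.
    by apply/andP; split; [apply/andP; split|]; apply/mem_set; rewrite /= in_itv.
  apply/mem_set; apply: ord3P; rewrite ?vec3E0 ?vec3E1 ?vec3E2.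
  - by move: h0; rewrite /= in_itv.
  - by move: h1; rewrite /= in_itv.
  - by move: h2; rewrite /= in_itv.
by ring.
Qed.

Lemma int3_cube_cst1 : int3 cube (fun=> 1 : R) = 8.
Proof.
transitivity (int3 cube (teval (1, 1, 1) : cV3 -> R)).
  congr int3; apply/funext => x; by rewrite /teval/= !hornerC !mulr1.
rewrite int3_cube_teval/=; have -> : pint (1 : {poly R}) = 2.
  by rewrite -derivX pint_deriv !hornerX; ring.
by ring.
Qed.

Lemma tensor_poly_teval (t : {poly R} * {poly R} * {poly R}) :
  tensor_poly (size t.1.1 + size t.1.2 + size t.2) (teval t).
Proof.
exists [:: t]; last by move=> x; rewrite /seval big_seq1.
rewrite /= /tsize andbT -addnA leq_addr addnCA leq_addr.
by rewrite addnCA addnA leq_addl.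
Qed.

Lemma int3_cube_seval (s : seq ({poly R} * {poly R} * {poly R})) :
  int3 cube (seval s) = \sum_(t <- s) pint t.1.1 * pint t.1.2 * pint t.2.
Proof.
rewrite int3E; transitivity (integ (fun x => \sum_(t <- s) teval t x * \1_cube x)).
  by congr integ; apply/funext => x; rewrite mulr_suml.
rewrite integ_sum; last by move=> t; exact: tame_cube (tensor_poly_teval t).
by apply: eq_bigr => t _; rewrite -int3_cube_teval int3E.
Qed.

(** Both sides are sums of products of three one-dimensional functionals, which
    agree on polynomials of degree less than [2 * n]. *)
Lemma gauss3_exact n (F : cV3 -> R) : tensor_poly (n + n) F ->
  gauss3 n F = int3 cube F.
Proof.
move=> [s sn FE]; have -> : F = seval s by apply/funext.
rewrite gauss3_seval int3_cube_seval !big_seq; apply: eq_bigr => t.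
by move=> /(allP sn)/and3P[h0 h1 h2]; rewrite !gauss1_exact.
Qed.

Definition cubeo : set cV3 := [set x | forall i, `|x i 0| < 1].

Lemma cubeo_cube : cubeo `<=` cube.
Proof. by move=> x xc; rewrite cubeE => i; exact: ltW. Qed.

Lemma open_cubeo : open cubeo.
Proof.
pose S i := [set x : cV3 | `|x i 0| < 1].
have oS i : open (S i).
  apply: (@open_comp _ _ (fun x : cV3 => `|x i 0|) [set t | t < 1]); last exact: open_lt.
  move=> x _; apply: (@continuous_comp _ _ _ (fun y : cV3 => y i 0) Num.norm).
    exact: coord_continuous.
  exact: norm_continuous.
have -> : cubeo = S 0 `&` S 1 `&` S 2%:R.
  apply/seteqP; split => [x h|x [[h0 h1] h2]]; last exact: ord3P.
  by split; [split|]; exact: h.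
by apply: openI => //; exact: openI.
Qed.

Lemma null3_cube_boundary : null3 (cube `\` cubeo).
Proof.
have mN : measurable (pt3 @^-1` (cube `\` cubeo) : set R3).
  apply: (@measurableD _ _ (pt3 @^-1` cube : set R3) (pt3 @^-1` cubeo)); first exact: measurable_cube.
  exact: measurable_open3 open_cubeo.
split => //; apply/(@negligibleP _ _ _ leb3) => //.
pose E : set mR := [set -1] `|` [set 1].
have mE : measurable E by apply: measurableU; exact: measurable_set1.
have E0 : leb E = 0%E.
  rewrite measureU0//; first exact: lebesgue_measure_set1.
  exact: lebesgue_measure_set1.
pose A0 := (E `*` setT) `*` setT : set R3; pose A1 := (setT `*` E) `*` setT : set R3.
pose A2 := (setT `*` setT) `*` E : set R3.
have n0 : leb3.-negligible A0.
  apply/negligibleP; first by apply: measurableX => //; apply: measurableX.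
  by rewrite [LHS]leb3_box// E0 !mul0e.
have n1 : leb3.-negligible A1.
  apply/negligibleP; first by apply: measurableX => //; apply: measurableX.
  by rewrite [LHS]leb3_box// E0 mule0 mul0e.
have n2 : leb3.-negligible A2.
  apply/negligibleP; first by apply: measurableX => //; apply: measurableX.
  by rewrite [LHS]leb3_box// E0 mule0.
apply: (negligibleS _ (negligibleU (negligibleU n0 n1) n2)) => -[[x y] z] /= [xc xo].
have face i : ~ `|pt3 (x, y, z) i 0| < 1 -> E (pt3 (x, y, z) i 0).
  move: (xc i) => /andP[lo hi] /negP; rewrite -leNgt.
  rewrite ler_normr => /orP[h|h]; [right|left]; apply/eqP; rewrite /= eq_le.
    by rewrite hi h.
  by rewrite lo andbT; lra.
apply: contrapT => /not_orP[/not_orP[h0 h1] h2]; apply: xo.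
apply: ord3P; apply: contrapT => /face; rewrite /pt3 ?vec3E0 ?vec3E1 ?vec3E2 => h.
- exact: h0.
- exact: h1.
- exact: h2.
Qed.

End CubeIntegral.

(** * Cells and mesh *)

Section AffineContinuity.
Context {R : realType}.
Notation cV3 := 'cV[R]_3.

Lemma continuous_mx (T : topologicalType) m n (f : T -> 'M[R]_(m, n)) :
  (forall i j, continuous (fun x => f x i j)) -> continuous f.
Proof.
move=> cf x; apply/cvg_ballP => e e0.
have H : \forall y \near x, forall i j, ball (f x i j) e (f y i j).
  apply: filter_forall => i; apply: filter_forall => j.
  by have /cvg_ballP/(_ e e0) := cf i j x.
by near=> y; split => //; near: y.
Unshelve. all: by end_near. Qed.

Lemma continuous_affine3 (M : 'M[R]_3) b : continuous (fun x : cV3 => b + M *m x).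
Proof.
apply: continuous_mx => i j.
have -> : (fun x : cV3 => (b + M *m x) i j) =
    (fun x => b i j + (M i 0 * x 0 j + M i 1 * x 1 j + M i 2%:R * x 2%:R j)).
  by apply/funext => x; rewrite !mxE sum3E.
move=> x.
have cM k : (fun y : cV3 => M i k * y k j) @ x --> M i k * x k j.
  exact: (cvgM (cvg_cst (M i k)) (@coord_continuous _ _ _ k j x)).
exact: (cvgD (cvg_cst _) (cvgD (cvgD (cM 0) (cM 1)) (cM 2%:R))).
Qed.

Lemma cubeo_scale (s : R) (xi : cV3) : 0 <= s < 1 -> cube xi -> cubeo (s *: xi).
Proof.
move=> /andP[s0 s1]; rewrite cubeE => xc i; rewrite mxE normrM ger0_norm//.
by rewrite (le_lt_trans _ s1)// -[leRHS]mulr1 ler_wpM2l.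
Qed.

End AffineContinuity.

Section Cells.
Context {R : realType} {m : nat}.
Notation mR := (measurableTypeR R).
Notation R3 := (mR * mR * mR)%type.
Notation cV3 := 'cV[R]_3.
Variable T : hexes R m.
Implicit Types e f : 'I_m.

Lemma hexA_unit e : hexA T e \in unitmx.
Proof. by rewrite unitmxE unitfE gt_eqF// hexA_det. Qed.

Lemma cellXK e : cancel (cellX T e) (cellXinv T e).
Proof. by move=> x; rewrite /cellXinv /cellX addrC addKr mulKmx// hexA_unit. Qed.

Lemma cellXinvK e : cancel (cellXinv T e) (cellX T e).
Proof. by move=> x; rewrite /cellXinv /cellX mulKVmx ?hexA_unit// addrC subrK. Qed.

Lemma cellXinvE e x : cellXinv T e x =
  - (invmx (hexA T e) *m hexb T e) + invmx (hexA T e) *m x.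
Proof. by rewrite /cellXinv mulmxBr addrC. Qed.

Lemma continuous_cellX e : continuous (cellX T e).
Proof. exact: continuous_affine3. Qed.

Lemma continuous_cellXinv e : continuous (cellXinv T e).
Proof.
have -> : cellXinv T e = fun x => - (invmx (hexA T e) *m hexb T e) + invmx (hexA T e) *m x.
  by apply/funext => x; exact: cellXinvE.
exact: continuous_affine3.
Qed.

Definition cello e : set cV3 := cellXinv T e @^-1` cubeo.

Lemma cellP e x : cell T e x <-> cube (cellXinv T e x).
Proof.
split => [[xi xic <-]|xc]; first by rewrite cellXK.
by exists (cellXinv T e x) => //; exact: cellXinvK.
Qed.

Lemma cello_cell e : cello e `<=` cell T e.
Proof. by move=> x xc; apply/cellP; exact: cubeo_cube. Qed.

Lemma open_cello e : open (cello e).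
Proof.
by apply: open_comp => [x _|]; [exact: continuous_cellXinv|exact: open_cubeo].
Qed.

Lemma interior_cell e : (cell T e)° = cello e.
Proof.
apply/seteqP; split; last first.
  by move=> x xc; apply: (@filterS _ _ _ (cello e)); [exact: cello_cell|
    apply: open_nbhs_nbhs; split => //; exact: open_cello].
move=> x xc i; set xi := cellXinv T e x.
have : nbhs xi (cellX T e @^-1` cell T e).
  by apply: continuous_cellX; rewrite /xi cellXinvK.
move=> /nbhs_ballP[r /= r0 rc].
pose s : R := if 0 <= xi i 0 then 1 else -1.
have s1 : `|s| = 1 by rewrite /s; case: ifP; rewrite ?normrN normr1.
have sE : `|xi i 0| = s * xi i 0.
  rewrite /s; case: ifPn => [h|]; first by rewrite mul1r ger0_norm.
  by rewrite -ltNge => h; rewrite mulN1r ltr0_norm.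
pose y := xi + (r / 2 * s) *: delta_mx i 0.
have : cube y.
  rewrite -(cellXK e y); apply/cellP; apply: rc; split=> // k l.
  rewrite /ball/= /y !mxE opprD addrA subrr add0r normrN !normrM s1 mulr1.
  rewrite (ord1 l) eqxx andbT gtr0_norm ?divr_gt0// gtr0_norm ?invr_gt0//.
  case: (k == i); rewrite ?mulr1 ?mulr0 ?normr1 ?normr0 ?mulr1 ?mulr0//; lra.
have yE : y i 0 = xi i 0 + r / 2 * s.
  by rewrite /y mxE [X in _ + X]mxE [X in _ * X]mxE !eqxx/= mulr1.
rewrite cubeE => /(_ i); rewrite yE => h.
have : s * (xi i 0 + r / 2 * s) <= 1.
  by apply: le_trans (ler_norm _) _; rewrite normrM s1 mul1r.
have ss : s * s = 1 by rewrite /s; case: ifP => _; ring.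
rewrite sE mulrDr (mulrC (r / 2)) mulrA ss mul1r; lra.
Qed.

(** Every point of a cell is approached by interior points, along the segment
    to the centre. *)
Lemma cell_limit e x : cell T e x -> forall A, nbhs x A -> exists2 y, A y & cello e y.
Proof.
move=> /cellP xc A xA.
have : nbhs (1 : R) (fun s => A (cellX T e (s *: cellXinv T e x))).
  have c : continuous (fun s : R => cellX T e (s *: cellXinv T e x)).
    move=> s; apply: continuous_comp; first exact: scalel_continuous.
    exact: continuous_cellX.
  by apply: c; rewrite scale1r cellXinvK.
move=> /nbhs_ballP[r /= r0 rA].
pose s := 1 - Num.min (r / 2) (1 / 2).
have r2 : 0 < r / 2 by rewrite divr_gt0.
have [h1 h2] : 0 < Num.min (r / 2) (1 / 2) /\ Num.min (r / 2) (1 / 2) <= 1 / 2.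
  by rewrite lt_min r2 ge_min lexx orbT; split => //; lra.
have h3 : Num.min (r / 2) (1 / 2) <= r / 2 by rewrite ge_min lexx.
exists (cellX T e (s *: cellXinv T e x)).
  by apply: rA; rewrite /ball/= /s opprB addrC subrK gtr0_norm//; lra.
by rewrite /cello /= cellXK; apply: cubeo_scale => //; rewrite /s; lra.
Qed.

Lemma measurable_cell e : measurable (pt3 @^-1` cell T e : set R3).
Proof.
have -> : pt3 @^-1` cell T e = (fun x : R3 => unpt3 (cellXinv T e (pt3 x)))
    @^-1` (pt3 @^-1` cube).
  by apply/seteqP; split => x /=; rewrite unpt3K => /cellP.
rewrite -[X in measurable X]setTI.
have mX : measurable_fun setT (fun x : R3 => unpt3 (cellXinv T e (pt3 x))).
  under eq_fun do rewrite cellXinvE; exact: measurable_affine3.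
by apply: mX => //; exact: measurable_cube.
Qed.

Lemma measurable_cello e : measurable (pt3 @^-1` cello e : set R3).
Proof. exact: measurable_open3 (@open_cello e). Qed.

Lemma null3_cell_boundary e : null3 (cell T e `\` cello e).
Proof.
set N := cell T e `\` cello e.
have mN : measurable (pt3 @^-1` N : set R3).
  exact: (measurableD (measurable_cell e) (measurable_cello e)).
split => //; have [mC C0] := @null3_cube_boundary R.
have H (A : set R3) : measurable A ->
    leb3 A = (\int[leb3]_x ((cst 1%E : R3 -> \bar R) \_ A) x)%E.
  by move=> mA; rewrite -integral_mkcond integral_cst// mul1e.
have HN := H _ mN; rewrite HN.
have dA : \det (hexA T e) != 0 by rewrite gt_eqF// hexA_det.
rewrite (change_of_variablesP (hexb T e) dA)//; last 2 first.
- have := @measurable_indic _ _ R setT _ mN.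
  move=> /measurable_EFinP; apply: eq_measurable_fun => x _.
  by rewrite patchE /= indicE; case: ifP.
- by move=> x; rewrite patchE; case: ifP.
suff E0 : (\int[leb3]_x ((cst 1%E : R3 -> \bar R) \_ (pt3 @^-1` N))
    (unpt3 (hexb T e + hexA T e *m pt3 x)) = 0)%E by rewrite E0 mule0.
have HC := H _ mC; rewrite -[RHS]C0 HC.
apply: eq_integral => x _; rewrite !patchE.
have -> : (unpt3 (hexb T e + hexA T e *m pt3 x) \in pt3 @^-1` N) =
    (x \in pt3 @^-1` (cube `\` cubeo)); last by [].
have E : N (pt3 (unpt3 (cellX T e (pt3 x)))) <-> (cube `\` cubeo) (pt3 x).
  rewrite unpt3K /N /cello; split.
    by move=> [/cellP + /=]; rewrite cellXK.
  by move=> [h1 h2]; split; [apply/cellP; rewrite cellXK|rewrite /= cellXK].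
by apply/idP/idP => /set_mem h; apply/mem_set; apply/E.
Qed.

Lemma int3_cell e (g : cV3 -> R) : tame (fun x => g x * \1_(cell T e) x) ->
  int3 (cell T e) g = \det (hexA T e) * int3 cube (fun xi => g (cellX T e xi)).
Proof.
move=> tf; rewrite !int3E (integ_affine (hexb T e) (hexA_unit e) tf).
rewrite gtr0_norm ?hexA_det//; congr (_ * integ _); apply/funext => xi.
congr (_ * _); rewrite !indicE; congr (nat_of_bool _)%:R.
apply/idP/idP => /set_mem h; apply/mem_set.
  by have /cellP := h; rewrite cellXK.
by apply/cellP; rewrite cellXK.
Qed.

Lemma cellVE e : cellV T e = 8 * \det (hexA T e).
Proof.
have t1 : tensor_poly 1 (fun=> 1 : R) by exact: tensor_poly_cst.
have -> : cellV T e = int3 (cell T e) (fun=> 1).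
  rewrite /cellV /vol /int3 Rintegral_cst ?mul1r//; exact: measurable_cell.
have [C cellC] : exists C, cell T e `<=` in_box C.
  have [D DP] := in_box_bounded_affine (hexA T e) (hexb T e) 1.
  by exists D => x [xi]; rewrite cubeE => /DP ? <-.
rewrite int3_cell; last exact: (tame_tensor_poly t1 (measurable_cell e) cellC).
by rewrite int3_cube_cst1 mulrC.
Qed.

Lemma cellV_gt0 e : 0 < cellV T e.
Proof. by rewrite cellVE mulr_gt0// hexA_det. Qed.

Lemma cell_in_box e : exists C, cell T e `<=` in_box C.
Proof.
have [D DP] := in_box_bounded_affine (hexA T e) (hexb T e) 1.
by exists D => x [xi]; rewrite cubeE => /DP ? <-.
Qed.

End Cells.

Section Mesh.
Context {R : realType} {m : nat}.
Notation cV3 := 'cV[R]_3.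
Variables (Om : set cV3) (T : hexes R m).
Hypotheses (HOm : bounded_lipschitz_domain Om) (Hmesh : conforming_mesh Om T).
Implicit Types e f : 'I_m.

(** A point of [cell T f] interior to [cell T e] would have interior points of
    [cell T f] nearby, common to both interiors. *)
Lemma cello_cell_disjoint e f : e != f -> cello T e `&` cell T f = set0.
Proof.
move=> ef; apply/seteqP; split => // x [xe xf].
have [y ye yf] := cell_limit xf (open_nbhs_nbhs (conj (@open_cello _ _ T e) xe)).
have [_ /(_ _ _ ef) dis _] := Hmesh.
have : ((cell T e)° `&` (cell T f)°) y by rewrite !interior_cell.
by rewrite dis.
Qed.

Lemma Om_cells x : Om x -> exists e, cell T e x.
Proof.
move=> Omx; have [clo _ _] := Hmesh; have : closure Om x by exact: subset_closure.
by rewrite clo => -[e _ ?]; exists e.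
Qed.

Lemma lipschitz_continuous (h : R * R -> R) : lipschitz h -> continuous h.
Proof.
move=> [M [_ hM]] x; pose K := `|M| + 1.
have K0 : 0 < K by rewrite ltr_pwDr.
have hK a b : `|h a - h b| <= K * `|a - b|.
  have /hM : M < K by rewrite /K (le_lt_trans (ler_norm _))// ltrDl.
  by move=> /(_ (a, b)); apply.
apply/cvg_ballP => e e0.
have : \forall y \near x, ball x (e / K) y by apply: nbhsx_ballx; rewrite divr_gt0.
apply: filterS => y; rewrite -ball_normE /= => xy.
by rewrite /ball/= (le_lt_trans (hK _ _))// mulrC -ltr_pdivlMr.
Qed.

(** The interior of a cell lies in the domain: below a boundary point the
    Lipschitz graph leaves points that are not even in the closure. *)
Lemma cello_Om e : cello T e `<=` Om.
Proof.
have [Om0 oOm _ _ lipOm] := HOm; have [clo _ _] := Hmesh.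
have cellcl x : cell T e x -> closure Om x by rewrite clo; exists e.
move=> x xe; apply: contrapT => nOm.
have [|Q [h [QQ lip ep]]] := lipOm x.
  by split; [exact/cellcl/cello_cell|rewrite (interior_id Om).1].
pose G (y : cV3) := h ((Q *m y) 0 0, (Q *m y) 1 0) - (Q *m y) 2%:R 0.
have cQ i : continuous (fun y : cV3 => (Q *m y) i 0).
  have c : continuous (fun y : cV3 => Q *m y).
    have -> : (fun y : cV3 => Q *m y) = (fun y => 0 + Q *m y).
      by apply/funext => y; rewrite add0r.
    exact: continuous_affine3.
  move=> y; apply: (@continuous_comp _ _ _ (fun y : cV3 => Q *m y) (fun z : cV3 => z i 0)).
    exact: c.
  exact: coord_continuous.
have cG : continuous G.
  have ch : continuous (h \o (fun y : cV3 => ((Q *m y) 0 0, (Q *m y) 1 0))).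
    move=> y; apply: continuous_comp; last exact: lipschitz_continuous.
    exact: (cvg_pair (cQ 0 y) (cQ 1 y)).
  by move=> y; exact: (cvgB (ch y) (cQ 2%:R y)).
have Gx : 0 <= G x.
  by rewrite subr_ge0 leNgt; apply/negP => /(nbhs_singleton ep).
pose y (s : R) := x - s *: (Q^T *m delta_mx 2%:R 0).
have QT : Q *m (Q^T *m delta_mx 2%:R 0) = delta_mx 2%:R 0 :> cV3.
  by rewrite mulmxA QQ mul1mx.
have Gy s : G (y s) = G x + s.
  rewrite /G /y mulmxBr -scalemxAr QT.
  have E i : (Q *m x - s *: delta_mx 2%:R 0) i 0 = (Q *m x) i 0 - s * (i == 2%:R)%:R.
    by rewrite !mxE eqxx andbT.
  by rewrite !E/= !mulr0 !subr0 mulr1; ring.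
have cy : continuous y.
  by move=> s; exact: (cvgB (cvg_cst x) (@scalel_continuous _ _ (Q^T *m delta_mx 2%:R 0) s)).
have y0 : y 0 = x by rewrite /y scale0r subr0.
have H : nbhs (0 : R) (fun s => cello T e (y s) /\
    nbhs (y s) (fun z => Om z <-> G z < 0)).
  apply: (cy 0 (fun p => cello T e p /\ nbhs p (fun z => Om z <-> G z < 0))).
  rewrite y0; apply: filterI.
    exact: open_nbhs_nbhs (conj (@open_cello _ _ T e) xe).
  have := nbhs_interior ep; apply: filterS => z; apply: filterS => w.
  by rewrite /G subr_lt0.
move: H => /nbhs_ballP[r /= r0 rH].
have [|ce ne] := rH (r / 2).
  by rewrite /ball/= sub0r normrN gtr0_norm//; lra.
have pos : nbhs (y (r / 2)) (fun z => 0 < G z).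
  apply: (cG (y (r / 2)) [set t | 0 < t]); apply: open_nbhs_nbhs; split.
    exact: open_gt.
  by rewrite /= Gy; lra.
have [z [Omz [OmG Gz]]] :
    (Om `&` [set z | (Om z <-> G z < 0) /\ 0 < G z]) !=set0.
  by apply: (cellcl _ (cello_cell ce)); exact: filterI.
by have := OmG.1 Omz; rewrite ltNge ltW.
Qed.

End Mesh.

(** * Null Lagrangians by central differences *)

Section NullLagrangian.
Context {R : realType}.
Notation mR := (measurableTypeR R).
Notation R3 := (mR * mR * mR)%type.
Notation cV3 := 'cV[R]_3.

Lemma integ_cvg (F_ : nat -> cV3 -> R) (F : cV3 -> R) (N : set cV3) (C : R) :
  (forall n, tame (F_ n)) -> tame F -> null3 N ->
  (forall x, ~ N x -> F_ n x @[n --> \oo] --> F x) ->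
  (forall n x, `|F_ n x| <= C /\ (F_ n x != 0 -> in_box C x)) ->
  integ (F_ n) @[n --> \oo] --> integ F.
Proof.
move=> tF_ tF [mN N0] cF bF; have [mB Bfin] := leb3_in_box C.
have intg : leb3.-integrable setT
    (EFin \o ((fun x : R3 => C) \_ (pt3 @^-1` in_box C))).
  have -> : EFin \o ((fun x : R3 => C) \_ (pt3 @^-1` in_box C)) =
     (EFin \o (fun=> C)) \_ (pt3 @^-1` in_box C).
    by apply/funext => x; rewrite /= !patchE; case: ifP.
  apply: (integrable_mkcond _ mB).1; apply: measurable_bounded_integrable => //.
  exact: bounded_cst.
have mF n := measurable_int _ (tame_integrable (tF_ n)).
have mFl := measurable_int _ (tame_integrable tF).
have ae1 : {ae leb3, forall x : R3, setT x ->
    (F_ n (pt3 x))%:E @[n --> \oo] --> (F (pt3 x))%:E}.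
  exists (pt3 @^-1` N); split => // x /= nc; apply: contrapT => Nx; apply: nc => _.
  by apply: cvg_EFin; [exact: nearW|exact: cF].
have ae2 : {ae leb3, forall (x : R3) n, setT x ->
    (`|(F_ n (pt3 x))%:E| <= (EFin \o ((fun x : R3 => C) \_ (pt3 @^-1` in_box C))) x)%E}.
  apply: aeW => x n _; rewrite /= lee_fin patchE; case: ifPn => xC.
    by have [] := bF n (pt3 x).
  case: (eqVneq (F_ n (pt3 x)) 0) => [->|F0]; first by rewrite normr0.
  by case/negP: xC; apply/mem_set; have [_] := bF n (pt3 x); exact.
have [iF _ cv] := @dominated_convergence _ _ R leb3 setT measurableT _ _ _ mF mFl ae1 intg ae2.
apply: fine_cvg; rewrite fineK; first exact: cv.
exact: integrable_fin_num iF.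
Qed.

Lemma tame_shift f (v : cV3) : tame f -> tame (fun x => f (x + v)).
Proof.
move=> /(tame_affine v (@unitmx1 _ _)).
by under eq_fun do rewrite mul1mx addrC.
Qed.

Lemma integ_shift f (v : cV3) : tame f -> integ (fun x => f (x + v)) = integ f.
Proof.
move=> tf; rewrite (integ_affine v (@unitmx1 _ _) tf) det1 normr1 mul1r.
by congr integ; apply/funext => x; rewrite mul1mx addrC.
Qed.

Definition cdiff (h : R) (k : 'I_3) (a : cV3 -> R) (x : cV3) : R :=
  (2 * h)^-1 * (a (x + h *: delta_mx k 0) - a (x - h *: delta_mx k 0)).

Lemma tame_cdiff h k a : tame a -> tame (cdiff h k a).
Proof. by move=> ta; apply: tameZ; apply: tameB; exact: tame_shift. Qed.

Lemma integ_cdiff h k a : tame a -> integ (cdiff h k a) = 0.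
Proof.
move=> ta; rewrite /cdiff integZ; last by apply: tameB; exact: tame_shift.
by rewrite integB ?integ_shift ?subrr ?mulr0//; exact: tame_shift.
Qed.

(** Central differences satisfy the null Lagrangian identity exactly: expanding
    both products gives the same four values of the correlation of [a] and
    [b]. *)
Lemma integ_cdiff2 h k l a b : tame a -> tame b ->
  integ (fun x => cdiff h k a x * cdiff h l b x - cdiff h l a x * cdiff h k b x) = 0.
Proof.
move=> ta tb; (* the correlation of [a] and [b], through which every product of shifts
   integrates *)
pose C (z : cV3) := integ (fun x => a x * b (x + z)).
have corr (v w : cV3) : integ (fun x => a (x + v) * b (x + w)) = C (w - v).
  rewrite -[LHS](integ_shift (- v)); last by apply: tameM; exact: tame_shift.
  by congr integ; apply/funext => x; rewrite subrK -addrA (addrC _ w).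
have tab (v w : cV3) : tame (fun x => a (x + v) * b (x + w)).
  by apply: tameM; exact: tame_shift.
pose e (j : 'I_3) : cV3 := h *: delta_mx j 0.
have prod i j : integ (fun x => cdiff h i a x * cdiff h j b x) =
    (2 * h)^-1 ^+ 2 * (C (e j - e i) - C (- e j - e i) - C (e j + e i) + C (e i - e j)).
  transitivity (integ (fun x => (2 * h)^-1 ^+ 2 *
     (a (x + e i) * b (x + e j) - a (x + e i) * b (x - e j)
      - a (x - e i) * b (x + e j) + a (x - e i) * b (x - e j)))).
    by congr integ; apply/funext => x; rewrite /cdiff -/(e i) -/(e j); ring.
  have t1 := tab (e i) (e j); have t2 := tab (e i) (- e j).
  have t3 := tab (- e i) (e j); have t4 := tab (- e i) (- e j).
  rewrite integZ; last by apply: tameD => //; apply: tameB => //; exact: tameB.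
  rewrite integD//; last by apply: tameB => //; exact: tameB.
  rewrite integB//; last exact: tameB.
  by rewrite integB// !corr !opprK (addrC (- e j) (e i)).
rewrite integB ?prod; [|by apply: tameM; exact: tame_cdiff..].
rewrite (addrC (- e k) (- e l)) (addrC (e k) (e l)).
move: (C (e l - e k)) (C (- e l - e k)) (C (e l + e k)) (C (e k - e l)).
by move: (_ ^+ 2) => c c1 c2 c3 c4; ring.
Qed.

(** Only increments along the axes enter the central differences. *)
Definition axis_lipschitz (L : R) (a : cV3 -> R) : Prop :=
  forall x k t, `|a (x + t *: delta_mx k 0) - a x| <= L * `|t|.

Lemma cdiff_bounded L a : tame a -> axis_lipschitz L a ->
  exists C, forall h k x, 0 < h <= 1 ->
    `|cdiff h k a x| <= C /\ (cdiff h k a x != 0 -> in_box C x).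
Proof.
move=> [_ [B aB]] lipa; exists (`|L| + (`|B| + 1)) => h k x /andP[h0 h1]; split.
  rewrite /cdiff normrM gtr0_norm ?invr_gt0 ?mulr_gt0//.
  have -> : x + h *: delta_mx k 0 =
      (x - h *: delta_mx k 0) + (2 * h) *: delta_mx k 0 :> cV3.
    by rewrite mulrDl mul1r scalerDl addrA subrK.
  have h20 : 0 < 2 * h by rewrite mulr_gt0.
  rewrite mulrC ler_pdivrMr//; apply: le_trans (lipa _ _ _) _.
  rewrite (gtr0_norm h20) ler_pM2r//.
  by rewrite (le_trans (ler_norm _))// lerDl.
have box (s : R) : `|s| <= 1 -> a (x + s *: delta_mx k 0) != 0 ->
    in_box (`|L| + (`|B| + 1)) x.
  move=> s1 /(aB _).2 xB i; have := xB i; rewrite !mxE eqxx andbT => xi.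
  have : `|s * (i == k)%:R| <= 1 by case: (i == k); rewrite ?mulr1// mulr0 normr0.
  have := ler_norm B; have := normr_ge0 L.
  by rewrite !ler_norml in xi * => *; lra.
case: (eqVneq (a (x + h *: delta_mx k 0)) 0) => [ap|ap _].
  case: (eqVneq (a (x + (- h) *: delta_mx k 0)) 0) => [am|am _].
    by rewrite /cdiff -scaleNr ap am subrr mulr0 eqxx.
  by apply: box am; rewrite normrN gtr0_norm.
by apply: box ap; rewrite gtr0_norm.
Qed.

(** The null Lagrangian identities for Lipschitz functions that are only
    almost everywhere differentiable, as limits of those for central
    differences. *)
Lemma null_lagrangian (a b : cV3 -> R) (ga gb : 'I_3 -> cV3 -> R) N L :
  tame a -> tame b -> (forall k, tame (ga k)) -> (forall k, tame (gb k)) ->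
  null3 N -> axis_lipschitz L a -> axis_lipschitz L b ->
  (forall x, ~ N x -> forall k, cdiff n.+1%:R^-1 k a x @[n --> \oo] --> ga k x) ->
  (forall x, ~ N x -> forall k, cdiff n.+1%:R^-1 k b x @[n --> \oo] --> gb k x) ->
  (forall k, integ (ga k) = 0) /\
  (forall k l, integ (fun x => ga k x * gb l x - ga l x * gb k x) = 0).
Proof.
move=> ta tb tga tgb nN lipa lipb ca cb.
have [A aA] := cdiff_bounded ta lipa; have [B bB] := cdiff_bounded tb lipb.
have h01 n : 0 < (n.+1%:R : R)^-1 <= 1.
  by rewrite invr_gt0 ltr0n/= invf_le1 ?ler1n// ltr0n.
split=> [k|k l].
  have H : integ (cdiff n.+1%:R^-1 k a) @[n --> \oo] --> integ (ga k).
    apply: (@integ_cvg (fun n => cdiff n.+1%:R^-1 k a) (ga k) N A) => //.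
    - by move=> n; exact: tame_cdiff.
    - by move=> x Nx; exact: ca.
    - by move=> n x; exact: aA (h01 n).
  rewrite -(cvg_lim _ H)//; apply: cvg_lim => //.
  have E n : integ (cdiff n.+1%:R^-1 k a) = 0 by exact: integ_cdiff.
  by rewrite (eq_cvg _ _ E); exact: cvg_cst.
have A0 : 0 <= A by have [h _] := aA _ k 0 (h01 0%N); rewrite (le_trans _ h).
have B0 : 0 <= B by have [h _] := bB _ k 0 (h01 0%N); rewrite (le_trans _ h).
pose F n x := cdiff n.+1%:R^-1 k a x * cdiff n.+1%:R^-1 l b x
  - cdiff n.+1%:R^-1 l a x * cdiff n.+1%:R^-1 k b x.
have tF n : tame (F n) by apply: tameB; apply: tameM; exact: tame_cdiff.
have tG : tame (fun x => ga k x * gb l x - ga l x * gb k x).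
  by apply: tameB; exact: tameM.
suff H : integ (F n) @[n --> \oo] --> integ (fun x => ga k x * gb l x - ga l x * gb k x).
  rewrite -(cvg_lim _ H)//; apply: cvg_lim => //.
  have E n : integ (F n) = 0 by exact: integ_cdiff2.
  by rewrite (eq_cvg _ _ E); exact: cvg_cst.
apply: (@integ_cvg F _ N (A * B + A * B + A)) => //.
- move=> x Nx.
  exact: (cvgB (cvgM (ca _ Nx k) (cb _ Nx l)) (cvgM (ca _ Nx l) (cb _ Nx k))).
- move=> n x; have [a1 a2] := aA _ k x (h01 n); have [a3 a4] := aA _ l x (h01 n).
  have [b1 b2] := bB _ k x (h01 n); have [b3 b4] := bB _ l x (h01 n).
  split.
    rewrite (le_trans (ler_normB _ _))// -[leLHS]addr0 lerD//.
    by apply: lerD; rewrite [leLHS]normrM; apply: ler_pM.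
  have AB : A <= A * B + A * B + A by rewrite lerDr addr_ge0// mulr_ge0.
  rewrite /F; case: (eqVneq (cdiff n.+1%:R^-1 k a x) 0) => [->|/a2/(in_boxW AB)//].
  case: (eqVneq (cdiff n.+1%:R^-1 l a x) 0) => [->|/a4/(in_boxW AB)//].
  by rewrite !mul0r subrr eqxx.
Qed.

Lemma cdiff_cvg a k (x : cV3) : derivable a x (delta_mx k 0) ->
  cdiff n.+1%:R^-1 k a x @[n --> \oo] --> 'D_(delta_mx k 0) a x.
Proof.
move=> da; set v := delta_mx k 0 in da *.
pose q (h : R) := h^-1 *: ((a \o shift x) (h *: v) - a x).
have qc : q h @[h --> 0^'] --> 'D_v a x by exact: da.
have hs (s : R) : s != 0 -> q (s * n.+1%:R^-1) @[n --> \oo] --> 'D_v a x.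
  move=> s0; apply: ((cvgr_dnbhsP _ _ _).1 qc); split.
    by move=> n; rewrite mulf_neq0// invr_eq0 pnatr_eq0.
  rewrite -[X in _ --> X](mulr0 s).
  exact: (cvgM (cvg_cst s) (@cvg_harmonic R)).
have c1 := hs 1 (oner_neq0 R).
have c2 : q (-1 * n.+1%:R^-1) @[n --> \oo] --> 'D_v a x by apply: hs; rewrite oppr_eq0 oner_neq0.
have c := cvgM (cvg_cst (2 : R)^-1) (cvgD c1 c2).
have E : (2 : R)^-1 * ('D_v a x + 'D_v a x) = 'D_v a x by field.
have En n : (2 : R)^-1 * (q (1 * n.+1%:R^-1) + q (-1 * n.+1%:R^-1)) =
    cdiff n.+1%:R^-1 k a x.
  have := pnatr_eq0 R n.+1; move: (n.+1%:R) => t /negbT t0.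
  rewrite /cdiff /q /= mul1r mulN1r /shift /= -/v scaleNr.
  rewrite !(addrC _ x) invrN /GRing.scale/=.
  by field.
by rewrite -(eq_cvg _ _ En); rewrite E in c; exact: c.
Qed.

End NullLagrangian.

(** * Lipschitz bounds for piecewise polynomials *)

Section LipschitzGluing.
Context {R : realType}.
Notation cV3 := 'cV[R]_3.

(** A continuous function that is Lipschitz on each member of a finite closed
    cover of a segment is Lipschitz along it: the largest initial segment
    with the bound cannot stop, since some member of the cover accumulates at
    its endpoint from the right. *)
Lemma lipschitz_glue (I : finType) (C : I -> set R) (g : R -> R) (t L : R) :
  0 <= t -> 0 <= L -> continuous g -> (forall i, closed (C i)) ->
  (forall s, exists i, C i s) ->
  (forall i s s', C i s -> C i s' -> `|g s - g s'| <= L * `|s - s'|) ->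
  `|g t - g 0| <= L * t.
Proof.
move=> t0 L0 cg cC cov lip.
pose S := [set s | 0 <= s <= t /\ `|g s - g 0| <= L * s].
have S0 : S 0 by rewrite /S/= lexx t0 subrr normr0 mulr0.
have Sb : has_sup S by split; [exists 0|exists t => s [/andP[]]].
have Sub s : S s -> s <= sup S by move=> Ss; exact: ub_le_sup Sb.2 _ Ss.
have s0 : 0 <= sup S by exact: Sub.
have st : sup S <= t by apply: ge_sup => [|s [/andP[]//]]; exists 0.
have Ssup : S (sup S).
  split; first by rewrite s0 st.
  apply/ler_addgt0Pr => e e0.
  have [r /= r0 rg] : exists2 r, 0 < r & forall y, `|sup S - y| < r -> `|g (sup S) - g y| < e.
    have /cvgrPdist_lt/(_ e e0)/nbhs_ballP[r r0 rg] := cg (sup S).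
    by exists r => // y sy; apply: rg.
  have [s Ss sr] := sup_adherent r0 Sb.
  have sle := Sub _ Ss; have [_ gs] := Ss.
  have h : `|g (sup S) - g s| < e by apply: rg; rewrite ger0_norm ?subr_ge0//; lra.
  have -> : g (sup S) - g 0 = (g (sup S) - g s) + (g s - g 0) by rewrite addrA subrK.
  rewrite (le_trans (ler_normD _ _))// addrC lerD//; last exact: ltW.
  by rewrite (le_trans gs)// ler_wpM2l.
move: st; rewrite le_eqVlt => /predU1P[<-|st]; first by have [] := Ssup.
have [i Ci] : exists i, ~ \forall s \near (sup S)^'+, ~ C i s.
  apply/existsNP => H; have /filter_forall H' := H.
  have [s sC] := filter_ex H'; have [i Cis] := cov s; exact: (sC i).
have Cs : C i (sup S).
  apply: cC => B nB; apply: contrapT => nCB; apply: Ci.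
  have := cvg_at_right_filter (f := id) (cvg_id : id @ (sup S) --> sup S) nB.
  by apply: filterS => s Bs Cis; apply: nCB; exists s.
apply: contrapT => _; apply: Ci; near=> s => Cis.
have ss : sup S < s by near: s; exact: nbhs_right_gt.
have s_t : s < t by near: s; exact: nbhs_right_lt.
suff /Sub : S s by rewrite leNgt ss.
split; first by rewrite (le_trans s0 (ltW ss)) ltW.
have -> : g s - g 0 = (g s - g (sup S)) + (g (sup S) - g 0) by rewrite addrA subrK.
rewrite (le_trans (ler_normD _ _))//.
have := lip _ _ _ Cis Cs; rewrite (gtr0_norm (_ : 0 < s - sup S)) ?subr_gt0//.
by have [_] := Ssup; lra.
Unshelve. all: by end_near. Qed.

(** Mean value theorem along the segment, which stays in the convex cube. *)
Lemma tensor_poly_lipschitz N (F : cV3 -> R) : tensor_poly N F ->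
  exists2 K, 0 <= K & forall x y, cube x -> cube y ->
    `|F x - F y| <= K * \sum_i `|x i 0 - y i 0|.
Proof.
move=> tF; have [dF tdF FdF] := tensor_poly_diff tF.
have bnd j : exists C, forall x, in_box 1 x -> `|dF j x| <= C.
  exact: tensor_poly_bounded (tdF j).
have [C CP] := choice bnd.
exists (\sum_j `|C j|) => [|x y]; first exact: sumr_ge0.
rewrite cubeE => xc yc.
pose z (s : R) := y + s *: (x - y).
have zc s : s \in `]0, 1[ -> in_box 1 (z s).
  rewrite in_itv/= => /andP[s0 s1] i; rewrite !mxE; have := xc i; have := yc i.
  by rewrite !ler_norml => /andP[? ?] /andP[? ?]; nra.
pose g := F \o z.
have dg (s : R) : is_derive s 1 g (\sum_j (x - y) j 0 * dF j (z s)).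
  have dz : is_diff s z (fun h => h *: (x - y)).
    have -> : z = cst y + ( *:%R ^~ (x - y)) by [].
    apply: (is_diff_eq (is_diffD (is_diff_cst y s) (is_diff_scalel s (x - y)))).
    by apply/funext => h; rewrite !fctE add0r.
  have d := is_diff_comp dz (FdF (z s)).
  have dif : differentiable g s by have [] := d.
  apply: DeriveDef; first exact/derivable1_diffP.
  rewrite deriveE//; have [_ ->] := d.
  by rewrite /= scale1r.
have [|c c01 E] := @MVT _ g (fun s => \sum_j (x - y) j 0 * dF j (z s)) 0 1 ltr01.
  apply: continuous_subspaceT => s; apply: differentiable_continuous.
  by apply/derivable1_diffP; have [] := dg s.
have -> : F x - F y = g 1 - g 0.
  by rewrite /g /= /z scale1r scale0r addr0 [y + _]addrC subrK.
rewrite E subr0 mulr1 (le_trans (ler_norm_sum _ _ _))// mulr_suml.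
apply: ler_sum => j _; rewrite normrM mulrC.
apply: ler_pM => //.
- by rewrite (le_trans (CP _ _ (zc c c01)))// ler_norm.
- by rewrite (bigD1 j)//= !mxE lerDl sumr_ge0.
Qed.

End LipschitzGluing.

(** * Polynomial representatives of discrete fields *)

Section Null3Union.
Context {R : realType}.
Notation cV3 := 'cV[R]_3.

Lemma null3_finite_union (I : finType) (N : I -> set cV3) :
  (forall i, null3 (N i)) -> null3 [set x | exists i, N i x].
Proof.
move=> nN.
have E : pt3 @^-1` [set x | exists i, N i x] =
    \big[setU/set0]_(i <- index_enum I) (pt3 @^-1` N i).
  rewrite -bigcup_seq; apply/seteqP; split => x.
    by move=> [i Nix]; exists i => //=; exact: mem_index_enum.
  by move=> [i _ Nix]; exists i.
rewrite /null3 E; elim/big_rec: _ => [|i S _ [mS S0]]; first by rewrite measure0.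
have [mN N0] := nN i; split; first exact: measurableU.
by rewrite measureU0// setUC.
Qed.

End Null3Union.

Section DetExpansion.
Context {R : comUnitRingType}.

Definition minors1 (M : 'M[R]_3) : R := M 0 0 + M 1 1 + M 2%:R 2%:R.

Definition minors2 (M : 'M[R]_3) : R :=
  (M 0 0 * M 1 1 - M 0 1 * M 1 0) + (M 0 0 * M 2%:R 2%:R - M 0 2%:R * M 2%:R 0)
  + (M 1 1 * M 2%:R 2%:R - M 1 2%:R * M 2%:R 1).

Lemma det_add_expansion (A J : 'M[R]_3) : A \in unitmx ->
  \det (A + J) - \det A = \det A *
   (minors1 (J *m invmx A) + minors2 (J *m invmx A) + \det (J *m invmx A)).
Proof.
move=> uA; set M := J *m invmx A.
have -> : A + J = (1%:M + M) *m A by rewrite mulmxDl mul1mx /M mulmxKV.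
rewrite det_mulmx (_ : \det (1%:M + M) = 1 + minors1 M + minors2 M + \det M).
  by ring.
by rewrite !det3E /minors1 /minors2 !mxE/=; ring.
Qed.

End DetExpansion.

Section Pieces.
Context {R : realType} {m : nat}.
Notation mR := (measurableTypeR R).
Notation R3 := (mR * mR * mR)%type.
Notation cV3 := 'cV[R]_3.
Variables (T : hexes R m) (p : nat).
Implicit Types (u : cV3 -> cV3) (P : 'I_m -> 'I_3 -> cV3 -> R)
  (J : 'I_m -> cV3 -> 'M[R]_3).

(** A polynomial representative of a discrete field on each reference cube,
    with its Jacobian matrix: the representatives are defined and smooth on
    the whole space, the field only up to the boundary of the cells. *)
Definition pieces u P J : Prop :=
  [/\ forall e i, tensor_poly p.+1 (P e i),
      forall e i j, tensor_poly p.+1 (fun xi => J e xi i j),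
      forall e i xi, is_diff xi (P e i) (fun v => \sum_j v j 0 * J e xi i j) &
      forall e i xi, cube xi -> u (cellX T e xi) i 0 = P e i xi].

Lemma Uh_pieces (Om : set cV3) u : Uh Om T p u -> exists P J, pieces u P J.
Proof.
move=> [_ _ uQ].
have H (ei : 'I_m * 'I_3) : exists F, tensor_poly p.+1 F /\
    forall xi, cube xi -> u (cellX T ei.1 xi) ei.2 0 = F xi.
  by have [F tF uF] := Qp_tensor_poly (uQ ei.1 ei.2); exists F.
have [P PP] := choice H.
have H' ei : exists dF : 'I_3 -> cV3 -> R, (forall j, tensor_poly p.+1 (dF j)) /\
    forall xi, is_diff xi (P ei) (fun v => \sum_j v j 0 * dF j xi).
  by have [dF h1 h2] := tensor_poly_diff (PP ei).1; exists dF.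
have [dP dPP] := choice H'.
exists (fun e i => P (e, i)), (fun e xi => \matrix_(i, j) dP (e, i) j xi).
split.
- by move=> e i; have [] := PP (e, i).
- move=> e i j; apply: tensor_poly_ext ((dPP (e, i)).1 j) => xi.
  by rewrite mxE.
- move=> e i xi; apply: is_diff_eq ((dPP (e, i)).2 xi) _.
  by apply/funext => v; apply: eq_bigr => j _; rewrite mxE.
- by move=> e i xi; have [_] := PP (e, i); exact.
Qed.

(** The gradient in physical coordinates, by the chain rule. *)
Definition cgrad J (e : 'I_m) (xi : cV3) : 'M[R]_3 := J e xi *m invmx (hexA T e).

Lemma is_diff_affine (M : 'M[R]_3) (b x : cV3) :
  is_diff x (fun y : cV3 => b + M *m y) (fun v : cV3 => M *m v).
Proof.
have cM : continuous (fun y : cV3 => M *m y).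
  have -> : (fun y : cV3 => M *m y) = (fun y => 0 + M *m y).
    by apply/funext => y; rewrite add0r.
  exact: continuous_affine3.
have -> : (fun y : cV3 => b + M *m y) = cst b + (mulmx M : cV3 -> cV3) by [].
have d : is_diff x (mulmx M : cV3 -> cV3) (mulmx M).
  apply: DiffDef; first exact: (@linear_differentiable _ _ _ (mulmx M) x cM).
  exact: (@diff_lin _ _ _ (mulmx M) x cM).
apply: (is_diff_eq (is_diffD (is_diff_cst b x) d)).
by apply/funext => v; rewrite !fctE add0r.
Qed.

Lemma derive_of_is_diff (V W : normedModType R) (f df : V -> W) (x v : V) :
  is_diff x f df -> derivable f x v /\ 'D_v f x = df v.
Proof.
move=> d; have [dif E] := d; split; first exact: diff_derivable.
by rewrite deriveE// E.
Qed.

Lemma derive_near_is_diff (V W : normedModType R) (f g df : V -> W) (x v : V) :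
  (\near x, f x = g x) -> is_diff x g df -> derivable f x v /\ 'D_v f x = df v.
Proof.
move=> fg dg; have [d E] := derive_of_is_diff v dg; split.
  by apply: near_eq_derivable d; apply: filterS fg => y.
by rewrite (near_eq_derive _ fg).
Qed.

Section Fixed.
Variables (u : cV3 -> cV3) (P : 'I_m -> 'I_3 -> cV3 -> R)
  (J : 'I_m -> cV3 -> 'M[R]_3).
Hypothesis uPJ : pieces u P J.

Lemma pieces_derive e x i k : cello T e x ->
  derivable (fun y => u y i 0) x (delta_mx k 0) /\
  'D_(delta_mx k 0) (fun y => u y i 0) x = cgrad J e (cellXinv T e x) i k.
Proof.
move=> xe; have [_ _ dP uP] := uPJ.
pose g := P e i \o (fun y => - (invmx (hexA T e) *m hexb T e) + invmx (hexA T e) *m y).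
have ug : \near x, u x i 0 = g x.
  have : nbhs x (cello T e) by apply: open_nbhs_nbhs; split => //; exact: open_cello.
  apply: filterS => y ye; rewrite /g /= -cellXinvE -uP ?cellXinvK//.
  exact: cubeo_cube.
have dg := is_diff_comp (is_diff_affine (invmx (hexA T e)) (- (invmx (hexA T e) *m hexb T e)) x)
  (dP e i _).
have [d ->] := derive_near_is_diff (delta_mx k 0) ug dg; split => //=.
rewrite /cgrad mxE -cellXinvE; apply: eq_bigr => j _; rewrite mulrC; congr (_ * _).
rewrite mxE (bigD1 k)//= mxE !eqxx mulr1 big1 ?addr0// => l lk.
by rewrite mxE (negbTE lk) mulr0.
Qed.

Lemma pieces_Dmx e x : cello T e x -> Dmx u x = cgrad J e (cellXinv T e x).
Proof.
move=> xe; apply/matrixP => i k; rewrite mxE.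
by have [_ ->] := pieces_derive i k xe.
Qed.

Lemma pieces_Dmx_ref e xi : cubeo xi ->
  Dmx (fun eta => cellX T e eta + u (cellX T e eta)) xi = hexA T e + J e xi.
Proof.
move=> xc; have [_ _ dP uP] := uPJ; apply/matrixP => i k; rewrite !mxE.
pose f := (fun y : cV3 => (hexb T e + hexA T e *m y) i 0).
have df : is_diff xi f (fun v => (hexA T e *m v) i 0).
  have d := is_diff_comp (is_diff_affine (hexA T e) (hexb T e) xi) (is_diff_coord3 _ i).
  exact: d.
have near_e : \near xi, (cellX T e xi + u (cellX T e xi)) i 0 = (f + P e i) xi.
  have : nbhs xi cubeo by apply: open_nbhs_nbhs; split => //; exact: open_cubeo.
  by apply: filterS => y /cubeo_cube yc; rewrite mxE uP.
have [_ ->] := derive_near_is_diff (delta_mx k 0) near_e (is_diffD df (dP e i xi)).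
rewrite !fctE mxE; congr (_ + _).
  by rewrite (bigD1 k)//= mxE !eqxx mulr1 big1 ?addr0// => j jk; rewrite mxE (negbTE jk) mulr0.
by rewrite (bigD1 k)//= mxE !eqxx mul1r big1 ?addr0// => j jk; rewrite mxE (negbTE jk) mul0r.
Qed.

Lemma tensor_poly_cgrad e i k : tensor_poly p.+1 (fun xi => cgrad J e xi i k).
Proof.
have [_ tJ _ _] := uPJ.
apply: (@tensor_poly_ext _ _ _ (fun xi => \sum_j invmx (hexA T e) j k * J e xi i j)).
  by move=> xi; rewrite /cgrad mxE; apply: eq_bigr => j _; rewrite mulrC.
by apply: tensor_poly_sum => j _; exact: tensor_polyZ.
Qed.

(** By multiplicativity of the determinant, the defect is [\det A] times the
    expansion of [\det (1 + G) - 1], with [G] the physical gradient. *)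
Lemma vol_defectE e xi : cubeo xi -> vol_defect T e u xi =
  \det (hexA T e) * (minors1 (cgrad J e xi) + minors2 (cgrad J e xi)
    + \det (cgrad J e xi)).
Proof.
by move=> xc; rewrite /vol_defect pieces_Dmx_ref// det_add_expansion// hexA_unit.
Qed.

Lemma tensor_poly_minors e : tensor_poly (p.+1 + p.+1).-1
  (fun xi => minors1 (cgrad J e xi) + minors2 (cgrad J e xi)).
Proof.
have t2 i k j l := tensor_polyM (tensor_poly_cgrad e i k) (tensor_poly_cgrad e j l).
have t1 i k : tensor_poly (p.+1 + p.+1).-1 (fun xi => cgrad J e xi i k).
  by apply: tensor_polyW (tensor_poly_cgrad e i k); lia.
apply: tensor_polyD; first by do 2! (apply: tensor_polyD => //).
by apply: tensor_polyD; first apply: tensor_polyD; apply: tensor_polyB.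
Qed.

End Fixed.

End Pieces.

(** * The sum of the residuals is a cubic form *)

Section Gauss3Linear.
Context {R : realType}.
Notation cV3 := 'cV[R]_3.
Implicit Types F G : cV3 -> R.

(** The Gauss nodes are interior, so the values on the boundary of the cube,
    where a piecewise field is not differentiable, are never sampled. *)
Lemma gauss3_eq n F G : (forall xi, cubeo xi -> F xi = G xi) ->
  gauss3 n F = gauss3 n G.
Proof.
move=> FG; rewrite /gauss3 [LHS]big_seq [RHS]big_seq; apply: eq_bigr => x xn.
rewrite [LHS]big_seq [RHS]big_seq; apply: eq_bigr => y yn.
rewrite [LHS]big_seq [RHS]big_seq; apply: eq_bigr => z zn.
rewrite FG//; apply: ord3P; rewrite ?vec3E0 ?vec3E1 ?vec3E2 ltr_norml.
- exact: gl_nodes_itv xn.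
- exact: gl_nodes_itv yn.
- exact: gl_nodes_itv zn.
Qed.

Lemma gauss3D n F G : gauss3 n (fun xi => F xi + G xi) = gauss3 n F + gauss3 n G.
Proof.
rewrite /gauss3 -big_split; apply: eq_bigr => x _; rewrite -big_split.
apply: eq_bigr => y _; rewrite -big_split; apply: eq_bigr => z _.
by rewrite mulrDr.
Qed.

Lemma gauss3Z n a F : gauss3 n (fun xi => a * F xi) = a * gauss3 n F.
Proof.
rewrite /gauss3 mulr_sumr; apply: eq_bigr => x _; rewrite mulr_sumr.
apply: eq_bigr => y _; rewrite mulr_sumr; apply: eq_bigr => z _.
by rewrite mulrCA.
Qed.

End Gauss3Linear.

Section PiecewiseIntegral.
Context {R : realType} {m : nat}.
Notation mR := (measurableTypeR R).
Notation R3 := (mR * mR * mR)%type.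
Notation cV3 := 'cV[R]_3.
Variables (T : hexes R m).
Implicit Types (e f : 'I_m) (F G : cV3 -> R).

(** The values on the boundary of the cell are set to zero, so that the
    functions attached to different cells have disjoint supports. *)
Definition on_cell e F : cV3 -> R := fun x => F (cellXinv T e x) * \1_(cello T e) x.

Lemma on_cellE e F x : cello T e x -> on_cell e F x = F (cellXinv T e x).
Proof. by move=> xe; rewrite /on_cell indicE mem_set// mulr1. Qed.

Lemma on_cell0 e F x : ~ cello T e x -> on_cell e F x = 0.
Proof. by move=> xe; rewrite /on_cell indicE memNset// mulr0. Qed.

Lemma on_cell_comp e F : on_cell e F = fun x =>
  (fun xi => F xi * \1_cubeo xi)
    (- (invmx (hexA T e) *m hexb T e) + invmx (hexA T e) *m x).
Proof.
by apply/funext => x; rewrite -cellXinvE.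
Qed.

Lemma tame_cubeo N F : tensor_poly N F -> tame (fun xi => F xi * \1_cubeo xi).
Proof.
move=> tF; apply: (@tame_tensor_poly _ N _ _ 1) => //.
  exact: measurable_open3 (@open_cubeo R).
by move=> x xc i; exact: ltW.
Qed.

Lemma tame_on_cell N e F : tensor_poly N F -> tame (on_cell e F).
Proof.
move=> tF; rewrite on_cell_comp; apply: (tame_affine _ _ (tame_cubeo tF)).
by rewrite unitmx_inv hexA_unit.
Qed.

Lemma integ_on_cell N e F : tensor_poly N F ->
  integ (on_cell e F) = \det (hexA T e) * int3 cube F.
Proof.
move=> tF.
rewrite (integ_affine (hexb T e) (hexA_unit T e) (tame_on_cell e tF)).
rewrite gtr0_norm ?hexA_det//.
have -> : integ (fun x => on_cell e F (hexb T e + hexA T e *m x)) = int3 cubeo F.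
  rewrite int3E; congr integ; apply/funext => xi.
  by rewrite on_cell_comp -[_ + hexA T e *m xi]/(cellX T e xi) -cellXinvE cellXK.
congr (_ * _); apply: (int3_off_null (@null3_cube_boundary R)) => // xi /= Nx.
split => [|xc]; first exact: cubeo_cube.
by apply: contrapT => xo; exact: Nx.
Qed.

Variables (Om : set cV3).
Hypotheses (HOm : bounded_lipschitz_domain Om) (Hmesh : conforming_mesh Om T).

Lemma sum_on_cellE (F : 'I_m -> cV3 -> R) e x : cello T e x ->
  \sum_f on_cell f (F f) x = F e (cellXinv T e x).
Proof.
move=> xe; rewrite (bigD1 e)//= on_cellE// big1 ?addr0// => f fe.
apply: on_cell0 => xf; have := cello_cell_disjoint Hmesh fe.
by move=> /seteqP[/(_ x) + _]; apply; split => //; exact: cello_cell.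
Qed.

Lemma sum_on_cell0 (F : 'I_m -> cV3 -> R) x : (forall e, ~ cello T e x) ->
  \sum_f on_cell f (F f) x = 0.
Proof. by move=> nx; rewrite big1// => f _; exact: on_cell0. Qed.

Definition skeleton : set cV3 := [set x | exists e, (cell T e `\` cello T e) x].

Lemma null3_skeleton : null3 skeleton.
Proof. by apply: null3_finite_union => e; exact: null3_cell_boundary. Qed.

Lemma off_skeleton x : ~ skeleton x -> (exists e, cello T e x) \/ ~ closure Om x.
Proof.
move=> nx; have [clo _ _] := Hmesh.
case: (pselect (closure Om x)) => [cx|]; last by right.
left; move: (cx); rewrite clo => -[e _ xe]; exists e.
by apply: contrapT => ne; apply: nx; exists e.
Qed.

Lemma integ_sum_on_cell N (F : 'I_m -> cV3 -> R) : (forall e, tensor_poly N (F e)) ->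
  integ (fun x => \sum_f on_cell f (F f) x) =
  \sum_e \det (hexA T e) * int3 cube (F e).
Proof.
move=> tF; rewrite integ_sum; last by move=> e; exact: tame_on_cell (tF e).
by apply: eq_bigr => e _; exact: integ_on_cell (tF e).
Qed.

Lemma tame_sum_on_cell N (F : 'I_m -> cV3 -> R) : (forall e, tensor_poly N (F e)) ->
  tame (fun x => \sum_f on_cell f (F f) x).
Proof. by move=> tF; apply: tame_sum => e; exact: tame_on_cell (tF e). Qed.

End PiecewiseIntegral.

Section SumOfDefects.
Context {R : realType} {m : nat}.
Notation cV3 := 'cV[R]_3.
Variables (T : hexes R m) (p : nat) (Om : set cV3).
Hypotheses (HOm : bounded_lipschitz_domain Om) (Hmesh : conforming_mesh Om T).
Variables (u : cV3 -> cV3) (P : 'I_m -> 'I_3 -> cV3 -> R)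
  (J : 'I_m -> cV3 -> 'M[R]_3).
Hypotheses (uU : Uh Om T p u) (uPJ : pieces T p u P J).

Definition gradient (i k : 'I_3) (x : cV3) : R :=
  \sum_e on_cell T e (fun xi => cgrad T J e xi i k) x.

Lemma tame_gradient i k : tame (gradient i k).
Proof. by apply: tame_sum_on_cell => e; exact: (tensor_poly_cgrad uPJ). Qed.

Lemma Uh_bounded i : exists C, forall x, `|u x i 0| <= C /\ (u x i 0 != 0 -> in_box C x).
Proof.
have [tP _ _ uP] := uPJ; have [_ u0 _] := uU.
have bnd e : exists C, forall x, in_box 1 x -> `|P e i x| <= C.
  exact: tensor_poly_bounded (tP e i).
have [C CP] := choice bnd.
have [D DP] := choice (@cell_in_box R m T).
have sumC e : C e <= \sum_e `|C e|.
  by rewrite (le_trans (ler_norm _))// (bigD1 e)//= lerDl sumr_ge0.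
have sumD e : D e <= \sum_e `|D e|.
  by rewrite (le_trans (ler_norm _))// (bigD1 e)//= lerDl sumr_ge0.
have C0 : 0 <= \sum_e `|C e| by exact: sumr_ge0.
have D0 : 0 <= \sum_e `|D e| by exact: sumr_ge0.
exists (\sum_e `|C e| + \sum_e `|D e|) => x.
case: (pselect (Om x)) => [Omx|/u0 ->]; last by rewrite mxE normr0 eqxx addr_ge0.
have [e xe] := Om_cells Hmesh Omx; split; last first.
  move=> _; apply: in_boxW (DP e x xe).
  by rewrite (le_trans (sumD e))// lerDr.
have /cellP xc := xe; rewrite -(cellXinvK T e x) uP//.
rewrite (le_trans (CP e _ _)) -?cubeE//.
by rewrite (le_trans (sumC e))// lerDl.
Qed.

Lemma continuous_Uh_coord i : continuous (fun x => u x i 0).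
Proof.
have [cu _ _] := uU => x.
by apply: (@continuous_comp _ _ _ u (fun y : cV3 => y i 0)); [exact: cu|exact: coord_continuous].
Qed.

Lemma tame_Uh i : tame (fun x => u x i 0).
Proof.
have [C uC] := Uh_bounded i.
have cu := @continuous_Uh_coord i; have := tame_continuous cu uC; exact.
Qed.

Lemma closed_cell e : closed (cell T e).
Proof.
have -> : cell T e = cellXinv T e @^-1` (cube : set cV3).
  by apply/seteqP; split => x /cellP.
apply: closed_comp => [x _|]; first exact: continuous_cellXinv.
have -> : (cube : set cV3) = \bigcap_(i in [set: 'I_3]) [set x : cV3 | `|x i 0| <= 1].
  rewrite cubeE; apply/seteqP; split => x h i; first by move=> _; exact: h.
  exact: (h i I).
apply: closed_bigI => i _.
apply: (@closed_comp _ _ (fun x : cV3 => `|x i 0|) [set t | t <= 1]); last exact: closed_le.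
move=> x _; apply: (@continuous_comp _ _ _ (fun y : cV3 => y i 0) Num.norm).
  exact: coord_continuous.
exact: norm_continuous.
Qed.

(** On an axis-parallel line, the field is Lipschitz on the trace of each
    closed cell and vanishes off the cells; continuity glues these bounds. *)
Lemma Uh_axis_lipschitz i : exists2 L, 0 <= L & axis_lipschitz L (fun x => u x i 0).
Proof.
have [tP _ _ uP] := uPJ; have [_ u0 _] := uU.
have bnd e : exists K, 0 <= K /\ forall x y, cube x -> cube y ->
    `|P e i x - P e i y| <= K * \sum_j `|x j 0 - y j 0|.
  by have [K K0 KP] := tensor_poly_lipschitz (tP e i); exists K.
have [K KP] := choice bnd.
pose M e k := \sum_j `|invmx (hexA T e) j k|.
pose L := \sum_e \sum_k K e * M e k.
have KM0 e k : 0 <= K e * M e k by rewrite mulr_ge0 ?sumr_ge0//; have [] := KP e.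
have KML e k : K e * M e k <= L.
  rewrite /L (bigD1 e)//= (bigD1 k)//= -addrA lerDl addr_ge0 ?sumr_ge0//.
  by move=> f _; apply: sumr_ge0.
have L0 : 0 <= L by apply: sumr_ge0 => e _; exact: sumr_ge0.
exists L => //.
have pos x k t : 0 <= t -> `|u (x + t *: delta_mx k 0) i 0 - u x i 0| <= L * t.
  move=> t0; pose z (s : R) : cV3 := x + s *: delta_mx k 0.
  have cz : continuous z.
    move=> s; exact: (cvgD (cvg_cst x) (@scalel_continuous _ _ (delta_mx k 0) s)).
  have zinv e s s' j : cellXinv T e (z s) j 0 - cellXinv T e (z s') j 0 =
      (s - s') * invmx (hexA T e) j k.
    have -> : cellXinv T e (z s) j 0 - cellXinv T e (z s') j 0 =
        (cellXinv T e (z s) - cellXinv T e (z s')) j 0 by rewrite !mxE.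
    rewrite /cellXinv -mulmxBr opprB addrA subrK /z opprD addrACA subrr add0r.
    rewrite -scalerBl -scalemxAr mxE; congr (_ * _).
    rewrite mxE (bigD1 k)//= mxE !eqxx mulr1 big1 ?addr0// => l lk.
    by rewrite mxE (negbTE lk) mulr0.
  pose g s := u (z s) i 0.
  have cg : continuous g.
    move=> s; apply: (@continuous_comp _ _ _ z (fun y => u y i 0)); first exact: cz.
    exact: continuous_Uh_coord.
  pose C (o : option 'I_m) : set R := if o is Some e then z @^-1` cell T e
    else [set s | g s = 0].
  have -> : u x i 0 = g 0 by rewrite /g /z scale0r addr0.
  apply: (@lipschitz_glue _ _ C g t L) => //.
  - move=> [e|] /=; first by apply: closed_comp (@closed_cell e) => s _; exact: cz.
    apply: (@closed_comp _ _ g [set 0]) => [s _|]; first exact: cg.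
    exact: closed_eq.
  - move=> s; case: (pselect (Om (z s))) => [/(Om_cells Hmesh)[e ?]|/u0 E].
      by exists (Some e).
    by exists None; rewrite /C /g /= E mxE.
  - move=> [e|] s s' /=; last by move=> -> ->; rewrite subrr normr0 mulr_ge0.
    move=> /cellP h /cellP h'; rewrite /g -(cellXinvK T e (z s)).
    rewrite -(cellXinvK T e (z s')) !uP//.
    rewrite (le_trans ((KP e).2 _ _ h h'))//.
    under eq_bigr do rewrite zinv normrM.
    rewrite -mulr_sumr mulrCA (mulrC `|_|) ler_wpM2r//.
    exact: KML.
move=> x k t; case: (leP 0 t) => t0; first by rewrite (ger0_norm t0); exact: pos.
rewrite (ltr0_norm t0) distrC.
rewrite -[in X in `|X - _|](addrK (t *: delta_mx k 0) x) -scaleNr.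
by apply: pos; lra.
Qed.

Lemma gradient_cvg x : ~ skeleton T x -> forall i k,
  cdiff n.+1%:R^-1 k (fun y => u y i 0) x @[n --> \oo] --> gradient i k x.
Proof.
move=> nx i k; case: (off_skeleton Hmesh nx) => [[e xe]|ncx].
  have [d E] := pieces_derive uPJ i k xe.
  by rewrite /gradient (sum_on_cellE Hmesh _ xe) -E; exact: cdiff_cvg.
have near0 : \near x, u x i 0 = (cst 0 : cV3 -> R) x.
  have : nbhs x (~` closure Om).
    by apply: open_nbhs_nbhs; split => //; apply: closed_openC; exact: closed_closure.
  have [_ u0 _] := uU.
  by apply: filterS => y ny; rewrite u0 ?mxE// => /subset_closure.
have [d E] := derive_near_is_diff (delta_mx k 0) near0 (is_diff_cst 0 x).
have clo : closure Om = \bigcup_e cell T e by have [] := Hmesh.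
rewrite /gradient sum_on_cell0.
  have := cdiff_cvg d; rewrite E; exact.
by move=> e xe; apply: ncx; rewrite clo; exists e => //; exact: cello_cell.
Qed.

(** The first two orders of the volume defect have zero total: they are null
    Lagrangians of a field vanishing outside the domain. *)
Lemma sum_minors0 : \sum_e \det (hexA T e) *
  int3 cube (fun xi => minors1 (cgrad T J e xi) + minors2 (cgrad T J e xi)) = 0.
Proof.
rewrite -(integ_sum_on_cell T (tensor_poly_minors uPJ)).
have NL i j : (forall k, integ (gradient i k) = 0) /\
  (forall k l, integ (fun x => gradient i k x * gradient j l x
    - gradient i l x * gradient j k x) = 0).
  have [L L0 Li] := Uh_axis_lipschitz i; have [L' L'0 Lj] := Uh_axis_lipschitz j.
  apply: (@null_lagrangian _ (fun x => u x i 0) (fun x => u x j 0) _ _ (skeleton T) (L + L')).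
  - exact: tame_Uh.
  - exact: tame_Uh.
  - exact: tame_gradient.
  - exact: tame_gradient.
  - exact: null3_skeleton.
  - by move=> x k t; rewrite (le_trans (Li x k t))// ler_wpM2r// lerDl.
  - by move=> x k t; rewrite (le_trans (Lj x k t))// ler_wpM2r// lerDr.
  - by move=> x nx k; exact: gradient_cvg.
  - by move=> x nx k; exact: gradient_cvg.
have tB i j k l : tame (fun x => gradient i k x * gradient j l x
    - gradient i l x * gradient j k x).
  by apply: tameB; apply: tameM; exact: tame_gradient.
transitivity (integ (fun x => (gradient 0 0 x + gradient 1 1 x + gradient 2%:R 2%:R x) +
  ((gradient 0 0 x * gradient 1 1 x - gradient 0 1 x * gradient 1 0 x)
  + (gradient 0 0 x * gradient 2%:R 2%:R x - gradient 0 2%:R x * gradient 2%:R 0 x)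
  + (gradient 1 1 x * gradient 2%:R 2%:R x - gradient 1 2%:R x * gradient 2%:R 1 x)))).
  congr integ; apply/funext => x.
  case: (pselect (exists e, cello T e x)) => [[e xe]|nx].
    by rewrite /gradient !(sum_on_cellE Hmesh _ xe).
  have nx' e : ~ cello T e x by move=> xe; apply: nx; exists e.
  by rewrite /gradient !sum_on_cell0//; ring.
have tg := tame_gradient.
have t2 := tameD (tameD (tB 0 1 0 1) (tB 0 2%:R 0 2%:R)) (tB 1 2%:R 1 2%:R).
rewrite (integD (tameD (tameD (tg 0 0) (tg 1 1)) (tg 2%:R 2%:R)) t2).
rewrite (integD (tameD (tg 0 0) (tg 1 1)) (tg 2%:R 2%:R)).
rewrite (integD (tg 0 0) (tg 1 1)).
rewrite (integD (tameD (tB 0 1 0 1) (tB 0 2%:R 0 2%:R)) (tB 1 2%:R 1 2%:R)).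
rewrite (integD (tB 0 1 0 1) (tB 0 2%:R 0 2%:R)).
rewrite (NL 0 0).1 (NL 1 1).1 (NL 2%:R 2%:R).1 (NL 0 1).2 (NL 0 2%:R).2.
by rewrite (NL 1 2%:R).2 !addr0.
Qed.

(** The terms of first and second order have degree at most [2 * p] in each
    coordinate, so that the rule integrates them exactly; only the
    determinant of the gradient may be misintegrated. *)
Lemma qQ_expansion (ne : 'I_m -> nat) e : (p + 1 <= ne e)%N ->
  qQ T ne u e = \det (hexA T e) *
     int3 cube (fun xi => minors1 (cgrad T J e xi) + minors2 (cgrad T J e xi))
   + \det (hexA T e) * gauss3 (ne e) (fun xi => \det (cgrad T J e xi)).
Proof.
move=> pne; rewrite /qQ (gauss3_eq _ (vol_defectE uPJ e)) gauss3Z gauss3D mulrDr.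
congr (_ * _ + _); apply: gauss3_exact.
by apply: tensor_polyW (tensor_poly_minors uPJ e); lia.
Qed.

Lemma sum_qQ (ne : 'I_m -> nat) : (forall e, (p + 1 <= ne e)%N) ->
  \sum_e qQ T ne u e =
  \sum_e \det (hexA T e) * gauss3 (ne e) (fun xi => \det (cgrad T J e xi)).
Proof.
move=> Hne; rewrite (eq_bigr _ (fun e _ => qQ_expansion (Hne e))) big_split/=.
by rewrite sum_minors0 add0r.
Qed.

End SumOfDefects.

(** * The misintegrated direction *)

Lemma continuous_ballP {R : realType} (T : topologicalType)
    (V : pseudoMetricType R) (f : T -> V) : continuous f <->
  forall x e, 0 < e -> nbhs x (fun y => ball (f x) e (f y)).
Proof.
split => [cf x e e0|cf x]; first by have /cvg_ballP := cf x; exact.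
by apply/cvg_ballP => e e0; exact: cf.
Qed.

Section LinearStructure.
Context {R : realType} {m : nat}.
Notation cV3 := 'cV[R]_3.
Variables (T : hexes R m) (p : nat) (Om : set cV3).

Lemma Qp_ext (F G : cV3 -> R) : (forall xi, cube xi -> F xi = G xi) -> Qp p G -> Qp p F.
Proof. by move=> FG [c Gc]; exists c => xi xc; rewrite FG// Gc. Qed.

Lemma pieces_lin a b u P J w P' J' : pieces T p u P J -> pieces T p w P' J' ->
  pieces T p (fun x => a *: u x + b *: w x)
    (fun e i xi => a * P e i xi + b * P' e i xi)
    (fun e xi => a *: J e xi + b *: J' e xi).
Proof.
move=> [tP tJ dP uP] [tP' tJ' dP' wP']; split.
- by move=> e i; apply: tensor_polyD; exact: tensor_polyZ.
- move=> e i j; apply: (@tensor_poly_ext _ _ _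
    (fun xi => a * J e xi i j + b * J' e xi i j)); first by move=> xi; rewrite !mxE.
  by apply: tensor_polyD; exact: tensor_polyZ.
- move=> e i xi.
  have -> : (fun xi => a * P e i xi + b * P' e i xi) = a *: P e i + b *: P' e i by [].
  apply: (is_diff_eq (is_diffD (is_diffZ a (dP e i xi)) (is_diffZ b (dP' e i xi)))).
  apply/funext => v; rewrite !fctE /GRing.scale/= !mulr_sumr -big_split/=.
  by apply: eq_bigr => j _; rewrite !mxE; ring.
- by move=> e i xi xc; rewrite !mxE uP// wP'.
Qed.

Lemma pieces_Qp u P J : pieces T p u P J -> forall e i, Qp p (fun xi => u (cellX T e xi) i 0).
Proof.
move=> [tP _ _ uP] e i; apply: (Qp_ext (G := P e i)); first exact: uP.
exact: tensor_poly_Qp.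
Qed.

Lemma Uh_lin a b u w : Uh Om T p u -> Uh Om T p w ->
  Uh Om T p (fun x => a *: u x + b *: w x).
Proof.
move=> uU wU; have [cu u0 _] := uU; have [cw w0 _] := wU.
have [P [J uPJ]] := Uh_pieces uU; have [P' [J' wPJ]] := Uh_pieces wU.
split.
- apply: continuous_mx => i j; rewrite (ord1 j) => x.
  have -> : (fun x => (a *: u x + b *: w x) i 0) = (fun x => a * u x i 0 + b * w x i 0).
    by apply/funext => y; rewrite !mxE.
  have cu' : (fun y => u y i 0) @ x --> u x i 0 by exact: (continuous_Uh_coord uU).
  have cw' : (fun y => w y i 0) @ x --> w x i 0 by exact: (continuous_Uh_coord wU).
  have := cvgD (cvgM (cvg_cst a) cu') (cvgM (cvg_cst b) cw').
  exact.
- by move=> x nx; rewrite u0// w0// !scaler0 addr0.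
- exact: pieces_Qp (pieces_lin a b uPJ wPJ).
Qed.

Lemma cgrad_lin a b (J J' : 'I_m -> cV3 -> 'M[R]_3) e xi :
  cgrad T (fun e xi => a *: J e xi + b *: J' e xi) e xi =
  a *: cgrad T J e xi + b *: cgrad T J' e xi.
Proof. by rewrite /cgrad mulmxDl !scalemxAl. Qed.

End LinearStructure.

Section Direction.
Context {R : realType} {m : nat}.
Notation cV3 := 'cV[R]_3.
Notation trip := ({poly R} * {poly R} * {poly R})%type.
Variables (T : hexes R m) (p n : nat).
Hypotheses (Hp : (3 <= p)%N) (Hn : (p + 1 <= n)%N) (Hn3 : (2 * n < 3 * p)%N).

Let d := expd p n.

Let dE : (d + 2 * p = 2 * n + 1)%N. Proof. by rewrite /d /expd; lia. Qed.
Let dp : (d <= p)%N. Proof. by rewrite /d /expd; lia. Qed.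

Definition polyA : {poly R} := 1 - 'X^2.
Definition polyB : {poly R} := 'X * polyA.
Definition polyf : {poly R} := 'X^(d - 2) * polyA.
Definition polyg : {poly R} := 'X^(p - 2) * polyA.

Definition dir_trip (i : 'I_3) : trip :=
  if i == 0 then (polyf, polyA, polyA)
  else if i == 1 then (polyg, polyB, polyA) else (polyg, polyA, polyB).

Definition dir_jac (xi : cV3) : 'M[R]_3 :=
  \matrix_(i, j) teval (dtrip j (dir_trip i)) xi.

Let hornerA (x : R) : polyA.[x] = bumpA x.
Proof. by rewrite !hornerE. Qed.
Let hornerB (x : R) : polyB.[x] = bumpB x.
Proof. by rewrite !hornerE. Qed.
Let hornerf (x : R) : polyf.[x] = bumpf p n x.
Proof. by rewrite !hornerE. Qed.
Let hornerg (x : R) : polyg.[x] = bumpg p x.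
Proof. by rewrite !hornerE. Qed.

Lemma dirvE e x : cell T e x -> dirv T p n e x =
  hexA T e *m (\col_i teval (dir_trip i) (cellXinv T e x)).
Proof.
move=> xe; rewrite /dirv /cell_field mem_set// -!mulmxDr; congr (_ *m _).
move: (cellXinv T e x) => xi.
by apply: cV3P; rewrite !mxE /teval/= ?hornerA ?hornerB ?hornerf ?hornerg ?addr0 ?add0r.
Qed.

(** The nonzero component of each [W_i] contains the factors [1 - t ^ 2] of all
    three coordinates. *)
Lemma dirv0 e x : ~ cello T e x -> dirv T p n e x = 0.
Proof.
move=> nx; case: (pselect (cell T e x)) => [xe|xe]; last first.
  by rewrite /dirv /cell_field memNset// !addr0.
rewrite dirvE// (_ : \col_i _ = 0) ?mulmx0//.
have [i xi] : exists i, 1 - cellXinv T e x i 0 ^+ 2 = 0.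
  apply: contrapT => /forallNP H; apply: nx => i.
  have /cellP := xe; rewrite cubeE => /(_ i); rewrite le_eqVlt => /predU1P[E|//].
  by case: (H i); rewrite -real_normK ?num_real// E expr1n subrr.
apply/matrixP => k j; rewrite !mxE /teval /dir_trip.
move: i xi; apply: ord3P => xi; move: k; apply: ord3P => /=;
  rewrite ?hornerA ?hornerB ?hornerf ?hornerg /bumpA /bumpB /bumpf /bumpg xi;
  by rewrite ?mulr0 ?mul0r.
Qed.

Let size_A : (size polyA <= 3)%N.
Proof.
rewrite /polyA (leq_trans (size_polyD _ _))// size_polyN size_polyXn geq_max.
by rewrite (leq_trans (polyrcf.leq1_size_polyC _)).
Qed.

Let size_B : (size polyB <= 4)%N.
Proof. by rewrite /polyB (leq_trans (size_polyMleq _ _))// size_polyX. Qed.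

Let size_XA k N : (k + 3 <= N)%N -> (size ('X^k * polyA)%R <= N)%N.
Proof.
move=> kN; rewrite (leq_trans (size_polyMleq _ _))// size_polyXn/=.
by rewrite (leq_trans _ kN)// leq_add2l.
Qed.

Lemma tensor_poly_dir i : tensor_poly p.+1 (teval (dir_trip i)).
Proof.
exists [:: dir_trip i]; last by move=> x; rewrite /seval big_seq1.
have A : (size polyA <= p.+1)%N by rewrite (leq_trans size_A)//; lia.
have B : (size polyB <= p.+1)%N by rewrite (leq_trans size_B)//; lia.
have F : (size polyf <= p.+1)%N by apply: size_XA; lia.
have G : (size polyg <= p.+1)%N by apply: size_XA; lia.
by move: i; apply: ord3P; rewrite /= /tsize/= ?A ?B ?F ?G.
Qed.

Variables (Om : set cV3) (es : 'I_m).
Hypotheses (HOm : bounded_lipschitz_domain Om) (Hmesh : conforming_mesh Om T).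

Definition dirP (e : 'I_m) (i : 'I_3) (xi : cV3) : R :=
  (e == es)%:R * \sum_k hexA T e i k * teval (dir_trip k) xi.

Definition dirJ (e : 'I_m) (xi : cV3) : 'M[R]_3 :=
  (e == es)%:R *: (hexA T e *m dir_jac xi).

Let tensor_poly_jac i j : tensor_poly p.+1 (fun xi => dir_jac xi i j).
Proof.
have [dF tdF FdF] := tensor_poly_diff (tensor_poly_dir i).
apply: tensor_poly_ext (tdF j) => xi; rewrite mxE.
have [_ E] := FdF xi; have [_ E'] := is_diff_teval xi (dir_trip i).
have := congr1 (fun h : cV3 -> R => h (delta_mx j 0)) (etrans (esym E) E').
rewrite /= (bigD1 j)//= [RHS](bigD1 j)//= !mxE !eqxx !mul1r !big1 ?addr0// => k kj;
  by rewrite mxE (negbTE kj) mul0r.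
Qed.

Lemma pieces_dirv : pieces T p (dirv T p n es) dirP dirJ.
Proof.
split.
- move=> e i; apply: tensor_polyZ; apply: tensor_poly_sum => k _.
  by apply: tensor_polyZ; exact: tensor_poly_dir.
- move=> e i j; apply: (@tensor_poly_ext _ _ _ (fun xi => (e == es)%:R *
    \sum_k hexA T e i k * dir_jac xi k j)); first by move=> xi; rewrite !mxE.
  by apply: tensor_polyZ; apply: tensor_poly_sum => k _; exact: tensor_polyZ.
- move=> e i xi.
  have -> : dirP e i = (e == es)%:R *: (hexA T e i 0 *: teval (dir_trip 0)
      + hexA T e i 1 *: teval (dir_trip 1) + hexA T e i 2%:R *: teval (dir_trip 2%:R)).
    by apply/funext => y; rewrite /dirP sum3E.
  have dT k := is_diffZ (hexA T e i k) (is_diff_teval xi (dir_trip k)).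
  apply: (is_diff_eq (is_diffZ _ (is_diffD (is_diffD (dT 0) (dT 1)) (dT 2%:R)))).
  apply/funext => v; rewrite !fctE /GRing.scale/= !sum3E !mxE !sum3E !mxE.
  by move: (_%:R) => c; ring.
- move=> e i xi xc; rewrite /dirP; case: eqVneq => [->|ne].
    rewrite mul1r dirvE; last by exists xi.
    by rewrite mxE cellXK; apply: eq_bigr => k _; rewrite mxE.
  rewrite mul0r dirv0 ?mxE// => xes.
  have := cello_cell_disjoint Hmesh (_ : es != e); rewrite eq_sym => /(_ ne).
  by move=> /seteqP[/(_ (cellX T e xi)) + _]; apply; split => //; exists xi.
Qed.

Lemma continuous_dirv : continuous (dirv T p n es).
Proof.
pose bub (x : cV3) : cV3 := hexA T es *m (\col_i teval (dir_trip i) (cellXinv T es x)).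
have cbub : continuous bub.
  apply: continuous_mx => i j; rewrite (ord1 j).
  have tF : tensor_poly p.+1 (fun xi => \sum_k hexA T es i k * teval (dir_trip k) xi).
    by apply: tensor_poly_sum => k _; apply: tensor_polyZ; exact: tensor_poly_dir.
  have -> : (fun x => bub x i 0) =
      (fun xi => \sum_k hexA T es i k * teval (dir_trip k) xi) \o cellXinv T es.
    by apply/funext => x; rewrite /bub mxE; apply: eq_bigr => k _; rewrite mxE.
  move=> x; apply: continuous_comp; first exact: continuous_cellXinv.
  exact: (tensor_poly_continuous tF).
have inE x : cell T es x -> dirv T p n es x = bub x by exact: dirvE.
have out x : ~ cello T es x -> dirv T p n es x = 0 by exact: dirv0.
apply/continuous_ballP => x e e0; have cb := (continuous_ballP _).1 cbub x e e0.
case: (pselect (cello T es x)) => [xo|nxo].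
  have nb : \near x, bub x = dirv T p n es x.
    have : nbhs x (cello T es) by apply: open_nbhs_nbhs; split => //; exact: open_cello.
    by apply: filterS => y /cello_cell /inE.
  rewrite (inE _ (cello_cell xo)); move: cb.
  by apply: filterS2 nb => y <-.
rewrite out//; case: (pselect (cell T es x)) => [xc|nxc].
  have b0 : bub x = 0 by rewrite -inE// out.
  rewrite b0 in cb; move: cb.
  apply: filterS => y yb; case: (pselect (cello T es y)) => [yo|nyo].
    by rewrite inE//; exact: cello_cell.
  by rewrite out//; exact: ballxx.
have : nbhs x (~` cell T es).
  by apply: open_nbhs_nbhs; split => //; apply: closed_openC; exact: closed_cell.
by apply: filterS => y ny; rewrite out; [exact: ballxx|move/cello_cell].
Qed.

Lemma Uh_dirv : Uh Om T p (dirv T p n es).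
Proof.
split; first exact: continuous_dirv.
  by move=> x nx; apply: dirv0 => /(cello_Om HOm Hmesh).
exact: pieces_Qp pieces_dirv.
Qed.

Let beta : R := pint (polyA * polyB * polyA^`()).

(** Up to the factor -2, this is the integral of the square of [X * A]. *)
Let beta_neq0 : beta != 0.
Proof.
rewrite /beta (_ : _ * _ = (- 2) *: ('X * polyA) ^+ 2).
  have q0 : 'X * polyA != 0 :> {poly R}.
    apply/eqP => /(congr1 (fun q : {poly R} => q`_3)) /eqP.
    by rewrite coef0 coefXM /= /polyA coefB coef1 coefXn/= sub0r; apply/negP; rewrite oppr_eq0 oner_eq0.
  have n2 : (- 2 : R) != 0 by rewrite lt_eqF//; lra.
  by rewrite pintZ mulf_neq0// gt_eqF// pint_sqr_gt0.
have -> : polyA^`() = - ((2 : R)%:P * 'X).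
  rewrite /polyA derivB derivXn -[1]/(1%:P) derivC sub0r expr1.
  by rewrite mul_polyC scaler_nat.
rewrite scaleNr -mul_polyC /polyB; move: polyA ((2 : R)%:P) ('X : {poly R}) => A c X.
by ring.
Qed.

Let A1 : polyA.[1] = 0.
Proof. by rewrite hornerA /bumpA expr1n subrr. Qed.

Let Am1 : polyA.[-1] = 0.
Proof. by rewrite hornerA /bumpA sqrrN expr1n subrr. Qed.

Let pint_fgg : pint ((polyf * polyg ^+ 2)^`()) = 0.
Proof.
by rewrite pint_deriv /polyf !hornerM A1 Am1 !(mulr0, mul0r) subrr.
Qed.

Lemma pint_AAdB : pint (polyA * polyA * polyB^`()) = - (2 * beta).
Proof.
have : pint ((polyA * polyA * polyB)^`()) = 0.
  by rewrite pint_deriv !hornerM A1 Am1 !mul0r subrr.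
rewrite (derivM (polyA * polyA) polyB) (derivM polyA polyA) => E.
suff /eqP : pint (polyA * polyA * polyB^`()) + 2 * beta = 0.
  by rewrite addr_eq0 => /eqP.
rewrite -[RHS]E /beta -pintZ -pintD -mul_polyC polyC_natr; congr pint.
by move: polyA polyB (polyA^`()) (polyB^`()) => A B A' B'; ring.
Qed.

(** The trilinear quadrature value of the Jacobian determinant, for any linear
    functional on polynomials: the tangential factors enter only through
    [beta], and the remaining one is an exact derivative. *)
Let det_jac_seval : exists s : seq trip, (forall xi, \det (dir_jac xi) = seval s xi) /\
  forall L : {poly R} -> R,
    (forall q r, L (q + r) = L q + L r) -> (forall a q, L (a *: q) = a * L q) ->
    (L (polyA * polyA * polyB^`()) = - (2 * beta)) -> L (polyA * polyB * polyA^`()) = beta ->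
    \sum_(t <- s) L t.1.1 * L t.1.2 * L t.2 =
      3 * beta ^+ 2 * L ((polyf * polyg ^+ 2)^`()).
Proof.
pose A := polyA; pose B := polyB; pose A' := polyA^`(); pose B' := polyB^`().
pose fg := polyf^`() * polyg * polyg; pose gg := polyf * polyg^`() * polyg.
exists [:: (fg, A * A * B', A * A * B'); (- fg, A * B * A', A * B * A');
  (- gg, A * B * A', A * A * B'); (gg, A * B * A', A * B * A');
  (gg, A * B * A', A * B * A'); (- gg, A * A * B', A * B * A')]; split.
  move=> xi; rewrite det3E !mxE /seval !big_cons big_nil.
  rewrite /dir_trip /dtrip /= /teval /= !(hornerM, hornerN) -/A -/B -/A' -/B'.
  by ring.
move=> L LD LZ LB LA; rewrite !big_cons big_nil /=.
have LN q : L (- q) = - L q by rewrite -scaleN1r LZ mulN1r.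
rewrite !LN /A /B /A' /B' LB LA.
have -> : (polyf * polyg ^+ 2)^`() = fg + 2 *: gg.
  rewrite (derivM polyf) expr2 (derivM polyg polyg) /fg /gg -mul_polyC polyC_natr.
  by move: polyf polyg (polyf^`()) (polyg^`()) => f g f' g'; ring.
by rewrite LD LZ; ring.
Qed.

Lemma int3_det_jac : int3 cube (fun xi => \det (dir_jac xi)) = 0.
Proof.
have [s [sE sL]] := det_jac_seval.
have -> : (fun xi => \det (dir_jac xi)) = seval s by apply/funext.
rewrite int3_cube_seval sL//; [|exact: pintD|exact: pintZ|exact: pint_AAdB].
by rewrite pint_fgg mulr0.
Qed.

(** All tangential factors have degree 6 and are integrated exactly.
    The normal factor is the derivative of [H = f * g ^ 2], whose degree is
    [2 * n + 1] by the choice of the exponent in [f]: its derivative has the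
    first degree at which the rule fails, and the defect is signed. *)
Lemma gauss3_det_jac : 0 < gauss3 n (fun xi => \det (dir_jac xi)).
Proof.
have [s [sE sL]] := det_jac_seval.
have -> : (fun xi => \det (dir_jac xi)) = seval s by apply/funext.
have n4 : (4 <= n)%N by lia.
have sz (q r t : {poly R}) : (size q <= 3)%N -> (size r <= 4)%N -> (size t <= 3)%N ->
    (size (q * r * t)%R <= n + n)%N.
  move=> hq hr ht; have := size_polyMleq (q * r) t; have := size_polyMleq q r.
  by lia.
have dsz k (q : {poly R}) : (size q <= k.+1)%N -> (size (q^`()) <= k)%N.
  move=> qk; have [->|q0] := eqVneq q 0; first by rewrite deriv0 size_poly0.
  by rewrite -ltnS (leq_trans (lt_size_deriv q0)).
rewrite gauss3_seval sL; [|exact: gauss1D|exact: gauss1Z|..]; last 2 first.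
- rewrite gauss1_exact ?pint_AAdB// sz// ?(leq_trans size_A)//.
  by apply: dsz; exact: size_B.
- rewrite gauss1_exact// sz//.
  by apply: dsz; rewrite (leq_trans size_A).
pose H := polyf * polyg ^+ 2.
suff : 0 < gauss1 n H^`().
  by apply: mulr_gt0; rewrite mulr_gt0// exprn_even_gt0.
have HE : H = 'X^(2 * n - 5) * polyA ^+ 3.
  rewrite /H /polyf /polyg exprMn -exprM mulrACA -exprD -exprS.
  by congr ('X^_ * _); have := dE; lia.
have A3 : (polyA ^+ 3)`_6 = -1.
  have -> : polyA ^+ 3 = 1 - 3 *: 'X^2 + 3 *: 'X^4 - 'X^6.
    rewrite /polyA -!mul_polyC !polyC_natr (exprM _ 2 2 : 'X^4 = _) (exprM _ 2 3 : 'X^6 = _).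
    by move: ('X^2) => X; ring.
  by rewrite !(coefD, coefN) !coefZ !coefXn coefC/=; ring.
have sA3 : (size (polyA ^+ 3)%R <= 7)%N.
  have h2 := size_polyMleq polyA polyA; have h3 := size_polyMleq (polyA * polyA) polyA.
  by have := size_A; rewrite exprSr expr2; lia.
have Hlead : H`_(n + n).+1 = -1.
  have -> : (n + n).+1 = (2 * n - 5 + 6)%N by clear -n4; lia.
  by rewrite HE coefXnM ltnNge leq_addr/= addKn.
have Hsize : (size H <= (n + n).+2)%N.
  rewrite HE (leq_trans (size_polyMleq _ _))// size_polyXn; lia.
(* the leading coefficient of [H] is -1, so [c] is that of its derivative *)
pose c : R := - (n + n).+1%:R; pose q := c^-1 *: H^`() - 'X^(n + n).
have c0 : c != 0 by rewrite oppr_eq0 pnatr_eq0.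
have dHE : H^`() = c *: ('X^(n + n) + q).
  by rewrite /q addrC subrK scalerA mulfV// scale1r.
have sq : (size q <= n + n)%N.
  apply/leq_sizeP => j; rewrite leq_eqVlt => /predU1P[<-|nj].
    by rewrite coefB coefZ coef_deriv Hlead coefXn eqxx mulNrn -/c mulVf// subrr.
  rewrite coefB coefZ coef_deriv coefXn gtn_eqF// nth_default ?mul0rn ?mulr0 ?subrr//.
  by rewrite (leq_trans Hsize).
have I0 : pint H^`() = 0 by exact: pint_fgg.
rewrite dHE gauss1Z gauss1_defect// mulrBr -pintZ -dHE I0 sub0r -mulNr opprK.
by rewrite mulr_gt0 ?ltr0n// pint_sqr_gt0// monic_neq0// monic_nodal.
Qed.

End Direction.

(** * Residuals along the direction *)

Section ScaledFields.
Context {R : realType} {m : nat}.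
Notation cV3 := 'cV[R]_3.
Variables (T : hexes R m) (p : nat) (Om : set cV3).

Lemma pieces_scale t u P J : pieces T p u P J ->
  pieces T p (fun x => t *: u x) (fun e i xi => t * P e i xi) (fun e xi => t *: J e xi).
Proof.
move=> uPJ; have := pieces_lin t 0 uPJ uPJ.
have -> : (fun x => t *: u x + 0 *: u x) = (fun x => t *: u x).
  by apply/funext => x; rewrite scale0r addr0.
have -> : (fun e i xi => t * P e i xi + 0 * P e i xi) = (fun e i xi => t * P e i xi).
  by apply/funext => e; apply/funext => i; apply/funext => xi; rewrite mul0r addr0.
have -> // : (fun e xi => t *: J e xi + 0 *: J e xi) = (fun e xi => t *: J e xi).
by apply/funext => e; apply/funext => xi; rewrite scale0r addr0.
Qed.

Lemma Uh_scale t u : Uh Om T p u -> Uh Om T p (fun x => t *: u x).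
Proof.
move=> uU; have := Uh_lin t 0 uU uU.
congr (Uh _ _ _ _); apply/funext => x; by rewrite scale0r addr0.
Qed.

Lemma cgradZ t J e xi : cgrad T (fun e xi => t *: J e xi) e xi = t *: cgrad T J e xi.
Proof. by rewrite /cgrad scalemxAl. Qed.

Lemma tensor_poly_det u P J : pieces T p u P J -> forall e,
  tensor_poly (4 * p.+1) (fun xi => \det (cgrad T J e xi)).
Proof.
move=> uPJ e.
apply: tensor_poly_ext (fun xi => det3E (cgrad T J e xi)) _.
have t1 := tensor_poly_cgrad uPJ e.
have t3 i k j l i' k' j' l' s t : tensor_poly (4 * p.+1) (fun xi => cgrad T J e xi s t *
   (cgrad T J e xi i k * cgrad T J e xi j l - cgrad T J e xi i' k' * cgrad T J e xi j' l')).
  apply: tensor_polyW (tensor_polyM (t1 s t) (tensor_polyB (tensor_polyM (t1 i k) (t1 j l))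
    (tensor_polyM (t1 i' k') (t1 j' l')))); lia.
by apply: tensor_polyD; first apply: tensor_polyB.
Qed.

(** The volume defect of a discrete field is a polynomial on each cell, so its
    integral is its value under any sufficiently long Gauss rule. *)
Lemma qI_qQ u P J : pieces T p u P J -> forall e N, (2 * p.+1 <= N)%N ->
  qI T u e = qQ T (fun=> N) u e.
Proof.
move=> uPJ e N pN; rewrite /qI /qQ (gauss3_eq _ (vol_defectE uPJ e)).
rewrite gauss3_exact; last first.
  apply: tensor_polyZ; apply: tensor_polyD.
    by apply: tensor_polyW (tensor_poly_minors uPJ e); lia.
  by apply: tensor_polyW (tensor_poly_det uPJ e); lia.
apply: (int3_off_null (null3_cube_boundary (R := R))) => // xi nb xc.
by apply: (vol_defectE uPJ); apply: contrapT => nxo; apply: nb.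
Qed.

End ScaledFields.

Section DirectionResidual.
Context {R : realType} {m : nat}.
Notation cV3 := 'cV[R]_3.
Variables (Om : set cV3) (T : hexes R m) (p : nat) (ne : 'I_m -> nat) (es : 'I_m).
Hypotheses (HOm : bounded_lipschitz_domain Om) (Hmesh : conforming_mesh Om T).
Hypotheses (Hp : (3 <= p)%N) (Hne : forall e, (p + 1 <= ne e)%N).
Hypothesis Hes : (2 * ne es < 3 * p)%N.

Let n := ne es.
Let v := dirv T p n es.
Let J := dirJ T p n es.

(** The residual of the direction in its cell, as the coefficient of [t ^+ 3]. *)
Definition kappa : R := \det (hexA T es) * gauss3 n (fun xi => \det (dir_jac p n xi)).

Lemma kappa_gt0 : 0 < kappa.
Proof. by rewrite mulr_gt0 ?(hexA_det T es)// gauss3_det_jac// Hne. Qed.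

Let vPJ := pieces_dirv Hp (Hne es) Hes es Hmesh.
Let vU := Uh_dirv Hp (Hne es) Hes es HOm Hmesh.

Let cgrad0 e xi : e != es -> cgrad T J e xi = 0.
Proof. by move=> ne0; rewrite /cgrad /J /dirJ (negbTE ne0) scale0r mul0mx. Qed.

Let det_cgrad xi : \det (cgrad T J es xi) = \det (dir_jac p n xi).
Proof.
rewrite /cgrad /J /dirJ eqxx scale1r !det_mulmx mulrC mulrA -det_mulmx.
by rewrite mulVmx ?hexA_unit// det1 mul1r.
Qed.

(** The lower-order terms cancel in the sum over the cells; as the direction
    lives in a single cell, they vanish there. *)
Let minors_es t : \det (hexA T es) * int3 cube (fun xi =>
  minors1 (t *: cgrad T J es xi) + minors2 (t *: cgrad T J es xi)) = 0.
Proof.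
have := sum_minors0 Hmesh (Uh_scale t vU) (pieces_scale t vPJ).
rewrite (bigD1 es)//= [X in _ + X]big1 ?addr0.
  by under [in X in X -> _]eq_fun do rewrite cgradZ.
move=> e ees; rewrite int3E (_ : (fun x => _) = fun=> 0) ?integ0 ?mulr0//.
apply/funext => xi; rewrite cgradZ cgrad0// scaler0 /minors1 /minors2 !mxE.
by rewrite !(mulr0, addr0, subr0, mul0r).
Qed.

Let qQ_tv_gen (ne' : 'I_m -> nat) t e : (p + 1 <= ne' e)%N ->
  qQ T ne' (fun x => t *: v x) e = (e == es)%:R * (t ^+ 3 *
    (\det (hexA T es) * gauss3 (ne' es) (fun xi => \det (dir_jac p n xi)))).
Proof.
move=> pne; rewrite (qQ_expansion (pieces_scale t vPJ) pne).
have [->|ees] := eqVneq e es.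
  under [in X in X + _]eq_fun do rewrite cgradZ.
  rewrite minors_es add0r mul1r mulrCA; congr (_ * _).
  rewrite -gauss3Z; congr gauss3; apply/funext => xi.
  by rewrite cgradZ detZ det_cgrad.
rewrite mul0r int3E (_ : (fun x => _ * _) = fun=> 0); last first.
  apply/funext => xi; rewrite cgradZ cgrad0// scaler0 /minors1 /minors2 !mxE.
  by rewrite !(mulr0, addr0, subr0, mul0r).
rewrite integ0 mulr0 add0r (_ : (fun x => _) = fun=> 0 * 0) ?gauss3Z ?mul0r ?mulr0//.
by apply/funext => xi /=; rewrite cgradZ cgrad0// scaler0 det0.
Qed.

Lemma qQ_tv t e : qQ T ne (fun x => t *: v x) e = (e == es)%:R * (t ^+ 3 * kappa).
Proof. exact: qQ_tv_gen. Qed.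

Lemma qI_tv t e : qI T (fun x => t *: v x) e = 0.
Proof.
have N1 : (2 * p.+1 <= 4 * p.+1)%N by lia.
rewrite (qI_qQ (pieces_scale t vPJ) e N1) qQ_tv_gen; last by lia.
rewrite gauss3_exact ?int3_det_jac ?mulr0//.
have h := tensor_poly_det vPJ es.
apply: tensor_polyW (tensor_poly_ext (fun xi => esym (det_cgrad xi)) h).
lia.
Qed.

Lemma qnorm_tv t : qnorm T (qQ T ne (fun x => t *: v x)) =
  `|t| ^+ 3 * (kappa / Num.sqrt (cellV T es)).
Proof.
rewrite /qnorm (bigD1 es)//= big1 ?addr0; last first.
  by move=> e ees; rewrite qQ_tv (negbTE ees) mul0r expr0n mul0r.
rewrite qQ_tv eqxx mul1r sqrtrM ?sqr_ge0// sqrtr_sqr normrM normrX.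
by rewrite (gtr0_norm kappa_gt0) sqrtrV ?mulrA// ltW// cellV_gt0.
Qed.

End DirectionResidual.

(** * The H1 norm controls nodal gradients *)

Section H1Norm.
Context {R : realType} {m : nat}.
Notation cV3 := 'cV[R]_3.
Variables (Om : set cV3) (T : hexes R m) (p : nat).
Hypotheses (HOm : bounded_lipschitz_domain Om) (Hmesh : conforming_mesh Om T).

Definition energy (P : 'I_m -> 'I_3 -> cV3 -> R) (J : 'I_m -> cV3 -> 'M[R]_3) e xi : R :=
  \sum_i P e i xi ^+ 2 + frob2 (cgrad T J e xi).

Lemma frob2_ge0 k l (M : 'M[R]_(k, l)) : 0 <= frob2 M.
Proof. by apply: sumr_ge0 => i _; apply: sumr_ge0 => j _; exact: sqr_ge0. Qed.

Lemma frob2_cV k (M : 'cV[R]_k) : frob2 M = \sum_i M i 0 ^+ 2.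
Proof. by apply: eq_bigr => i _; rewrite big_ord1. Qed.

Lemma frob2_entry k l (M : 'M[R]_(k, l)) i j : M i j ^+ 2 <= frob2 M.
Proof.
rewrite /frob2 (bigD1 i)//= (bigD1 j)//= -addrA lerDl addr_ge0//.
  by apply: sumr_ge0 => ? _; exact: sqr_ge0.
by apply: sumr_ge0 => ? _; apply: sumr_ge0 => ? _; exact: sqr_ge0.
Qed.

Lemma tensor_poly_sqr N (F : cV3 -> R) : tensor_poly N F ->
  tensor_poly (N + N).-1 (fun x => F x ^+ 2).
Proof.
by move=> tF; apply: tensor_poly_ext (tensor_polyM tF tF) => x; rewrite expr2.
Qed.

(** The mesh tiles [Om] up to the null set of the cell boundaries. *)
Lemma int3_Om_cells N (F : 'I_m -> cV3 -> R) f : (forall e, tensor_poly N (F e)) ->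
  (forall e x, cello T e x -> f x = F e (cellXinv T e x)) ->
  int3 Om f = \sum_e \det (hexA T e) * int3 cube (F e).
Proof.
move=> tF fF; rewrite -(integ_sum_on_cell T tF).
rewrite (int3_off_null (null3_skeleton T) (E := [set x | exists e, cello T e x])
  (g := fun x => \sum_f on_cell T f (F f) x)).
- rewrite int3E; congr integ; apply/funext => x.
  case: (pselect (exists e, cello T e x)) => ex.
    by rewrite indicE mem_set// mulr1.
  rewrite indicE memNset// mulr0 sum_on_cell0// => e xe.
  by apply: ex; exists e.
- move=> x nx; split; last by move=> [e]; exact: (cello_Om HOm Hmesh).
  move=> /(Om_cells Hmesh)[e xe]; exists e; apply: contrapT => xo.
  by apply: nx; exists e.
- move=> x nx /(Om_cells Hmesh)[e xe].
  have xo : cello T e x by apply: contrapT => xo; apply: nx; exists e.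
  by rewrite (sum_on_cellE Hmesh _ xo) (fF e).
Qed.

Lemma int3_one_cell N (F : cV3 -> R) (D : set cV3) e f : tensor_poly N F ->
  cello T e `<=` D -> (forall x, cello T e x -> f x = F (cellXinv T e x)) ->
  (forall x, D x -> ~ skeleton T x -> ~ cello T e x -> f x = 0) ->
  int3 D f = \det (hexA T e) * int3 cube F.
Proof.
move=> tF eD fF f0; rewrite -(integ_on_cell T e tF).
rewrite (int3_off_null (null3_skeleton T) (E := D) (g := on_cell T e F))//.
  rewrite int3E; congr integ; apply/funext => x.
  case: (pselect (cello T e x)) => [xo|xo]; last by rewrite on_cell0// mul0r.
  by rewrite indicE mem_set ?mulr1//; exact: eD.
move=> x nx Dx; case: (pselect (cello T e x)) => [xo|xo].
  by rewrite on_cellE// fF.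
by rewrite on_cell0// f0.
Qed.

Section Pieces.
Variables (u : cV3 -> cV3) (P : 'I_m -> 'I_3 -> cV3 -> R) (J : 'I_m -> cV3 -> 'M[R]_3).
Hypothesis uPJ : pieces T p u P J.

Lemma tensor_poly_energy e : tensor_poly (p.+1 + p.+1).-1 (energy P J e).
Proof.
have [tP _ _ _] := uPJ.
apply: tensor_polyD; first by apply: tensor_poly_sum => i _; exact: tensor_poly_sqr.
apply: tensor_poly_sum => i _; apply: tensor_poly_sum => k _.
exact: tensor_poly_sqr (tensor_poly_cgrad uPJ e i k).
Qed.

Lemma energy_ge0 e xi : 0 <= energy P J e xi.
Proof. by rewrite addr_ge0 ?frob2_ge0//; apply: sumr_ge0 => i _; exact: sqr_ge0. Qed.

Lemma energyE e x : cello T e x ->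
  frob2 (u x) + frob2 (Dmx u x) = energy P J e (cellXinv T e x).
Proof.
move=> xe; rewrite (pieces_Dmx uPJ xe) frob2_cV; congr (_ + _).
apply: eq_bigr => i _; have [_ _ _ uP] := uPJ.
rewrite -uP ?cellXinvK//; exact: cubeo_cube.
Qed.

Lemma H1norm_sqrE : H1norm Om u = Num.sqrt (\sum_e \det (hexA T e) * int3 cube (energy P J e)).
Proof.
congr Num.sqrt; apply: (int3_Om_cells tensor_poly_energy) => e x.
exact: energyE.
Qed.

Lemma int3_energy_ge0 e : 0 <= int3 cube (energy P J e).
Proof.
rewrite int3E; apply: integ_ge0 => x.
by apply: mulr_ge0; [exact: energy_ge0|rewrite indicE].
Qed.

(** The Gauss rule integrates the energy density exactly and has positive
    weights, so the H1 norm controls the gradient at each quadrature node. *)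
Lemma node_gradient_le n e x y z i k : (p + 1 <= n)%N ->
  x \in gl_nodes n -> y \in gl_nodes n -> z \in gl_nodes n ->
  `|cgrad T J e (vec3 x y z) i k| <=
  (Num.sqrt (\det (hexA T e) * (gl_weight n x * gl_weight n y * gl_weight n z)))^-1
    * H1norm Om u.
Proof.
move=> pn xn yn zn.
have W (t : R) : t \in gl_nodes n -> 0 < gl_weight n t by exact: gl_weight_gt0.
have Wge (t : R) : t \in gl_nodes n -> 0 <= gl_weight n t by move=> /W/ltW.
set w := gl_weight n x * _ * _.
have w0 : 0 < w by rewrite /w !mulr_gt0// W.
have D0 := hexA_det T e.
have Dw : 0 < \det (hexA T e) * w by exact: mulr_gt0.
rewrite [leRHS]mulrC ler_pdivlMr ?sqrtr_gt0// -sqrtr_sqr -sqrtrM ?sqr_ge0//.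
rewrite H1norm_sqrE ler_wsqrtr// (bigD1 e)//=.
rewrite -[X in X <= _]addr0 lerD//; last first.
  by apply: sumr_ge0 => f _; rewrite mulr_ge0 ?int3_energy_ge0// ltW// hexA_det.
rewrite mulrCA ler_pM2l// -(@gauss3_exact _ n); last first.
  by apply: tensor_polyW (tensor_poly_energy e); lia.
rewrite mulrC /gauss3.
have En a b c : a \in gl_nodes n -> b \in gl_nodes n -> c \in gl_nodes n ->
    0 <= gl_weight n a * gl_weight n b * gl_weight n c * energy P J e (vec3 a b c).
  by move=> an bn cn; rewrite !mulr_ge0 ?Wge// energy_ge0.
have sumge (s : seq R) (F : R -> R) a : a \in s -> (forall b, b \in s -> 0 <= F b) ->
    F a <= \sum_(b <- s) F b.
  move=> sa F0; rewrite (big_rem a)//= lerDl big_seq_cond.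
  by apply: sumr_ge0 => b /andP[/mem_rem sb _]; exact: F0.
apply: (@le_trans _ _ (w * energy P J e (vec3 x y z))).
  rewrite ler_pM2l// /energy (le_trans (frob2_entry _ _ _))// lerDr.
  by apply: sumr_ge0 => ? _; exact: sqr_ge0.
apply: le_trans (sumge _ _ _ xn _); last first.
  move=> a an; rewrite big_seq_cond; apply: sumr_ge0 => b /andP[bn _].
  by rewrite big_seq_cond; apply: sumr_ge0 => c /andP[cn _]; exact: En.
apply: le_trans (sumge _ _ _ yn _); last first.
  by move=> b bn; rewrite big_seq_cond; apply: sumr_ge0 => c /andP[cn _]; exact: En.
apply: le_trans (sumge _ _ _ zn _); last by move=> c cn; exact: En.
by [].
Qed.

End Pieces.

Lemma H1norm_ge0 u : 0 <= H1norm Om u. Proof. exact: sqrtr_ge0. Qed.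

Lemma H1norm_scale t u : Uh Om T p u -> H1norm Om (fun x => t *: u x) = `|t| * H1norm Om u.
Proof.
move=> uU; have [P [J uPJ]] := Uh_pieces uU.
rewrite (H1norm_sqrE (pieces_scale t uPJ)) (H1norm_sqrE uPJ) -sqrtr_sqr -sqrtrM ?sqr_ge0//.
congr Num.sqrt; rewrite mulr_sumr; apply: eq_bigr => e _; rewrite mulrCA; congr (_ * _).
rewrite !int3E -integZ; last exact: tame_cube (tensor_poly_energy uPJ e).
congr integ; apply/funext => xi; rewrite mulrA; congr (_ * _).
rewrite /energy cgradZ mulrDr /frob2 !mulr_sumr; congr (_ + _); apply: eq_bigr => i _.
  by rewrite exprMn.
by rewrite mulr_sumr; apply: eq_bigr => j _; rewrite mxE exprMn.
Qed.

(** Each residual mixes three degrees of homogeneity; their sum is a pure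
    cubic. *)
Lemma sum_qQ_scale (ne : 'I_m -> nat) t u : (forall e, (p + 1 <= ne e)%N) ->
  Uh Om T p u -> \sum_e qQ T ne (fun x => t *: u x) e = t ^+ 3 * \sum_e qQ T ne u e.
Proof.
move=> pne uU; have [P [J uPJ]] := Uh_pieces uU.
rewrite (sum_qQ Hmesh (Uh_scale t uU) (pieces_scale t uPJ) pne) (sum_qQ Hmesh uU uPJ pne).
rewrite mulr_sumr; apply: eq_bigr => e _; rewrite mulrCA; congr (_ * _).
by rewrite -gauss3Z; congr gauss3; apply/funext => xi; rewrite cgradZ detZ.
Qed.

End H1Norm.

Section Approach.
Context {R : realType} {X : Type}.
Variables (D : X -> Prop) (h : X -> R).
Hypothesis h01 : forall x, D x -> 0 <= h x <= 1.

(** Lipschitz dependence on a scale [h], phrased so that it is stable under sums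
    and products without naming the constants; [h] bounded by 1 absorbs the
    quadratic term of a product. *)
Definition approach (f : X -> R) (a : R) : Prop :=
  exists K, forall x, D x -> `|f x - a| <= K * h x.

Lemma approachD f a g b : approach f a -> approach g b ->
  approach (fun x => f x + g x) (a + b).
Proof.
move=> [K fK] [L gL]; exists (K + L) => x Dx.
rewrite opprD addrACA mulrDl (le_trans (ler_normD _ _))//.
by apply: lerD; [exact: fK|exact: gL].
Qed.

Lemma approachZ c f a : approach f a -> approach (fun x => c * f x) (c * a).
Proof.
move=> [K fK]; exists (`|c| * K) => x Dx.
by rewrite -mulrBr normrM -mulrA ler_wpM2l// fK.
Qed.

Lemma approachB f a g b : approach f a -> approach g b ->
  approach (fun x => f x - g x) (a - b).
Proof.
move=> fa /(approachZ (-1)) gb; have := approachD fa gb.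
by under eq_fun do rewrite mulN1r; rewrite mulN1r.
Qed.

Lemma approachM f a g b : approach f a -> approach g b ->
  approach (fun x => f x * g x) (a * b).
Proof.
move=> [K fK] [L gL]; exists (`|K| * `|L| + `|a| * `|L| + `|K| * `|b|) => x Dx.
have /andP[h0 h1] := h01 Dx.
have fK' : `|f x - a| <= `|K| * h x.
  by rewrite (le_trans (fK x Dx))// ler_wpM2r// ler_norm.
have gL' : `|g x - b| <= `|L| * h x.
  by rewrite (le_trans (gL x Dx))// ler_wpM2r// ler_norm.
have -> : f x * g x - a * b = (f x - a) * (g x - b) + a * (g x - b) + (f x - a) * b by ring.
rewrite [leRHS]mulrDl (le_trans (ler_normD _ _))// lerD//; last first.
  by rewrite normrM mulrAC ler_wpM2r.
rewrite [leRHS]mulrDl (le_trans (ler_normD _ _))// lerD//; last first.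
  by rewrite normrM -mulrA ler_wpM2l.
rewrite normrM; have := ler_pM (normr_ge0 _) (normr_ge0 _) fK' gL'.
move=> /le_trans; apply.
by rewrite mulrACA ler_wpM2l ?mulr_ge0// -[leRHS]mulr1 ler_wpM2l.
Qed.

Lemma approach_sum (I : eqType) (s : seq I) (f : I -> X -> R) (a : I -> R) :
  (forall i, i \in s -> approach (f i) (a i)) ->
  approach (fun x => \sum_(i <- s) f i x) (\sum_(i <- s) a i).
Proof.
elim: s => [_|i s IH fa].
  by exists 0 => x _; rewrite !big_nil subrr normr0 mul0r.
have fs j : j \in s -> approach (f j) (a j) by move=> js; apply: fa; rewrite inE js orbT.
have := approachD (fa i (mem_head _ _)) (IH fs).
by rewrite big_cons; under [in X in _ -> X]eq_fun do rewrite big_cons.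
Qed.

End Approach.

(** * Distance to the constraint set along the direction *)

Section DistanceFromConstraint.
Context {R : realType} {m : nat}.
Notation cV3 := 'cV[R]_3.
Variables (Om : set cV3) (T : hexes R m) (p : nat) (ne : 'I_m -> nat) (es : 'I_m).
Hypotheses (HOm : bounded_lipschitz_domain Om) (Hmesh : conforming_mesh Om T).
Hypotheses (Hp : (3 <= p)%N) (Hne : forall e, (p + 1 <= ne e)%N).
Hypothesis Hes : (2 * ne es < 3 * p)%N.

Let v := dirv T p (ne es) es.
Let vPJ := pieces_dirv Hp (Hne es) Hes es Hmesh.
Let vU : Uh Om T p v := Uh_dirv Hp (Hne es) Hes es HOm Hmesh.
Let kap := kappa T p ne es.

Let qQ_v t e : qQ T ne (fun x => t *: v x) e = (e == es)%:R * (t ^+ 3 * kap).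
Proof. exact: (qQ_tv HOm). Qed.

Let kap0 : 0 < kap.
Proof. exact: kappa_gt0. Qed.

Let field_data : Type :=
  ((cV3 -> cV3) * ('I_m -> 'I_3 -> cV3 -> R) * ('I_m -> cV3 -> 'M[R]_3))%type.

Let gap (d : field_data) : R := H1norm Om (fun x => v x - d.1.1 x).

Let near_v (d : field_data) : Prop :=
  [/\ Uh Om T p d.1.1, pieces T p d.1.1 d.1.2 d.2 & gap d <= 1].

Let gap01 d : near_v d -> 0 <= gap d <= 1.
Proof. by case=> _ _ ->; rewrite H1norm_ge0. Qed.

Let approach_cgrad e x y z i k : x \in gl_nodes (ne e) -> y \in gl_nodes (ne e) ->
  z \in gl_nodes (ne e) ->
  approach near_v gap (fun d => cgrad T d.2 e (vec3 x y z) i k)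
    (cgrad T (dirJ T p (ne es) es) e (vec3 x y z) i k).
Proof.
move=> xn yn zn; exists (Num.sqrt (\det (hexA T e) * (gl_weight (ne e) x *
  gl_weight (ne e) y * gl_weight (ne e) z)))^-1 => -[[w P] J] [/= wU wPJ _].
have := node_gradient_le HOm Hmesh (pieces_lin 1 (-1) vPJ wPJ) e i k (Hne e) xn yn zn.
rewrite cgrad_lin !mxE mul1r mulN1r distrC; congr (_ <= _ * H1norm _ _).
by apply/funext => ?; rewrite scale1r scaleN1r.
Qed.

Let approach_det e x y z : x \in gl_nodes (ne e) -> y \in gl_nodes (ne e) ->
  z \in gl_nodes (ne e) ->
  approach near_v gap (fun d => \det (cgrad T d.2 e (vec3 x y z)))
    (\det (cgrad T (dirJ T p (ne es) es) e (vec3 x y z))).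
Proof.
move=> xn yn zn; have aJ i k := approach_cgrad i k xn yn zn.
have aM := approachM gap01.
rewrite det3E; under [X in approach _ _ X _]eq_fun do rewrite det3E.
have a3 i k j l i' k' j' l' s t := aM _ _ _ _ (aJ s t)
  (approachB (aM _ _ _ _ (aJ i k) (aJ j l)) (aM _ _ _ _ (aJ i' k') (aJ j' l'))).
by apply: approachD; first apply: approachB; exact: a3.
Qed.

Let approach_cubic : approach near_v gap
  (fun d => \sum_e \det (hexA T e) * gauss3 (ne e) (fun xi => \det (cgrad T d.2 e xi))) kap.
Proof.
have <- : \sum_e \det (hexA T e) *
    gauss3 (ne e) (fun xi => \det (cgrad T (dirJ T p (ne es) es) e xi)) = kap.
  have := sum_qQ Hmesh vU vPJ Hne; rewrite (bigD1 es)//= big1 ?addr0.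
    have -> : v = (fun x => 1 *: v x) by apply/funext => x; rewrite scale1r.
    by rewrite qQ_v eqxx expr1n !mul1r => <-.
  move=> e ees; have -> : v = (fun x => 1 *: v x) by apply/funext => x; rewrite scale1r.
  by rewrite qQ_v (negbTE ees) mul0r.
apply: approach_sum => e _; apply: approachZ.
apply: approach_sum => x xn; apply: approach_sum => y yn; apply: approach_sum => z zn.
by apply: approachZ; exact: approach_det.
Qed.

(** The residuals of a field satisfying all the constraints add up to zero;
    that sum is a cubic form in the nodal gradients, hence continuous, and it
    does not vanish at [v]. *)
Lemma dirv_far : exists2 c, 0 < c & forall w, Uh Om T p w -> \sum_e qQ T ne w e = 0 ->
  c <= H1norm Om (fun x => v x - w x).
Proof.
have [K HK] := approach_cubic.
exists (Num.min 1 (kap / (`|K| + 1))).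
  by rewrite lt_min ltr01/= divr_gt0// ltr_wpDl.
move=> w wU w0; have [P [J wPJ]] := Uh_pieces wU.
rewrite ge_min; have [//|/ltW h1] := leP 1 (H1norm Om (fun x => v x - w x)).
rewrite /= ler_pdivrMr ?ltr_wpDl//.
have /HK := And3 wU wPJ h1 : near_v (w, P, J).
rewrite /= -(sum_qQ Hmesh wU wPJ Hne) w0 sub0r normrN (gtr0_norm kap0).
move=> /le_trans; apply; rewrite mulrC ler_wpM2l ?H1norm_ge0//.
by rewrite (le_trans (ler_norm K))// lerDl.
Qed.

Let zeroE : (fun x => 0 *: v x) = (fun=> 0).
Proof. by apply/funext => x; rewrite scale0r. Qed.

Lemma FhQ_0 : FhQ Om T p ne (fun=> 0).
Proof.
rewrite -zeroE; split; first exact: Uh_scale.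
by move=> e; rewrite qQ_v expr0n mul0r mulr0.
Qed.

Lemma has_lbound_dist u : has_lbound [set H1norm Om (fun x => u x - w x) | w in FhQ Om T p ne].
Proof. by exists 0 => _ [w _ <-]; exact: H1norm_ge0. Qed.

Lemma distH1_le u w : FhQ Om T p ne w -> distH1 Om u (FhQ Om T p ne) <= H1norm Om (fun x => u x - w x).
Proof. by move=> wF; apply: (ge_inf (has_lbound_dist u)); exists w. Qed.

Lemma distH1_tv_le t : 0 < t ->
  distH1 Om (fun x => t *: v x) (FhQ Om T p ne) <= H1norm Om v * t.
Proof.
move=> t0; apply: le_trans (distH1_le _ FhQ_0) _.
under eq_fun do rewrite subr0.
by rewrite (H1norm_scale HOm Hmesh _ vU) gtr0_norm// mulrC.
Qed.

(** The zero set of the sum of the residuals is a cone containing the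
    constraint set, so the bound at [v] scales linearly. *)
Lemma distH1_tv_ge : exists2 c, 0 < c & forall t, 0 < t ->
  c * t <= distH1 Om (fun x => t *: v x) (FhQ Om T p ne).
Proof.
have [c c0 Hc] := dirv_far; exists c => // t t0; apply: lb_le_inf.
  by exists (H1norm Om (fun x => t *: v x - 0)); exists (fun=> 0) => //; exact: FhQ_0.
move=> _ [w [wU w0] <-].
have -> : (fun x => t *: v x - w x) = (fun x => t *: (1 *: v x + (-1) *: (t^-1 *: w x))).
  apply/funext => x.
  by rewrite scale1r scaleN1r scalerBr scalerA mulfV ?gt_eqF// scale1r.
rewrite (H1norm_scale HOm Hmesh _ (p := p)); last by apply: Uh_lin => //; exact: Uh_scale.
rewrite gtr0_norm// mulrC ler_pM2l//.
under eq_fun do rewrite scale1r scaleN1r.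
apply: Hc; first exact: Uh_scale.
by rewrite (sum_qQ_scale Hmesh _ Hne wU) big1 ?mulr0.
Qed.

Lemma bigTheta_at_right0 (f g : R -> R) a b : 0 < a -> 0 < b -> 
  (forall t, 0 < t -> 0 <= g t) ->
  (forall t, 0 < t -> a * g t <= f t <= b * g t) -> f =Theta_(0^'+) g.
Proof.
move=> a0 b0 g0 fg; rewrite eqThetaE qualifE; apply/asboolP.
exists (a, b); first by rewrite /= a0.
near=> t; have t0 : 0 < t by [].
have /andP[f1 f2] := fg t t0; have gt0 := g0 t t0.
by rewrite /= !ger0_norm// (le_trans _ f1)// mulr_ge0// ltW.
Unshelve. all: by end_near. Qed.

Lemma qnorm_tv_Theta :
  (fun t => qnorm T (qQ T ne (fun x => t *: v x))) =Theta_(0^'+) (fun t => t ^+ 3).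
Proof.
have q0 : 0 < kap / Num.sqrt (cellV T es).
  by rewrite divr_gt0 ?sqrtr_gt0 ?cellV_gt0.
apply: (bigTheta_at_right0 q0 q0) => t t0; first by rewrite exprn_ge0// ltW.
by rewrite (qnorm_tv HOm)// gtr0_norm// mulrC lexx.
Qed.

Lemma distH1_tv_Theta :
  (fun t => distH1 Om (fun x => t *: v x) (FhQ Om T p ne)) =Theta_(0^'+) (fun t => t).
Proof.
have [c c0 Hc] := distH1_tv_ge.
have b0 : 0 < H1norm Om v.
  have := le_trans (Hc 1 ltr01) (distH1_tv_le ltr01).
  by rewrite !mulr1; exact: lt_le_trans.
apply: (bigTheta_at_right0 c0 b0) => t t0; first exact: ltW.
by rewrite Hc// distH1_tv_le.
Qed.

(** Along the direction, such a bound would read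
    [c * t <= M * t ^ (3 * theta)], which fails for small [t]. *)
Lemma no_better_exponent theta : 3^-1 < theta -> ~ local_error_bound Om T p ne theta.
Proof.
move=> th [C [delta [C0 d0 Hd]]].
have [c c0 Hc] := distH1_tv_ge.
set K := kap / Num.sqrt (cellV T es).
have K0 : 0 < K by rewrite divr_gt0 ?sqrtr_gt0 ?cellV_gt0.
have th3 : 0 < 3 * theta - 1 by rewrite subr_gt0 -ltr_pdivrMl// mulr1.
pose M := C * K `^ theta; have M0 : 0 < M by rewrite mulr_gt0// powR_gt0.
pose t := Num.min (delta / (H1norm Om v + 1)) ((c / (2 * M)) `^ (3 * theta - 1)^-1).
have t0 : 0 < t.
  rewrite lt_min divr_gt0 ?ltr_wpDl ?H1norm_ge0//=.
  by rewrite powR_gt0// divr_gt0// mulr_gt0.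
have tv : H1norm Om (fun x => t *: v x) < delta.
  rewrite (H1norm_scale HOm Hmesh _ vU) gtr0_norm//.
  have h1 : 0 < H1norm Om v + 1 by rewrite ltr_wpDl// H1norm_ge0.
  have : t <= delta / (H1norm Om v + 1) by rewrite ge_min lexx.
  rewrite ler_pdivlMr// => /lt_le_trans; apply.
  by rewrite ltr_pM2l// ltrDl.
have := le_trans (Hc t t0) (Hd _ (Uh_scale t vU) tv).
rewrite (qnorm_tv HOm)// -/kap -/K gtr0_norm//.
have t0' := ltW t0; have K0' := ltW K0.
rewrite powRM ?exprn_ge0// mulrCA [C * _]mulrC mulrA mulrC -/M.
rewrite -powR_mulrn// -powRrM.
have -> : 3%:R * theta = 1 + (3 * theta - 1) by rewrite addrC subrK.
rewrite powRD; last by rewrite (gt_eqF t0) implybT.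
rewrite powRr1// -2!mulrA ler_pM2l// [_ * C]mulrC -/M.
apply/negP; rewrite -ltNge.
have q0 : 0 <= c / (2 * M) by apply/ltW/divr_gt0 => //; exact: mulr_gt0.
have : t `^ (3 * theta - 1) <= c / (2 * M).
  have tle : t <= (c / (2 * M)) `^ (3 * theta - 1)^-1 by rewrite ge_min lexx orbT.
  have := ge0_ler_powR (ltW th3) (_ : t \in Num.nneg) (_ : _ \in Num.nneg) tle.
  rewrite -powRrM mulVf ?gt_eqF// powRr1//; apply; first by rewrite nnegrE.
  by rewrite nnegrE powR_ge0.
have cM : c / (2 * M) * M = c / 2 by field; rewrite gt_eqF.
move=> /(ler_wpM2r (ltW M0)); rewrite cM => /le_lt_trans; apply.
by lra.
Qed.

End DistanceFromConstraint.

(** * Zeros of multi-affine functions *)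

Section MultiaffineRoot.
Context {R : realType} {I : finType}.

Let multi (c : {set I} -> R) (a : I -> R) : R := \sum_(S : {set I}) c S * \prod_(i in S) a i.

Let sg (b : bool) : R := (-1) ^+ b.

Let sum_sg : \sum_(b : bool) sg b = 0.
Proof. by rewrite big_bool /sg/= expr1 expr0 addrC subrr. Qed.

Let sum_sg2 : \sum_(b : bool) sg b * sg b = 2.
Proof. by rewrite big_bool /sg/= expr1 expr0 mulrNN mulr1. Qed.

Let prod_mask (S : {set I}) (a : I -> R) :
  \prod_(i in S) a i = \prod_i (if i \in S then a i else 1).
Proof. by rewrite big_mkcond. Qed.

Let sum_vertices c r : \sum_(s : {ffun I -> bool}) multi c (fun i => sg (s i) * r) =
  2 ^+ #|I| * c finset.set0.
Proof.
rewrite /multi exchange_big/= (bigD1 finset.set0)//= [X in _ + X]big1 ?addr0.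
  rewrite -mulr_sumr mulrC; congr (_ * _).
  under eq_bigr do rewrite big_set0.
  by rewrite sumr_const card_ffun card_bool -natrX.
move=> S /finset.set0Pn[i iS]; rewrite -mulr_sumr.
under eq_bigr do rewrite prod_mask.
rewrite -(bigA_distr_bigA (fun i b => if i \in S then sg b * r else 1)) (bigD1 i)//=.
by rewrite iS -mulr_suml sum_sg !mul0r mulr0.
Qed.

Let sum_signed_vertices c r :
  \sum_(s : {ffun I -> bool}) (\prod_i sg (s i)) * multi c (fun i => sg (s i) * r) =
  2 ^+ #|I| * (c [set: I]%SET * r ^+ #|I|).
Proof.
under eq_bigr do rewrite mulr_sumr.
rewrite exchange_big/= (bigD1 [set: I]%SET)//= [X in _ + X]big1 ?addr0.
  under eq_bigr do rewrite mulrCA prod_mask -big_split/=.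
  rewrite -mulr_sumr -(bigA_distr_bigA (fun i b => sg b * (if i \in [set: I]%SET then sg b * r else 1))).
  under eq_bigr do (under eq_bigr do rewrite inE mulrA; rewrite -mulr_suml sum_sg2).
  by rewrite big_split/= !prodr_const mulrCA.
move=> S ST; have /finset.set0Pn[i] : (~: S)%SET != finset.set0.
  by apply: contraNneq ST => /(congr1 (@finset.setC I)); rewrite finset.setCK finset.setC0 => ->.
rewrite inE => iS; under eq_bigr do rewrite mulrCA prod_mask -big_split/=.
rewrite -mulr_sumr.
rewrite -(bigA_distr_bigA (fun i b => sg b * (if i \in S then sg b * r else 1))) (bigD1 i)//=.
by rewrite (negbTE iS) -mulr_suml sum_sg !mul0r mulr0.
Qed.

Let root_pos (c : {set I} -> R) r : 0 < c finset.set0 -> (0 < #|I|)%N ->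
  c finset.set0 = `|c [set: I]%SET| * r ^+ #|I| ->
  exists2 a, (forall i, `|a i| <= `|r|) & multi c a = 0.
Proof.
move=> q0 /card_gt0P[i0 _] cr; set q := c finset.set0 in q0 cr *.
pose eps : R := - Num.sg (c [set: I]%SET).
have eps1 : eps = 1 \/ eps = -1.
  have : c [set: I]%SET != 0 by apply: contraTneq q0 => g0; rewrite cr g0 normr0 mul0r ltxx.
  by rewrite /eps; case: sgrP => // _ _; [right|left; rewrite opprK].
have sgprod (s : {ffun I -> bool}) : \prod_i sg (s i) = 1 \/ \prod_i sg (s i) = -1.
  apply: (big_ind (fun x : R => x = 1 \/ x = -1)); first by left.
    move=> x y [->|->] [->|->]; rewrite ?mulr1 ?mul1r ?mulrNN ?mulr1; by [left|right].
  by move=> i _; rewrite /sg; case: (s i); [right; rewrite expr1|left].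
(* the weights [1 + eps * sign] are 0 or 2, and the weighted sum vanishes *)
have [s Ps] : exists s : {ffun I -> bool}, multi c (fun i => sg (s i) * r) <= 0.
  apply: contrapT => /forallNP H.
  have Hpos (s : {ffun I -> bool}) : 0 < multi c (fun i => sg (s i) * r) by rewrite ltNge; apply/negP; exact: H.
  have sum0 : \sum_(s : {ffun I -> bool})
      (1 + eps * \prod_i sg (s i)) * multi c (fun i => sg (s i) * r) = 0.
    under eq_bigr do rewrite mulrDl mul1r -mulrA.
    rewrite big_split/= -mulr_sumr sum_vertices sum_signed_vertices -/q cr.
    by rewrite normrEsg /eps; ring.
  have term0 (s : {ffun I -> bool}) : 1 + eps * \prod_i sg (s i) = 0.
    have ge0 (s' : {ffun I -> bool}) : true ->
        0 <= (1 + eps * \prod_i sg (s' i)) * multi c (fun i => sg (s' i) * r).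
      move=> _; apply: mulr_ge0; last exact: ltW.
      by case: eps1 => ->; case: (sgprod s') => ->; lra.
    have /eqP := psumr_eq0P ge0 sum0 (i := s) isT.
    by rewrite mulf_eq0 (gt_eqF (Hpos s)) orbF => /eqP.
  have := term0 [ffun=> false]; have := term0 [ffun i => i == i0].
  rewrite (bigD1 i0)//= !ffunE eqxx [\prod_(_ | _) _]big1 => [|i ii0]; last first.
    by rewrite ffunE (negbTE ii0).
  rewrite [\prod_i _]big1 => [|i _]; last by rewrite ffunE.
  by rewrite /sg expr1; lra.
pose g := fun t : R => multi c (fun i => t * (sg (s i) * r)).
pose pg : {poly R} := \sum_(S : {set I}) (c S * \prod_(i in S) (sg (s i) * r)) *: 'X^#|S|.
have gE : g = horner pg.
  apply/funext => t; rewrite /g /multi /pg horner_sum; apply: eq_bigr => S _.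
  by rewrite hornerZ hornerXn big_split/= prodr_const -mulrA; congr (_ * _); rewrite mulrC.
have g0 : g 0 = q.
  rewrite /g /multi (bigD1 finset.set0)//= big_set0 mulr1 big1 ?addr0// => S /finset.set0Pn[i iS].
  by rewrite (bigD1 i)//= mul0r mul0r mulr0.
have g1 : g 1 <= 0.
  suff -> : g 1 = multi c (fun i => sg (s i) * r) by [].
  by rewrite /g; congr multi; apply/funext => i; rewrite mul1r.
have [||t] := @IVT _ g 0 1 0 ler01.
- by rewrite gE; apply: continuous_subspaceT; exact: continuous_horner.
- by rewrite g0 ge_min le_max g1 (ltW q0) orbT.
rewrite in_itv/= => /andP[t0 t1] gt0; exists (fun i => t * (sg (s i) * r)) => // i.
rewrite !normrM normrX normrN1 expr1n mul1r ger0_norm//.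
by rewrite ler_piMl.
Qed.

(** On the vertices of the cube of half-width [r], the signed mean of a
    multi-affine function isolates its top coefficient and the plain mean its
    value at the origin. If these balance, some vertex value has the sign
    opposite to that at the origin, and there is a zero in between. *)
Lemma multiaffine_root (c : {set I} -> R) r : (0 < #|I|)%N -> 
  `|c finset.set0| = `|c [set: I]%SET| * r ^+ #|I| ->
  exists2 a : I -> R, (forall i, `|a i| <= `|r|) &
    \sum_(S : {set I}) c S * \prod_(i in S) a i = 0.
Proof.
move=> I0 cr; have [q0|q0|q0] := ltrgt0P (c finset.set0).
- by apply: root_pos => //; rewrite -cr gtr0_norm.
- have [||a ar am] := @root_pos (fun S => - c S) r _ I0.
  + by rewrite oppr_gt0.
  + by rewrite normrN -cr ltr0_norm.
  exists a => //; apply: oppr_inj; rewrite oppr0 -[RHS]am /multi -sumrN.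
  by apply: eq_bigr => S _; rewrite mulNr.
- exists (fun=> 0) => [i|]; first by rewrite normr0.
  rewrite (bigD1 finset.set0)//= q0 mul0r add0r big1// => S /finset.set0Pn[i iS].
  by rewrite (bigD1 i)//= mul0r mulr0.
Qed.

End MultiaffineRoot.

(** * Cell-by-cell correction *)

Section CellwiseCorrection.
Context {R : realType} {m : nat}.
Notation cV3 := 'cV[R]_3.
Variables (Om : set cV3) (T : hexes R m) (p : nat) (ne : 'I_m -> nat).
Variables (U : 'I_m -> 'I_3 -> cV3 -> cV3) (gamma : 'I_m -> R) (gamma0 : R).
Hypothesis UU : forall e i, Uh Om T p (U e i).
Hypothesis gamma0_gt0 : 0 < gamma0.
Hypothesis gamma_ge : forall e, gamma0 * cellV T e <= `|gamma e|.
Hypothesis affine : forall e u, Uh Om T p u ->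
  (exists2 c : {set 'I_3} -> R, c [set: 'I_3]%SET = gamma e &
     forall a, qQ T ne (fun x => u x + comb3 (U e) a x) e
               = \sum_(S : {set 'I_3}) c S * \prod_(i in S) a i) /\
  (forall a f, f != e -> qQ T ne (fun x => u x + comb3 (U e) a x) f = qQ T ne u f).

Lemma Uh_add u w : Uh Om T p u -> Uh Om T p w -> Uh Om T p (fun x => u x + w x).
Proof.
move=> uU wU; have := Uh_lin 1 1 uU wU.
by congr (Uh _ _ _ _); apply/funext => x; rewrite !scale1r.
Qed.

Lemma comb3E (V : 'I_3 -> cV3 -> cV3) a x :
  comb3 V a x = a 0 *: V 0 x + a 1 *: V 1 x + a 2%:R *: V 2%:R x.
Proof.
rewrite /comb3 !big_ord_recl big_ord0 addr0 addrA.
by congr (_ *: _ _ + _ *: V _ _ + _ *: V _ _); try congr (a _); apply: val_inj.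
Qed.

Lemma Uh_comb3 e a : Uh Om T p (comb3 (U e) a).
Proof.
have := Uh_add (Uh_lin (a 0) (a 1) (UU e 0) (UU e 1)) (Uh_scale (a 2%:R) (UU e 2%:R)).
by congr (Uh _ _ _ _); apply/funext => x; rewrite comb3E.
Qed.

Lemma max3_le (a : 'I_3 -> R) r : 0 <= r -> (forall i, `|a i| <= r) -> max3 a <= r.
Proof. by move=> r0 ar; apply: bigmax_le. Qed.

Lemma max3_ge0 (a : 'I_3 -> R) : 0 <= max3 a.
Proof. by rewrite /max3; apply: bigmax_ge_id. Qed.

(** The radius makes the two sides of the balance in [multiaffine_root] equal. *)
Let cell_root e u : Uh Om T p u -> exists2 a : 'I_3 -> R,
  qQ T ne (fun x => u x + comb3 (U e) a x) e = 0 &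
  max3 a ^+ 3 * (gamma0 * cellV T e) <= `|qQ T ne u e|.
Proof.
move=> uU; have [[c cg qc] _] := affine e uU.
have gV : 0 < gamma0 * cellV T e by rewrite mulr_gt0// cellV_gt0.
have g0 : 0 < `|gamma e| by rewrite (lt_le_trans gV).
have cq : c finset.set0 = qQ T ne u e.
  have -> : qQ T ne u e = qQ T ne (fun x => u x + comb3 (U e) (fun=> 0) x) e.
    congr (qQ _ _ _ _); apply/funext => x.
    by rewrite /comb3 big1 ?addr0// => i _; rewrite scale0r.
  rewrite qc (bigD1 finset.set0)//= big_set0 mulr1 big1 ?addr0// => S /finset.set0Pn[i iS].
  by rewrite (bigD1 i)//= mul0r mulr0.
pose r := (`|qQ T ne u e| / `|gamma e|) `^ 3^-1.
have r0 : 0 <= r by exact: powR_ge0.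
have r3 : r ^+ 3 = `|qQ T ne u e| / `|gamma e|.
  by rewrite -powR_mulrn// -powRrM mulVf// powRr1// divr_ge0.
have [||a ar am] := @multiaffine_root R _ c r; first by rewrite card_ord.
  by rewrite card_ord cg cq r3 mulrCA mulfV ?mulr1// gt_eqF.
exists a; first by rewrite qc.
rewrite (@le_trans _ _ (r ^+ 3 * `|gamma e|))//; last by rewrite r3 divfK// gt_eqF.
apply: ler_pM; rewrite ?exprn_ge0 ?max3_ge0// ?(ltW gV)//.
rewrite lerXn2r ?nnegrE ?max3_ge0//; apply: max3_le => // i.
by rewrite (le_trans (ar i))// ger0_norm.
Qed.

(** A correction in one cell leaves the residuals of the others unchanged, so
    the cells can be treated one after the other, each with the parameters
    dictated by its initial residual. *)
Lemma cellwise_correction u : Uh Om T p u -> exists2 a : 'I_m -> 'I_3 -> R,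
  FhQ Om T p ne (fun x => u x + \sum_e comb3 (U e) (a e) x) &
  forall e, max3 (a e) ^+ 3 * (gamma0 * cellV T e) <= `|qQ T ne u e|.
Proof.
move=> uU.
suff H (s : seq 'I_m) : uniq s -> exists a : 'I_m -> 'I_3 -> R,
  let w := fun x => u x + \sum_(e <- s) comb3 (U e) (a e) x in
  [/\ Uh Om T p w, forall e, e \in s -> qQ T ne w e = 0,
      forall e, e \notin s -> qQ T ne w e = qQ T ne u e &
      forall e, max3 (a e) ^+ 3 * (gamma0 * cellV T e) <= `|qQ T ne u e|].
  have [a [wU w0 _ am]] := H _ (index_enum_uniq _); exists a => //; split => // e.
  by apply: w0; exact: mem_index_enum.
elim: s => [_|e s IH /= /andP[es us]].
  exists (fun _ _ => 0); rewrite (_ : (fun x => _) = u); last first.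
    by apply/funext => x; rewrite big_nil addr0.
  split=> // e; rewrite (_ : max3 _ = 0) ?expr0n ?mul0r//.
  by apply/eqP; rewrite eq_le max3_ge0 andbT; apply: max3_le => // i; rewrite normr0.
have [a [wU w0 wu am]] := IH us.
have [b b0 bm] := cell_root e wU.
rewrite (wu e es) in bm; have [_ other] := affine e wU.
exists (fun f => if f == e then b else a f).
rewrite (_ : (fun x => _) = (fun x => u x + \sum_(e <- s) comb3 (U e) (a e) x
    + comb3 (U e) b x)); last first.
  apply/funext => x; rewrite big_cons eqxx [X in _ + X]addrC addrA; congr (_ + _ + _).
  apply: eq_big_seq => f fs; case: eqVneq => // fe.
  by rewrite fe (negbTE es) in fs.
split.
- by apply: Uh_add => //; exact: Uh_comb3.
- move=> f; rewrite inE; have [->//|fe /= fs] := eqVneq f e.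
  by rewrite other// w0.
- by move=> f; rewrite inE negb_or => /andP[fe fs]; rewrite other// wu.
- by move=> f; case: eqVneq => [->|].
Qed.

End CellwiseCorrection.

(** * One-dimensional cutoffs *)

Section Cutoff.
Context {R : realType}.

Lemma is_derive_quadratic (f : R -> R) (y d : R) :
  (forall t, `|f (y + t) - f y - d * t| <= t ^+ 2) -> is_derive y 1 f d.
Proof.
move=> H.
have c : h^-1 *: ((f \o shift y) (h *: 1) - f y) @[h --> 0^'] --> d.
  apply/cvgrPdist_le => e e0; near=> h.
  have h0 : h != 0 by near: h; exact: nbhs_dnbhs_neq.
  have he : `|h| <= e by near: h; exact: dnbhs0_le.
  apply: le_trans he; rewrite distrC /= /GRing.scale/= mulr1 (addrC h y).
  rewrite -(ler_pM2r (_ : 0 < `|h|)) ?normr_gt0// -normrM mulrBl mulrAC mulVf// mul1r.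
  by rewrite (le_trans (H h))// -expr2 real_normK// num_real.
apply: DeriveDef; first by apply/cvg_ex; exists d.
exact: cvg_lim c.
Unshelve. all: by end_near. Qed.

Definition ramp (y : R) : R := Num.max 0 y.

Lemma is_derive_ramp2 (y : R) : is_derive y 1 (fun y => ramp y ^+ 2) (2 * ramp y).
Proof.
apply: is_derive_quadratic => t; rewrite /ramp ler_norml.
by case: (leP 0 (y + t)) => h1; case: (leP 0 y) => h2; apply/andP; split; nra.
Qed.

(** A second difference of the squared ramp is a C1 function rising from 0, on
    the negative axis, to 1, beyond 2. *)
Definition transition (y : R) : R :=
  (ramp y ^+ 2 - 2 * ramp (y - 1) ^+ 2 + ramp (y - 2) ^+ 2) / 2.

Definition dtransition (y : R) : R := ramp y - 2 * ramp (y - 1) + ramp (y - 2).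

Lemma is_derive_transition (y : R) : is_derive y 1 transition (dtransition y).
Proof.
have d c : is_derive y 1 (fun y => ramp (y - c) ^+ 2) (2 * ramp (y - c)).
  have d1 : is_derive y 1 (fun y : R => y - c) 1.
    have -> : (fun y : R => y - c) = (id : R -> R) - cst c by [].
    by apply: is_derive_eq; rewrite subr0.
  by have := @is_derive1_comp _ (fun y => ramp y ^+ 2) (fun y => y - c) y _ _
    (is_derive_ramp2 (y - c)) d1; rewrite mulr1.
have -> : transition = 2^-1 *: ((fun y => ramp (y - 0) ^+ 2) + (-2) *: (fun y => ramp (y - 1) ^+ 2)
    + (fun y => ramp (y - 2) ^+ 2)).
  by apply/funext => x; rewrite /transition !fctE subr0 /GRing.scale/= mulrC mulNr.
have := is_deriveZ 2^-1 (is_deriveD (is_deriveD (d 0) (is_deriveZ (-2) (d 1))) (d 2)).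
congr (is_derive _ _ _ _); rewrite /dtransition subr0 /GRing.scale/=.
by field.
Qed.

Lemma transition01 y : 0 <= transition y <= 1.
Proof.
rewrite /transition /ramp.
by case: (leP 0 y) => h1; case: (leP 0 (y - 1)) => h2; case: (leP 0 (y - 2)) => h3;
  apply/andP; split; nra.
Qed.

Lemma dtransition01 y : 0 <= dtransition y <= 1.
Proof.
rewrite /dtransition /ramp.
by case: (leP 0 y) => h1; case: (leP 0 (y - 1)) => h2; case: (leP 0 (y - 2)) => h3;
  apply/andP; split; lra.
Qed.

Lemma transition_le0 y : y <= 0 -> transition y = 0 /\ dtransition y = 0.
Proof.
move=> y0; rewrite /transition /dtransition /ramp !max_l; lra.
Qed.

Lemma transition_ge2 y : 2 <= y -> transition y = 1 /\ dtransition y = 0.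
Proof.
move=> y2; rewrite /transition /dtransition /ramp !max_r; lra.
Qed.

Lemma continuous_ramp : continuous ramp.
Proof.
move=> y; apply: continuous_max; first exact: cvg_cst.
exact: cvg_id.
Qed.

Lemma continuous_dtransition : continuous dtransition.
Proof.
have cr c : continuous (fun y => ramp (y - c)).
  move=> y; apply: (@continuous_comp _ _ _ (fun y => y - c) ramp); last exact: continuous_ramp.
  by apply: cvgB; [exact: cvg_id|exact: cvg_cst].
move=> y; apply: cvgD; last exact: cr.
apply: cvgB; first exact: continuous_ramp.
by apply: cvgM; [exact: cvg_cst|exact: cr].
Qed.

Variable eps : R.
Hypothesis eps0 : 0 < eps.

(** The transition takes place where [eps <= 1 - t ^+ 2 <= 3 * eps]. *)
Definition cut (t : R) : R := transition ((1 - t ^+ 2) / eps - 1).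

Definition dcut (t : R) : R := dtransition ((1 - t ^+ 2) / eps - 1) * (- (2 * t) / eps).

Lemma is_derive_cut (t : R) : is_derive t 1 cut (dcut t).
Proof.
have d : is_derive t 1 (fun t : R => (1 - t ^+ 2) / eps - 1) (- (2 * t) / eps).
  have -> : (fun t : R => (1 - t ^+ 2) / eps - 1) =
      eps^-1 *: (cst 1 - (id : R -> R) ^+ 2) - cst 1.
    by apply/funext => x; rewrite !fctE /GRing.scale/= mulrC.
  apply: is_derive_eq.
  by rewrite /GRing.scale/= subr0 sub0r mulr1 mulrC expr1 -mulr_natl.
exact: (is_derive1_comp (is_derive_transition _) d).
Qed.

Lemma continuous_cut : continuous cut.
Proof.
move=> t; have [d _] := is_derive_cut t.
exact/differentiable_continuous/derivable1_diffP.
Qed.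

Lemma continuous_dcut : continuous dcut.
Proof.
have cp (q : {poly R}) (f : R -> R) : f = horner q -> continuous f.
  by move=> ->; exact: continuous_horner.
have c1 : continuous (fun t : R => (1 - t ^+ 2) / eps - 1).
  apply: (cp ((1 - 'X^2) * (eps^-1)%:P - 1)).
  by apply/funext => x; rewrite !hornerE.
have c2 : continuous (fun t : R => - (2 * t) / eps).
  apply: (cp (- (2%:P * 'X) * (eps^-1)%:P)).
  by apply/funext => x; rewrite !hornerE.
move=> t; apply: cvgM; last exact: c2.
exact: (@continuous_comp _ _ _ (fun t : R => (1 - t ^+ 2) / eps - 1) dtransition t (c1 t)
  (@continuous_dtransition _)).
Qed.

Lemma cut01 t : 0 <= cut t <= 1. Proof. exact: transition01. Qed.

Lemma cut_outer t : 1 - t ^+ 2 <= eps -> cut t = 0 /\ dcut t = 0.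
Proof.
move=> h; have [|c d] := @transition_le0 ((1 - t ^+ 2) / eps - 1).
  by rewrite subr_le0 ler_pdivrMr// mul1r.
by rewrite /cut /dcut c d mul0r.
Qed.

Lemma cut_inner t : 3 * eps <= 1 - t ^+ 2 -> cut t = 1 /\ dcut t = 0.
Proof.
move=> h; have [|c d] := @transition_ge2 ((1 - t ^+ 2) / eps - 1).
  rewrite lerBrDr ler_pdivlMr//; lra.
by rewrite /cut /dcut c d mul0r.
Qed.

(** The derivative of the cutoff is of order [1 / eps], but only at distance of
    order [eps] from the endpoints. *)
Lemma dcut_le t : `|t| < 1 -> `|dcut t| * (1 - `|t|) <= 6.
Proof.
move=> t1; have t0 : 0 <= 1 - `|t| by rewrite subr_ge0 ltW.
have [h|h] := leP (3 * eps) (1 - t ^+ 2).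
  by rewrite (cut_inner h).2 normr0 mul0r.
have ht : 1 - `|t| <= 3 * eps.
  by have := real_normK (num_real t); have := normr_ge0 t; move: t1; nra.
have /andP[d0 d1] := dtransition01 ((1 - t ^+ 2) / eps - 1).
have -> : 6 = 2 / eps * (3 * eps) :> R by field; rewrite gt_eqF.
apply: ler_pM => //; rewrite /dcut normrM (ger0_norm d0) -[leRHS]mul1r.
apply: ler_pM => //; rewrite normrM normrN normrM normr_nat.
rewrite (gtr0_norm (_ : 0 < eps^-1)) ?invr_gt0//; apply: ler_wpM2r; first by rewrite invr_ge0 ltW.
by rewrite -[leRHS]mulr1 ler_wpM2l// ltW.
Qed.

End Cutoff.

(** * Cutoffs of the reference cube *)

Section CubeCutoff.
Context {R : realType}.
Notation cV3 := 'cV[R]_3.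

Lemma is_diff_coord_comp (k dk : R -> R) (x : cV3) i : is_derive (x i 0) 1 k (dk (x i 0)) ->
  is_diff x (fun y : cV3 => k (y i 0)) (fun v => v i 0 * dk (x i 0)).
Proof.
move=> [d E].
have dk' : is_diff (x i 0) k (fun h => h * dk (x i 0)).
  apply: DiffDef; first exact/derivable1_diffP.
  rewrite diff1E; last exact/derivable1_diffP.
  by apply/funext => h; rewrite derive1E E.
exact: (@is_diff_comp _ _ _ _ _ _ _ _ _ (is_diff_coord3 x i) dk').
Qed.

Definition chi (eps : R) (xi : cV3) : R :=
  cut eps (xi 0 0) * cut eps (xi 1 0) * cut eps (xi 2%:R 0).

Let fac (eps : R) (j l : 'I_3) : R -> R := if l == j then dcut eps else cut eps.

Definition dchi (eps : R) (j : 'I_3) (xi : cV3) : R :=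
  fac eps j 0 (xi 0 0) * fac eps j 1 (xi 1 0) * fac eps j 2%:R (xi 2%:R 0).

Lemma is_diff_chi eps xi :
  is_diff xi (chi eps) (fun v => \sum_j v j 0 * dchi eps j xi).
Proof.
have d i := is_diff_coord_comp (i := i) (is_derive_cut eps (xi i 0)).
have -> : chi eps = (fun y : cV3 => cut eps (y 0 0)) *
  (fun y : cV3 => cut eps (y 1 0)) * (fun y : cV3 => cut eps (y 2%:R 0)) by [].
apply: (@is_diff_eq _ _ _ _ _ _ _ (is_diffM (is_diffM (d 0) (d 1)) (d 2%:R))).
apply/funext => v; rewrite sum3E /dchi /fac/= !fctE /=.
by rewrite /GRing.scale/=; ring.
Qed.

Let continuous_coord (k : R -> R) i : continuous k -> continuous (fun y : cV3 => k (y i 0)).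
Proof.
move=> ck x; apply: (@continuous_comp _ _ _ (fun y : cV3 => y i 0) k); last exact: ck.
exact: coord_continuous.
Qed.

Lemma continuous_chi eps : continuous (chi eps).
Proof.
move=> x; have c i := @continuous_coord (cut eps) i (@continuous_cut _ eps) x.
exact: (cvgM (cvgM (c 0) (c 1)) (c 2%:R)).
Qed.

Lemma continuous_dchi eps j : continuous (dchi eps j).
Proof.
move=> x.
have c i : (fun y : cV3 => fac eps j i (y i 0)) @ x --> fac eps j i (x i 0).
  apply: continuous_coord; rewrite /fac; case: ifP => _; first exact: continuous_dcut.
  exact: continuous_cut.
exact: (cvgM (cvgM (c 0) (c 1)) (c 2%:R)).
Qed.

Lemma chi01 eps xi : 0 <= chi eps xi <= 1.
Proof.
have c i := cut01 eps (xi i 0).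
have /andP[a0 a1] := c 0; have /andP[b0 b1] := c 1; have /andP[d0 d1] := c 2%:R.
apply/andP; split; first by apply: mulr_ge0 => //; exact: mulr_ge0.
by apply: mulr_ile1 => //; [exact: mulr_ge0|exact: mulr_ile1].
Qed.

Lemma chi_outer eps (xi : cV3) i : 0 < eps -> 1 - xi i 0 ^+ 2 <= eps ->
  chi eps xi = 0 /\ forall j, dchi eps j xi = 0.
Proof.
move=> e0 /(cut_outer e0)[c d].
have f0 j : fac eps j i (xi i 0) = 0 by rewrite /fac; case: ifP.
split=> [|j]; rewrite /chi /dchi.
  by clear f0 d; move: i c; apply: ord3P => ->; rewrite ?(mulr0, mul0r).
have := f0 j; clear f0 c d; move: i; apply: ord3P => ->; rewrite ?(mulr0, mul0r)//.
Qed.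

Lemma chi_inner eps (xi : cV3) : 0 < eps -> (forall i, 3 * eps <= 1 - xi i 0 ^+ 2) ->
  chi eps xi = 1 /\ forall j, dchi eps j xi = 0.
Proof.
move=> e0 h; have c i := (cut_inner e0 (h i)).1; have d i := (cut_inner e0 (h i)).2.
split=> [|j]; first by rewrite /chi !c !mulr1.
by move: j; apply: ord3P; rewrite /dchi /fac/= d ?(mulr0, mul0r).
Qed.

Lemma dchi_le eps j (xi : cV3) : `|dchi eps j xi| <= `|dcut eps (xi j 0)|.
Proof.
have c i : `|cut eps (xi i 0)| <= 1.
  by have /andP[a0 a1] := cut01 eps (xi i 0); rewrite ger0_norm.
have le1 (a b d : R) : `|b| <= 1 -> `|d| <= 1 -> `|b * d * a| <= `|a|.
  by move=> b1 d1; rewrite normrM ler_piMl// normrM mulr_ile1.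
move: j; apply: ord3P; rewrite /dchi /fac/=.
- by rewrite -mulrA mulrC; exact: le1.
- by rewrite mulrAC; exact: le1.
- exact: le1.
Qed.

(** Sequences of functions on the open reference cube that die out pointwise
    while staying bounded: all the errors committed by the cutoffs are of this
    kind, and dominated convergence applies to them. *)
Definition fading (f : nat -> cV3 -> R) : Prop :=
  [/\ forall n, continuous (f n),
      exists C, forall n xi, cubeo xi -> `|f n xi| <= C &
      forall xi, cubeo xi -> \forall n \near \oo, f n xi = 0].

Lemma fadingD f g : fading f -> fading g -> fading (fun n xi => f n xi + g n xi).
Proof.
move=> [cf [C fC] f0] [cg [D gD] g0]; split.
- by move=> n x; exact: (cvgD (cf n x) (cg n x)).
- exists (C + D) => n xi xc.
  by rewrite (le_trans (ler_normD _ _))// lerD ?fC ?gD.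
- by move=> xi xc; apply: filterS2 (f0 xi xc) (g0 xi xc) => n -> ->; rewrite addr0.
Qed.

Lemma fadingM f g : fading f -> fading g -> fading (fun n xi => f n xi * g n xi).
Proof.
move=> [cf [C fC] f0] [cg [D gD] g0]; split.
- by move=> n x; exact: (cvgM (cf n x) (cg n x)).
- exists (C * D) => n xi xc.
  by rewrite normrM ler_pM ?fC ?gD.
- by move=> xi xc; apply: filterS (f0 xi xc) => n ->; rewrite mul0r.
Qed.

Lemma fadingZ a f : fading f -> fading (fun n xi => f n xi * a).
Proof.
move=> [cf [C fC] f0]; split.
- by move=> n x; exact: (cvgM (cf n x) (cvg_cst a)).
- exists (C * `|a|) => n xi xc.
  by rewrite normrM ler_wpM2r ?fC.
- by move=> xi xc; apply: filterS (f0 xi xc) => n ->; rewrite mul0r.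
Qed.

Lemma fading_sum3 (f : 'I_3 -> nat -> cV3 -> R) : (forall i, fading (f i)) ->
  fading (fun n xi => \sum_i f i n xi).
Proof.
move=> ff; have := fadingD (fadingD (ff 0) (ff 1)) (ff 2%:R).
by congr fading; apply/funext => n; apply/funext => xi; rewrite sum3E.
Qed.

Definition width (n : nat) : R := n.+1%:R^-1.

Lemma width_gt0 n : 0 < width n. Proof. by rewrite invr_gt0. Qed.

Lemma width_small (xi : cV3) : cubeo xi ->
  \forall n \near \oo, forall i, 3 * width n <= 1 - xi i 0 ^+ 2.
Proof.
move=> xc.
have s i : 0 < (1 - xi i 0 ^+ 2) / 3.
  by rewrite divr_gt0//; have := xc i; rewrite ltr_norml => /andP[h1 h2]; nra.
have H i : \forall n \near \oo, 3 * width n <= 1 - xi i 0 ^+ 2.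
  have := near_infty_natSinv_lt (PosNum (s i)).
  by apply: filterS => n /= /ltW; rewrite ler_pdivlMr// mulrC.
apply: filterS2 (H 0) (filterI (H 1) (H 2%:R)) => n h0 [h1 h2].
by apply: ord3P.
Qed.

Lemma continuousM3 (f g : cV3 -> R) : continuous f -> continuous g ->
  continuous (fun x => f x * g x).
Proof. by move=> cf cg x; exact: (cvgM (cf x) (cg x)). Qed.

Lemma continuousD3 (f g : cV3 -> R) : continuous f -> continuous g ->
  continuous (fun x => f x + g x).
Proof. by move=> cf cg x; exact: (cvgD (cf x) (cg x)). Qed.

Lemma fading_chi N (P : cV3 -> R) : tensor_poly N P ->
  fading (fun n xi => (chi (width n) xi - 1) * P xi).
Proof.
move=> tP; have [C PC] := tensor_poly_bounded 1 tP; split.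
- move=> n; apply: (continuousM3 _ (tensor_poly_continuous tP)).
  by move=> x; exact: (cvgB (@continuous_chi (width n) x) (cvg_cst _)).
- exists C => n xi xc; rewrite normrM -[leRHS]mul1r ler_pM//.
    by have /andP[a0 a1] := chi01 (width n) xi; rewrite ler_norml; lra.
  by apply: PC => i; exact/ltW/xc.
- move=> xi xc; apply: filterS (width_small xc) => n /(chi_inner (width_gt0 n))[-> _].
  by rewrite subrr mul0r.
Qed.

(** A Lipschitz function with zero trace is bounded by the distance to the
    face, which compensates for the steepness of the cutoff. *)
Lemma fading_dchi N (P : cV3 -> R) j : tensor_poly N P ->
  (forall xi, cube xi -> ~ cubeo xi -> P xi = 0) ->
  fading (fun n xi => P xi * dchi (width n) j xi).
Proof.
move=> tP P0; split.
- move=> n; exact: (continuousM3 (tensor_poly_continuous tP) (@continuous_dchi (width n) j)).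
- have [K K0 PK] := tensor_poly_lipschitz tP.
  exists (K * 6) => n xi xc.
  (* [y] is the projection of [xi] to the nearest of the two faces normal to
     the direction [j] *)
  pose s : R := if 0 <= xi j 0 then 1 else -1.
  pose y : cV3 := xi + (s - xi j 0) *: delta_mx j 0.
  have yE i : y i 0 = if i == j then s else xi i 0.
    rewrite !mxE andbT; case: eqVneq => [->|_]; last by rewrite mulr0 addr0.
    by rewrite mulr1 addrC subrK.
  have s1 : `|s| = 1 by rewrite /s; case: ifP; rewrite ?normrN normr1.
  have yc : cube y.
    by rewrite cubeE => i; rewrite yE; case: ifP => _; [rewrite s1|exact/ltW/xc].
  have yo : ~ cubeo y by move=> /(_ j); rewrite yE eqxx s1 ltxx.
  have Pxi : `|P xi| <= K * (1 - `|xi j 0|).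
    have := PK xi y (cubeo_cube xc) yc; rewrite (P0 y yc yo) subr0 => /le_trans; apply.
    rewrite ler_wpM2l// (bigD1 j)//= big1 ?addr0 => [|i ij]; last first.
      by rewrite yE (negbTE ij) subrr normr0.
    rewrite yE eqxx /s; have := xc j; rewrite ltr_norml => /andP[l1 l2].
    case: ifP => [h|/negbT]; first by rewrite distrC (ger0_norm h) ger0_norm; lra.
    by rewrite -ltNge => h; rewrite (ltr0_norm h) !opprK ger0_norm; lra.
  rewrite normrM (le_trans (ler_pM _ _ Pxi (dchi_le (width n) j xi)))//.
  rewrite -mulrA ler_wpM2l// mulrC; apply: dcut_le; first exact: width_gt0.
  exact: xc.
- move=> xi xc; apply: filterS (width_small xc) => n /(chi_inner (width_gt0 n))[_ ->].
  by rewrite mulr0.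
Qed.

End CubeCutoff.

(** * Fields supported in one cell belong to H^1_0 *)

Section CellFieldH10.
Context {R : realType} {m : nat}.
Notation cV3 := 'cV[R]_3.
Notation mR := (measurableTypeR R).
Notation R3 := (mR * mR * mR)%type.
Variables (Om : set cV3) (T : hexes R m) (p : nat) (e : 'I_m).
Hypotheses (HOm : bounded_lipschitz_domain Om) (Hmesh : conforming_mesh Om T).

Lemma tame_on_cell_continuous (F : cV3 -> R) C : continuous F ->
  (forall xi, cubeo xi -> `|F xi| <= C) -> tame (on_cell T e F).
Proof.
move=> cF FC.
suff tf : tame (fun xi => F xi * \1_cubeo xi).
  by rewrite on_cell_comp; apply: (tame_affine _ _ tf); rewrite unitmx_inv hexA_unit.
apply: (@tame_indic _ _ _ (Num.max 1 C)).
- exact: measurable_open3 (@open_cubeo R).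
- by move=> x xc i; rewrite le_max (ltW (xc i)).
- by move=> x /FC h; rewrite le_max h orbT.
- exact: measurable_continuous3.
Qed.

Lemma fading_tame (H : nat -> cV3 -> R) n : fading H -> tame (on_cell T e (H n)).
Proof.
by move=> [cH [C HC] _]; apply: (@tame_on_cell_continuous _ C) => // xi; exact: HC.
Qed.

Lemma fading_integ (H : nat -> cV3 -> R) : fading H ->
  integ (on_cell T e (H n)) @[n --> \oo] --> (0 : R).
Proof.
move=> fH; have [cH [C HC] H0] := fH; have [B cB] := cell_in_box T e.
rewrite -[X in _ --> X]integ0.
apply: (@integ_cvg _ _ _ set0 (Num.max B `|C|)).
- by move=> n; exact: fading_tame.
- exact: tame0.
- by split; rewrite ?preimage_set0 ?measure0.
- move=> x _; case: (pselect (cello T e x)) => [xo|xo].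
    apply/cvgrPdist_le => r r0; apply: filterS (H0 _ xo) => n /= H0n.
    by rewrite on_cellE// H0n subrr normr0 ltW.
  under eq_fun do rewrite on_cell0//; exact: cvg_cst.
- move=> n x; case: (pselect (cello T e x)) => [xo|xo].
    rewrite on_cellE// le_max (le_trans (HC _ _ xo) (ler_norm C)) orbT; split=> // _.
    by apply: (@in_boxW _ B); [rewrite le_max lexx|exact/cB/cello_cell].
  by rewrite on_cell0// eqxx normr0 le_max normr_ge0 orbT.
Qed.

Lemma is_diff_cellXinv (F : cV3 -> R) (D : 'I_3 -> R) x :
  is_diff (cellXinv T e x) F (fun v => \sum_j v j 0 * D j) ->
  is_diff x (F \o cellXinv T e) (fun v => \sum_j (invmx (hexA T e) *m v) j 0 * D j).
Proof.
move=> dF.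
have -> : F \o cellXinv T e = F \o (fun y => - (invmx (hexA T e) *m hexb T e) + invmx (hexA T e) *m y).
  by apply/funext => y /=; rewrite cellXinvE.
rewrite cellXinvE in dF.
exact: (is_diff_comp (is_diff_affine (invmx (hexA T e)) (- (invmx (hexA T e) *m hexb T e)) x) dF).
Qed.

Lemma compact_cell : compact (cell T e).
Proof.
apply: continuous_compact; first exact/continuous_subspaceT/continuous_cellX.
have -> : (cube : set cV3) = trmx @` [set v : 'rV[R]_3 | forall i, `[-1, 1]%classic (v ord0 i)].
  apply/seteqP; split => [x xc|_ [v vc <-] i].
    by exists x^T; rewrite ?trmxK// => i /=; rewrite mxE in_itv/=; exact: xc.
  by have := vc i; rewrite /= in_itv/= mxE.
apply: continuous_compact; last first.
  exact: (@rV_compact R 3 (fun=> `[-1, 1]%classic) (fun=> @segment_compact _ _ _)).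
apply: continuous_subspaceT; apply: continuous_mx => i j.
have -> : (fun v : 'rV[R]_3 => v^T i j) = (fun v => v 0 i).
  by apply/funext => v; rewrite mxE (ord1 j).
exact: coord_continuous.
Qed.

Variables (z : cV3 -> cV3) (P : 'I_m -> 'I_3 -> cV3 -> R) (J : 'I_m -> cV3 -> 'M[R]_3).
Hypotheses (zU : Uh Om T p z) (zPJ : pieces T p z P J).
Hypothesis z0 : forall x, ~ cello T e x -> z x = 0.

(** The pointwise gradient, set to zero outside the open cell. *)
Definition weak_gradient (x : cV3) : 'M[R]_3 :=
  \matrix_(i, j) on_cell T e (fun xi => cgrad T J e xi i j) x.

Let M := invmx (hexA T e).

Let tP i : tensor_poly p.+1 (P e i). Proof. by have [] := zPJ. Qed.
Let tJ i j : tensor_poly p.+1 (fun xi => J e xi i j). Proof. by have [] := zPJ. Qed.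

Let P0 i xi : cube xi -> ~ cubeo xi -> P e i xi = 0.
Proof.
move=> xc nxo; have [_ _ _ <-//] := zPJ; rewrite z0 ?mxE//.
by rewrite /cello /preimage/= cellXK.
Qed.

Let zE x i : z x i 0 = on_cell T e (P e i) x.
Proof.
case: (pselect (cello T e x)) => [xo|xo]; last by rewrite on_cell0// z0// mxE.
have [_ _ _ zP] := zPJ; rewrite on_cellE// -zP ?cellXinvK//; exact: cubeo_cube.
Qed.

Let phi (n : nat) (x : cV3) : cV3 :=
  \col_i (chi (width n) (cellXinv T e x) * P e i (cellXinv T e x)).

Let dphi (n : nat) (xi : cV3) : 'M[R]_3 :=
  \matrix_(i, j) (chi (width n) xi * J e xi i j + P e i xi * dchi (width n) j xi).

Let is_diff_phi n i x : is_diff x (fun y => phi n y i 0)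
  (fun v => \sum_j (M *m v) j 0 * dphi n (cellXinv T e x) i j).
Proof.
have [_ _ dP _] := zPJ.
have -> : (fun y => phi n y i 0) = (chi (width n) * P e i) \o cellXinv T e.
  by apply/funext => y; rewrite mxE.
apply: is_diff_cellXinv; move: (cellXinv T e x) => xi.
apply: (is_diff_eq (is_diffM (is_diff_chi (width n) xi) (dP e i xi))).
apply/funext => v; rewrite !fctE /GRing.scale/= !mulr_sumr -big_split/=.
by apply: eq_bigr => j _; rewrite mxE; ring.
Qed.

Let Dmx_phi n x : Dmx (phi n) x = dphi n (cellXinv T e x) *m M.
Proof.
apply/matrixP => i k; rewrite !mxE.
have [_ ->] := derive_of_is_diff (delta_mx k 0) (is_diff_phi n i x).
apply: eq_bigr => j _; rewrite mulrC; congr (_ * _).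
rewrite mxE (bigD1 k)//= mxE !eqxx mulr1 big1 ?addr0// => l lk.
by rewrite mxE (negbTE lk) mulr0.
Qed.

Let differentiable_phi n x : differentiable (phi n) x.
Proof.
pose comp i := ( *:%R^~ (delta_mx i 0 : cV3)) \o (fun y => phi n y i 0).
have -> : phi n = comp 0 + comp 1 + comp 2%:R.
  apply/funext => y; rewrite !fctE /comp /=; apply: cV3P; rewrite !mxE/=;
    by rewrite ?(mulr1, mulr0, addr0, add0r).
have d i : differentiable (comp i) x.
  apply: differentiable_comp; first by have [] := is_diff_phi n i x.
  by have [] := is_diff_scalel (phi n x i 0) (delta_mx i 0 : cV3).
exact: (differentiableD (differentiableD (d 0) (d 1)) (d 2%:R)).
Qed.

Let continuous_Dmx_phi n : continuous (Dmx (phi n)).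
Proof.
apply: continuous_mx => i k x.
have -> : (fun x => Dmx (phi n) x i k) = (fun xi => \sum_j dphi n xi i j * M j k) \o cellXinv T e.
  by apply/funext => y; rewrite Dmx_phi mxE.
apply: continuous_comp; first exact: continuous_cellXinv.
have c j : continuous (fun xi => dphi n xi i j * M j k).
  apply: continuousM3; last exact: cst_continuous.
  have -> : (fun xi => dphi n xi i j) = (fun xi =>
      chi (width n) xi * J e xi i j + P e i xi * dchi (width n) j xi).
    by apply/funext => y; rewrite mxE.
  apply: continuousD3; apply: continuousM3.
  - exact: continuous_chi.
  - exact: tensor_poly_continuous (tJ i j).
  - exact: tensor_poly_continuous (tP i).
  - exact: continuous_dchi.
have -> : (fun xi => \sum_j dphi n xi i j * M j k) = (fun xi => dphi n xi i 0 * M 0 k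
   + dphi n xi i 1 * M 1 k + dphi n xi i 2%:R * M 2%:R k).
  by apply/funext => y; rewrite sum3E.
exact: (continuousD3 (continuousD3 (c 0) (c 1)) (c 2%:R)).
Qed.

Let core n : set cV3 := [set x | forall i, width n <= 1 - cellXinv T e x i 0 ^+ 2].

Let core_cello n : core n `<=` cello T e.
Proof.
move=> x xK i; have := lt_le_trans (@width_gt0 R n) (xK i).
by rewrite subr_gt0 -real_normK ?num_real// expr_lt1.
Qed.

Let closed_core n : closed (core n).
Proof.
have -> : core n = \bigcap_(i in [set: 'I_3])
    [set x | width n <= 1 - cellXinv T e x i 0 ^+ 2].
  by apply/seteqP; split => x h i; [move=> _; exact: h|exact: (h i I)].
apply: closed_bigI => i _.
apply: (@closed_comp _ _ (fun x => 1 - cellXinv T e x i 0 ^+ 2) [set t | width n <= t]); last exact: closed_ge.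
move=> x _.
have c : (fun y => cellXinv T e y i 0) @ x --> cellXinv T e x i 0.
  apply: (@continuous_comp _ _ _ (cellXinv T e) (fun y : cV3 => y i 0)).
    exact: continuous_cellXinv.
  exact: coord_continuous.
have -> : (fun x => 1 - cellXinv T e x i 0 ^+ 2) = (fun x => 1 - cellXinv T e x i 0 * cellXinv T e x i 0).
  by apply/funext => y; rewrite expr2.
exact: (cvgB (cvg_cst _) (cvgM c c)).
Qed.

Let phi_support n : closure [set x | phi n x != 0] `<=` core n.
Proof.
suff /closure_subset : [set x | phi n x != 0] `<=` core n.
  by have <- := (closure_id (core n)).1 (@closed_core n).
move=> x /= /eqP phx i; rewrite leNgt; apply/negP => /ltW.
move=> /(chi_outer (@width_gt0 R n))[c _]; apply: phx.
by apply/matrixP => k l; rewrite !mxE c mul0r.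
Qed.

Let C1c_phi n : C1c Om (phi n).
Proof.
split; [exact: differentiable_phi|exact: continuous_Dmx_phi| |].
- apply: (@subclosed_compact _ _ (cell T e)); [exact: closed_closure|exact: compact_cell|].
  by move=> x /phi_support /core_cello /cello_cell.
- by move=> x /phi_support /core_cello; exact: (cello_Om HOm Hmesh).
Qed.

Let err (n : nat) (xi : cV3) : R :=
  \sum_i ((chi (width n) xi - 1) * P e i xi) * ((chi (width n) xi - 1) * P e i xi) +
  \sum_i \sum_k (\sum_j ((chi (width n) xi - 1) * J e xi i j + P e i xi * dchi (width n) j xi) * M j k)
    * (\sum_j ((chi (width n) xi - 1) * J e xi i j + P e i xi * dchi (width n) j xi) * M j k).

Let fading_err : fading err.
Proof.
apply: fadingD.
  by apply: fading_sum3 => i; apply: fadingM; exact: fading_chi.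
apply: fading_sum3 => i; apply: fading_sum3 => k.
have h : fading (fun n xi => \sum_j ((chi (width n) xi - 1) * J e xi i j
    + P e i xi * dchi (width n) j xi) * M j k).
  apply: fading_sum3 => j; apply: fadingZ; apply: fadingD; first exact: fading_chi.
  by apply: fading_dchi => //; exact: P0.
exact: fadingM.
Qed.

Let errE n x : frob2 (phi n x - z x) + frob2 (Dmx (phi n) x - weak_gradient x) =
  on_cell T e (err n) x.
Proof.
rewrite frob2_cV Dmx_phi; case: (pselect (cello T e x)) => [xo|xo].
  rewrite on_cellE// /err; congr (_ + _).
    apply: eq_bigr => i _; rewrite !mxE zE on_cellE//; move: (cellXinv T e x) => xi; ring.
  apply: eq_bigr => i _; apply: eq_bigr => k _; rewrite -expr2; congr (_ ^+ 2).
  rewrite !mxE on_cellE// /cgrad mxE -sumrB; apply: eq_bigr => j _.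
  rewrite mxE; move: (cellXinv T e x) => xi; rewrite -/M; ring.
rewrite on_cell0//.
have [i xi] : exists i, 1 - cellXinv T e x i 0 ^+ 2 <= width n.
  apply: contrapT => /forallNP h; apply: xo; apply: (@core_cello n) => i.
  by rewrite leNgt; apply/negP => /ltW; exact: h.
have [c d] := chi_outer (@width_gt0 R n) xi.
rewrite big1 ?add0r => [|k _]; last by rewrite !mxE c z0// mul0r mxE subrr expr0n.
rewrite /frob2 big1// => k _; rewrite big1// => l _; rewrite !mxE on_cell0// subr0 big1 ?expr0n// => j _.
by rewrite mxE c d mul0r mulr0 addr0 mul0r.
Qed.

(** A discrete field supported in one cell lies in H^1_0: multiplying it by
    smooth cutoffs of the cell yields test fields, and the gradient of the
    cutoff, large only near the boundary, is tamed there by the zero trace. *)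
Lemma cell_field_H10 : H10 Om z weak_gradient.
Proof.
split.
- move=> i; apply: measurable_funTS.
  by have [] := tame_Uh Hmesh zU zPJ i.
- move=> i j; apply: measurable_funTS.
  have [h _] := tame_on_cell T e (tensor_poly_cgrad zPJ e i j).
  by apply: eq_measurable_fun h => x _ /=; rewrite mxE.
- exists phi; first exact: C1c_phi.
  rewrite (_ : (fun k => _) = (fun k => (integ (on_cell T e (err k)))%:E)).
    apply: cvg_EFin; first by apply: nearW.
    exact: fading_integ.
  apply/funext => k.
  have ti := tame_integrable (fading_tame k fading_err).
  rewrite integE fineK ?integrable_fin_num// integral_mkcond.
  apply: eq_integral => x _; rewrite /patch; case: ifPn => xO; first by rewrite errE.
  rewrite on_cell0// => /(cello_Om HOm Hmesh) xOm.
  by move/negP: xO; apply; rewrite inE.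
Qed.

End CellFieldH10.

(** * The upper bound with exponent one third *)

Section GlobalBound.
Context {R : realType} {m : nat}.
Notation cV3 := 'cV[R]_3.
Variables (Om : set cV3) (T : hexes R m) (p : nat).
Hypotheses (HOm : bounded_lipschitz_domain Om) (Hmesh : conforming_mesh Om T).

Lemma vol_Om : vol Om = \sum_e cellV T e.
Proof.
have [_ oOm _ _ _] := HOm.
have -> : vol Om = int3 Om (fun=> 1).
  rewrite /vol /int3 Rintegral_cst ?mul1r//; exact: measurable_open3.
have t1 : tensor_poly 1 (fun _ : cV3 => 1 : R) by exact: tensor_poly_cst.
rewrite (int3_Om_cells HOm Hmesh (F := fun _ _ => 1) (fun _ => t1))//.
by apply: eq_bigr => e _; rewrite int3_cube_cst1 cellVE mulrC.
Qed.

Section OneCell.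
Variables (e : 'I_m) (z : cV3 -> cV3).
Variables (P : 'I_m -> 'I_3 -> cV3 -> R) (J : 'I_m -> cV3 -> 'M[R]_3).
Hypotheses (zU : Uh Om T p z) (zPJ : pieces T p z P J).
Hypothesis z0 : forall x, ~ cello T e x -> z x = 0.
Variables (CP B : R).
Hypothesis poincare : poincare_constant Om CP.
Hypothesis gradB : Num.sqrt (int3 (cell T e) (fun x => frob2 (Dmx z x))) <= B.

Let tP : tensor_poly (p.+1 + p.+1).-1 (fun xi => \sum_i P e i xi ^+ 2).
Proof. by have [tP _ _ _] := zPJ; apply: tensor_poly_sum => i _; exact: tensor_poly_sqr. Qed.

Let tG : tensor_poly (p.+1 + p.+1).-1 (fun xi => frob2 (cgrad T J e xi)).
Proof.
apply: tensor_poly_sum => i _; apply: tensor_poly_sum => k _.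
exact: tensor_poly_sqr (tensor_poly_cgrad zPJ e i k).
Qed.

Let L2_field : int3 Om (fun x => frob2 (z x)) =
  \det (hexA T e) * int3 cube (fun xi => \sum_i P e i xi ^+ 2).
Proof.
apply: (int3_one_cell tP); first exact: (cello_Om HOm Hmesh).
- move=> x xo; rewrite frob2_cV; apply: eq_bigr => i _.
  have [_ _ _ <-] := zPJ; last exact: cubeo_cube.
  by rewrite cellXinvK.
- by move=> x _ _ xo; rewrite z0// frob2_cV big1// => i _; rewrite mxE expr0n.
Qed.

Let L2_weak_gradient : int3 Om (fun x => frob2 (weak_gradient T e J x)) =
  \det (hexA T e) * int3 cube (fun xi => frob2 (cgrad T J e xi)).
Proof.
apply: (int3_one_cell tG); first exact: (cello_Om HOm Hmesh).
- move=> x xo; apply: eq_bigr => i _; apply: eq_bigr => k _.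
  by rewrite mxE on_cellE.
- move=> x _ _ xo; rewrite /frob2 big1// => i _; rewrite big1// => k _.
  by rewrite mxE on_cell0// expr0n.
Qed.

Let L2_gradient : int3 (cell T e) (fun x => frob2 (Dmx z x)) =
  \det (hexA T e) * int3 cube (fun xi => frob2 (cgrad T J e xi)).
Proof.
apply: (int3_one_cell tG); first exact: cello_cell.
- by move=> x xo; rewrite (pieces_Dmx zPJ xo).
- by move=> x xc nx xo; exfalso; apply: nx; exists e.
Qed.

Let int3_sqr_ge0 (F : cV3 -> R) : (forall x, 0 <= F x) -> 0 <= \det (hexA T e) * int3 cube F.
Proof.
move=> F0; apply: mulr_ge0; first exact/ltW/hexA_det.
by rewrite int3E; apply: integ_ge0 => x; rewrite mulr_ge0// indicE.
Qed.

(** The correction lives in one cell, where the Poincare inequality on the whole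
    domain bounds its L2 norm by that of its gradient. *)
Lemma one_cell_energy_le :
  \det (hexA T e) * int3 cube (energy T P J e) <= (1 + CP ^+ 2) * B ^+ 2.
Proof.
set N0 := int3 Om (fun x => frob2 (z x)).
set N1 := int3 Om (fun x => frob2 (weak_gradient T e J x)).
have N1_ge0 : 0 <= N1.
  by rewrite /N1 L2_weak_gradient; apply: int3_sqr_ge0 => x; exact: frob2_ge0.
have N0_ge0 : 0 <= N0.
  rewrite /N0 L2_field; apply: int3_sqr_ge0 => x; apply: sumr_ge0 => i _; exact: sqr_ge0.
have sqr_le (a b : R) : 0 <= a -> a <= b -> a ^+ 2 <= b ^+ 2 by nra.
have N01 : N0 <= CP ^+ 2 * N1.
  have := poincare (cell_field_H10 HOm Hmesh zU zPJ z0); rewrite -/N0 -/N1.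
  move=> /(sqr_le _ _ (sqrtr_ge0 _)); by rewrite exprMn !sqr_sqrtr.
have N1B : N1 <= B ^+ 2.
  have := gradB; rewrite L2_gradient -L2_weak_gradient -/N1.
  by move=> /(sqr_le _ _ (sqrtr_ge0 _)); rewrite sqr_sqrtr.
have -> : \det (hexA T e) * int3 cube (energy T P J e) = N0 + N1.
  rewrite /N0 /N1 L2_field L2_weak_gradient -mulrDr; congr (_ * _).
  rewrite !int3E -integD; [|exact: tame_cube tP|exact: tame_cube tG].
  by congr integ; apply/funext => x; rewrite -mulrDl.
have := sqr_ge0 CP; nra.
Qed.

End OneCell.

(** Jensen's inequality for the cube, with weights: sum the tangent line
    inequality [y ^+ 3 >= s ^+ 3 + 3 * s ^+ 2 * (y - s)] at the mean [s]. *)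
Lemma jensen_cube (I : finType) (V y : I -> R) :
  (forall i, 0 < V i) -> (forall i, 0 <= y i) ->
  (\sum_i V i * y i) ^+ 3 <= (\sum_i V i) ^+ 2 * \sum_i V i * y i ^+ 3.
Proof.
move=> V0 y0; set S := \sum_i V i * y i; set W := \sum_i V i.
have W0 : 0 <= W by apply: sumr_ge0 => i _; exact: ltW.
have S0 : 0 <= S by apply: sumr_ge0 => i _; rewrite mulr_ge0// ltW.
move: W0; rewrite le_eqVlt => /predU1P[W0|W0].
  have V0' i : V i = 0 by apply: (psumr_eq0P _ (esym W0)) => // j _; exact: ltW.
  by rewrite /S big1 => [|i _]; rewrite ?V0' ?mul0r// expr0n -W0 expr0n mul0r.
pose s := S / W; have SE : S = s * W by rewrite /s divfK// gt_eqF.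
have s0 : 0 <= s by rewrite divr_ge0// ltW.
have tangent : \sum_i V i * (s ^+ 3 + 3 * s ^+ 2 * (y i - s)) <= \sum_i V i * y i ^+ 3.
  apply: ler_sum => i _; rewrite ler_pM2l// -subr_ge0.
  have -> : y i ^+ 3 - (s ^+ 3 + 3 * s ^+ 2 * (y i - s)) = (y i - s) ^+ 2 * (y i + 2 * s) by ring.
  by rewrite mulr_ge0 ?sqr_ge0// addr_ge0// mulr_ge0.
have LE : \sum_i V i * (s ^+ 3 + 3 * s ^+ 2 * (y i - s)) = W * s ^+ 3.
  transitivity (\sum_i (V i * (s ^+ 3 - 3 * s ^+ 3) + 3 * s ^+ 2 * (V i * y i))).
    by apply: eq_bigr => i _; ring.
  by rewrite big_split/= -mulr_suml -mulr_sumr -/W -/S SE; ring.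
rewrite LE in tangent.
have -> : S ^+ 3 = W ^+ 2 * (W * s ^+ 3) by rewrite SE; ring.
by rewrite ler_wpM2l// sqr_ge0.
Qed.

Lemma powR_third_le (x a : R) : 0 <= x -> 0 <= a -> x ^+ 3 <= a -> x <= a `^ 3^-1.
Proof.
move=> x0 a0 xa; have := ge0_ler_powR (_ : 0 <= 3^-1 :> R) _ _ xa.
rewrite -powR_mulrn// -powRrM mulfV// powRr1//; apply; rewrite ?invr_ge0//.
by rewrite nnegrE powR_ge0.
Qed.

Variables (ne : 'I_m -> nat).
Variables (U : 'I_m -> 'I_3 -> cV3 -> cV3) (gamma : 'I_m -> R) (gamma0 L2 CP : R).
Hypothesis UU : forall e i, Uh Om T p (U e i).
Hypothesis U0 : forall e i x, ~ (cell T e)° x -> U e i x = 0.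
Hypothesis gamma0_gt0 : 0 < gamma0.
Hypothesis L2_gt0 : 0 < L2.
Hypothesis gamma_ge : forall e, gamma0 * cellV T e <= `|gamma e|.
Hypothesis affine : forall e u, Uh Om T p u ->
  (exists2 c : {set 'I_3} -> R, c [set: 'I_3]%SET = gamma e &
     forall a, qQ T ne (fun x => u x + comb3 (U e) a x) e
               = \sum_(S : {set 'I_3}) c S * \prod_(i in S) a i) /\
  (forall a f, f != e -> qQ T ne (fun x => u x + comb3 (U e) a x) f = qQ T ne u f).
Hypothesis gradL2 : forall e a,
  Num.sqrt (int3 (cell T e) (fun x => frob2 (Dmx (comb3 (U e) a) x)))
    <= L2 * Num.sqrt (cellV T e) * max3 a.
Hypothesis poincare : poincare_constant Om CP.

Lemma Uh_0 : Uh Om T p (fun=> 0).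
Proof.
split=> // [|e i]; first exact: cst_continuous.
exists (fun _ _ _ => 0) => xi _; rewrite mxE; symmetry.
by do 3 (apply: big1 => ? _); rewrite !mul0r.
Qed.

Let comb0 e a x : ~ cello T e x -> comb3 (U e) a x = 0.
Proof.
by rewrite -interior_cell => nx; rewrite /comb3 big1// => i _; rewrite U0// scaler0.
Qed.

Section Correction.
Variable a : 'I_m -> 'I_3 -> R.

Let z_cello e x : cello T e x ->
  \sum_f comb3 (U f) (a f) x = comb3 (U e) (a e) x.
Proof.
move=> xo; rewrite (bigD1 e)//= big1 ?addr0// => f fe; apply: comb0 => xf.
have := cello_cell_disjoint Hmesh fe => /seteqP[/(_ x) + _]; apply; split => //.
exact: cello_cell.
Qed.

Lemma Uh_correction : Uh Om T p (fun x => \sum_e comb3 (U e) (a e) x).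
Proof.
elim: (index_enum _) => [|e s IH].
  rewrite (_ : (fun x => _) = fun=> 0); first exact: Uh_0.
  by apply/funext => x; rewrite big_nil.
have := Uh_add (Uh_comb3 UU e (a e)) IH.
by congr (Uh _ _ _ _); apply/funext => x; rewrite big_cons.
Qed.

Lemma correction_norm_le : H1norm Om (fun x => \sum_e comb3 (U e) (a e) x) <=
  Num.sqrt ((1 + CP ^+ 2) * L2 ^+ 2 * \sum_e cellV T e * max3 (a e) ^+ 2).
Proof.
have [P [J zPJ]] := Uh_pieces Uh_correction.
rewrite (H1norm_sqrE HOm Hmesh zPJ) ler_wsqrtr// mulr_sumr; apply: ler_sum => e _.
have eU := Uh_comb3 UU e (a e); have [P' [J' ePJ]] := Uh_pieces eU.
have -> : int3 cube (energy T P J e) = int3 cube (energy T P' J' e).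
  apply: (int3_off_null (null3_cube_boundary (R := R))) => // xi nb xc.
  have xo : cello T e (cellX T e xi).
    rewrite /cello /preimage /= cellXK; apply: contrapT => nxo; exact: nb.
  rewrite -(cellXK T e xi) -(energyE zPJ xo) -(energyE ePJ xo) (z_cello xo); congr (_ + frob2 _).
  apply/matrixP => i k; rewrite !mxE; apply: near_eq_derive.
  have : nbhs (cellX T e xi) (cello T e) by apply: open_nbhs_nbhs; split => //; exact: open_cello.
  by apply: filterS => y /z_cello ->.
apply: (le_trans (one_cell_energy_le eU ePJ _ poincare (gradL2 e (a e)))).
  by move=> x; exact: comb0.
rewrite !exprMn sqr_sqrtr; last exact/ltW/cellV_gt0.
by rewrite !mulrA.
Qed.

End Correction.

(** Write [S] for the sum of [V_e * max3 (a e) ^+ 2]. Jensen's inequality bounds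
    [S ^+ 3] by the square of the volume times the sum of
    [V_e * max3 (a e) ^+ 6], and the size of the corrections bounds the latter
    by the squared residual norm over [gamma0 ^+ 2]. *)
Lemma distance_le u : Uh Om T p u -> distH1 Om u (FhQ Om T p ne) <=
  Num.sqrt (1 + CP ^+ 2) * L2 * gamma0 `^ (- 3^-1) * vol Om `^ 3^-1
    * qnorm T (qQ T ne u) `^ 3^-1.
Proof.
move=> uU; have [a wF am] := cellwise_correction UU gamma0_gt0 gamma_ge affine uU.
have V0 e : 0 < cellV T e by exact: cellV_gt0.
set Q := qnorm T (qQ T ne u); have Q0 : 0 <= Q by exact: sqrtr_ge0.
have W0 : 0 <= vol Om by rewrite vol_Om; apply: sumr_ge0 => e _; exact: ltW.
set S := \sum_e cellV T e * max3 (a e) ^+ 2.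
have S0 : 0 <= S by apply: sumr_ge0 => e _; rewrite mulr_ge0 ?sqr_ge0// ltW.
apply: le_trans (_ : Num.sqrt ((1 + CP ^+ 2) * L2 ^+ 2 * S) <= _).
  apply: le_trans (distH1_le _ wF) _.
  apply: le_trans (correction_norm_le a).
  rewrite (_ : (fun x => _) = fun x => (-1) *: \sum_e comb3 (U e) (a e) x).
    by rewrite (H1norm_scale HOm Hmesh _ (Uh_correction a)) normrN1 mul1r.
  by apply/funext => x; rewrite opprD addNKr scaleN1r.
have -> : Num.sqrt ((1 + CP ^+ 2) * L2 ^+ 2 * S) = Num.sqrt (1 + CP ^+ 2) * L2 * Num.sqrt S.
  have c0 : 0 <= 1 + CP ^+ 2 by rewrite addr_ge0// sqr_ge0.
  have cL : 0 <= (1 + CP ^+ 2) * L2 ^+ 2 by rewrite mulr_ge0// sqr_ge0.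
  by rewrite (sqrtrM _ cL) (sqrtrM _ c0) sqrtr_sqr gtr0_norm.
rewrite -!mulrA !ler_wpM2l ?sqrtr_ge0 ?(ltW L2_gt0)//.
have -> : gamma0 `^ (- 3^-1) * (vol Om `^ 3^-1 * Q `^ 3^-1) = (gamma0^-1 * (vol Om * Q)) `^ 3^-1.
  by rewrite !powRM ?mulr_ge0 ?invr_ge0 ?(ltW gamma0_gt0)// -(powR_inv1 (ltW gamma0_gt0)) -powRrM mulN1r.
apply: powR_third_le; rewrite ?sqrtr_ge0 ?mulr_ge0 ?invr_ge0 ?(ltW gamma0_gt0)//.
have B0 : 0 <= gamma0^-1 * (vol Om * Q) by rewrite !mulr_ge0// invr_ge0 ltW.
suff : Num.sqrt S ^+ 3 ^+ 2 <= (gamma0^-1 * (vol Om * Q)) ^+ 2.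
  by rewrite ler_pXn2r ?nnegrE// exprn_ge0// sqrtr_ge0.
rewrite -exprM mulnC exprM sqr_sqrtr//.
apply: le_trans (jensen_cube V0 (fun e => sqr_ge0 (max3 (a e)))) _.
rewrite -vol_Om !exprMn [leRHS]mulrCA ler_wpM2l ?sqr_ge0//.
rewrite /Q /qnorm sqr_sqrtr; last first.
  by apply: sumr_ge0 => e _; rewrite divr_ge0 ?sqr_ge0// ltW.
rewrite mulr_sumr; apply: ler_sum => e _.
have := am e; set M := max3 (a e) => Mq.
have M0 : 0 <= M by exact: max3_ge0.
have gV : 0 < gamma0 * cellV T e by rewrite mulr_gt0.
have : (M ^+ 3 * (gamma0 * cellV T e)) ^+ 2 <= qQ T ne u e ^+ 2.
  rewrite -[leRHS]real_normK ?num_real// lerXn2r ?nnegrE//.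
  by rewrite mulr_ge0 ?exprn_ge0// ltW.
have c0 : 0 <= gamma0^-1 ^+ 2 / cellV T e by rewrite divr_ge0 ?sqr_ge0// ltW.
move=> /(ler_wpM2r c0); rewrite [leRHS]mulrCA; congr (_ <= _).
by field; rewrite !gt_eqF.
Qed.

End GlobalBound.

(** * Optimality of the exponent *)

Theorem corollary5 (R : realType) (m : nat) (Om : set 'cV[R]_3)
    (T : hexes R m) (p : nat) (ne : 'I_m -> nat) (es : 'I_m)
    (HOm : bounded_lipschitz_domain Om)
    (Hmesh : conforming_mesh Om T)
    (Hconn : face_connected T)
    (Hcompat : facets_compatible Om T p)
    (Hp : (3 <= p)%N)
    (Hne : forall e, (p + 1 <= ne e)%N)
    (Hes : (2 * ne es < 3 * p)%N) :
  let tv := fun (t : R) (x : 'cV[R]_3) => t *: dirv T p (ne es) es x in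
  [/\ (fun t => qnorm T (qQ T ne (tv t))) =Theta_(0^'+) (fun t => t ^+ 3),
      (fun t => distH1 Om (tv t) (FhQ Om T p ne)) =Theta_(0^'+) (fun t => t),
      forall t e, qI T (tv t) e = 0,
      ~ (exists2 theta : R, 3^-1 < theta & local_error_bound Om T p ne theta) &
      forall gamma0 L2 Linf CP : R,
        0 < gamma0 -> 0 < L2 -> 0 < Linf ->
        (forall e, cell_admission Om T p ne gamma0 L2 Linf e) ->
        poincare_constant Om CP ->
        (forall u, Uh Om T p u ->
           distH1 Om u (FhQ Om T p ne)
             <= Num.sqrt (1 + CP ^+ 2) * L2 * gamma0 `^ (- 3^-1)
                * vol Om `^ 3^-1 * qnorm T (qQ T ne u) `^ 3^-1) /\
        optimal_exponent Om T p ne 3^-1].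
Proof.
move=> tv; split.
- exact: (qnorm_tv_Theta HOm Hmesh Hp Hne Hes).
- exact: (distH1_tv_Theta HOm Hmesh Hp Hne Hes).
- by move=> t e; exact: (qI_tv HOm Hmesh Hp Hne Hes).
- by move=> [theta th]; exact: (no_better_exponent HOm Hmesh Hp Hne Hes).
- move=> gamma0 L2 Linf CP gamma0_gt0 L2_gt0 _ adm poincare.
  have [U /choice[gamma UP]] := choice adm.
  have bound u : Uh Om T p u -> distH1 Om u (FhQ Om T p ne) <=
      Num.sqrt (1 + CP ^+ 2) * L2 * gamma0 `^ (- 3^-1) * vol Om `^ 3^-1
        * qnorm T (qQ T ne u) `^ 3^-1.
    apply: (@distance_le _ _ _ _ _ HOm Hmesh _ U gamma) => //.
    + by move=> e i; have [/(_ i)[]] := UP e.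
    + by move=> e i x; have [/(_ i)[_ h] _ _ _ _] := UP e; exact: h.
    + by move=> e; have [] := UP e.
    + by move=> e; have [] := UP e.
    + by move=> e; have [] := UP e.
  split=> //; split; last by move=> theta th; exact: (no_better_exponent HOm Hmesh Hp Hne Hes).
  exists (Num.sqrt (1 + CP ^+ 2) * L2 * gamma0 `^ (- 3^-1) * vol Om `^ 3^-1), 1; split.
  + rewrite !mulr_gt0 ?powR_gt0 ?sqrtr_gt0//.
      by rewrite ltr_pwDl// sqr_ge0.
    rewrite (vol_Om HOm Hmesh) (bigD1 es)//= ltr_pwDl ?cellV_gt0//.
    by apply: sumr_ge0 => e _; exact/ltW/cellV_gt0.
  + exact: ltr01.
  + by move=> u uU _; exact: bound.
Qed.
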